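(* Let $G$ be a planar graph with maximum degree $\Delta\geq 12$. Then $\Delta+1\leq\lambda_2^T(G)\leq\Delta+2$.
   Context: All graphs are finite, simple and undirected. For a positive integer $k$, a $k$-(2,1)-total labelling of a graph $G$ is a function $c: V(G)\cup E(G)\to\{0,1,\dots,k\}$ such that $c(u)\neq c(v)$ whenever $uv\in E(G)$; $c(e)\neq c(e')$ whenever $e$ and $e'$ are two adjacent edges (distinct edges sharing an endpoint); and $|c(u)-c(e)|\geq 2$ whenever the vertex $u$ is incident with the edge $e$. The (2,1)-total labelling number $\lambda_2^T(G)$ is the minimum $k$ such that $G$ has a $k$-(2,1)-total labelling. *)

(* Defs.v *)
From mathcomp Require Import all_boot all_order all_algebra.
From mathcomp Require Import all_classical all_reals all_analysis.
From mathcomp Require Import zify.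
Import Order.TTheory GRing.Theory Num.Theory.
Import numFieldNormedType.Exports.

Set Implicit Arguments.
Unset Strict Implicit.
Unset Printing Implicit Defensive.

Record sgraph := SGraph {
  vertex :> finType;
  adj : rel vertex;
  adj_sym : symmetric adj;
  adj_irr : irreflexive adj }.

Definition edges (G : sgraph) : {set {set G}} :=
  [set [set u; v]%SET | u in G, v in G & adj u v]%SET.

Notation edge G := {e : {set G} | e \in edges G}.

Definition incident (G : sgraph) (v : G) (e : edge G) : bool := v \in val e.

Definition adjacent_edges (G : sgraph) (e f : edge G) : bool :=
  (e != f) && [exists v, incident v e && incident v f].

Definition degree (G : sgraph) (v : G) : nat := #|[set w | adj v w]%SET|.

Definition max_degree (G : sgraph) : nat := \max_(v : G) degree v.

(* A drawing without crossings: each edge is a simple arc, parametrized by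
   [0, 1], that joins its two ends, and the interior of an arc meets neither
   a vertex nor the interior of another arc. *)
Record plane_drawing (R : realType) (G : sgraph)
    (pos : G -> R * R) (arc : edge G -> R -> R * R) : Prop := PlaneDrawing {
  drawing_pos_inj : injective pos;
  drawing_arc_cont : forall e : edge G,
    {within `[0%R, 1%R], continuous (arc e)}%classic;
  drawing_arc_inj : forall e : edge G,
    {in `[0%R, 1%R]%R &, injective (arc e)};
  drawing_ends : forall e : edge G, exists u v : G,
    [/\ val e = [set u; v]%SET, arc e 0%R = pos u & arc e 1%R = pos v];
  drawing_avoids_vertices : forall (e : edge G) (t : R) (v : G),
    t \in `]0%R, 1%R[%R -> arc e t <> pos v;
  drawing_no_crossing : forall (e f : edge G) (s t : R), e != f ->
    s \in `]0%R, 1%R[%R -> t \in `]0%R, 1%R[%R -> arc e s <> arc f t }.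

(* Any two [realType] structures are isomorphic, so [R] is just a model of
   the real line. *)
Definition planar (R : realType) (G : sgraph) : Prop :=
  exists (pos : G -> R * R) (arc : edge G -> R -> R * R), plane_drawing pos arc.

(* [`|m - n|] below is the distance: the subtraction is taken in [int]. *)
Definition total_labelling21 (G : sgraph) (k : nat)
    (c : G + edge G -> 'I_k.+1) : bool :=
  [&& [forall u : G, forall v : G, adj u v ==> (c (inl u) != c (inl v))],
      [forall e : edge G, forall f : edge G,
         adjacent_edges e f ==> (c (inr e) != c (inr f))]
    & [forall u : G, forall e : edge G,
         incident u e ==> (2 <= `|c (inl u) - c (inr e)|)%N]].

Definition has_total_labelling21 (G : sgraph) (k : nat) : bool :=
  (0 < k)%N &&
  [exists c : {ffun (G + edge G)%type -> 'I_k.+1}, total_labelling21 c].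

(* Distinct labels on the vertices, then, after a gap, on the edges. *)
Lemma has_total_labelling21_ex (G : sgraph) :
  exists k, has_total_labelling21 G k.
Proof.
pose n := #|G|; pose m := #|{: edge G}|.
exists (n + m).+2; apply/andP; split=> //; apply/existsP.
pose f (x : G + edge G) : nat :=
  match x with inl u => enum_rank u | inr e => (n + enum_rank e).+2 end.
have fE x : @inord (n + m).+2 (f x) = f x :> nat.
  rewrite inordK // /f; case: x => x.
    by have := ltn_ord (enum_rank x); rewrite -/n; lia.
  by have := ltn_ord (enum_rank x); rewrite -/m; lia.
exists [ffun x => inord (f x)]; apply/and3P; split;
  apply/forallP => x; apply/forallP => y; apply/implyP => xy;
  rewrite !ffunE -?(inj_eq (@ord_inj _)) !fE /f.
- apply: contraTneq xy => /ord_inj/enum_rank_inj ->.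
  by rewrite adj_irr.
- rewrite !eqSS eqn_add2l; case/andP: xy => xy _.
  by apply: contra_neq xy => /ord_inj/enum_rank_inj.
- by have := ltn_ord (enum_rank x); rewrite -/n; lia.
Qed.

Definition lambda21T (G : sgraph) : nat := ex_minn (has_total_labelling21_ex G).

(* Main.v *)
Require Import Defs.
From mathcomp Require Import all_boot all_order all_algebra.
From mathcomp Require Import all_classical all_reals all_analysis.
From mathcomp Require Import zify ring lra.
From mathcomp Require Import ssrbool eqtype ssrnat seq fintype bigop finset.

Set Implicit Arguments.
Unset Strict Implicit.
Unset Printing Implicit Defensive.

(** Lower bound. At a vertex of degree D the edges carry D distinct labels, all
    at distance at least 2 from the label of the vertex; this label and one
    next to it are excluded, so [D < k] ([total_labelling_lower]).

    Upper bound. Let [M >= 12] bound the degrees, and take a graph with fewest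
    edges that has no labelling with the [M + 3] labels [0, ..., M + 2]
    ([critical]). A labelling of a smaller graph cannot be extended, so the
    graph contains none of the configurations around which an extension always
    exists. Write d for the degree. An edge at a vertex of degree at most 3
    has degree sum at least [M + 2] ([low_vertex_edge]); the neighbours of a
    4-vertex have degree at least 8 ([four_vertex_edge]); a 5-vertex has at
    most three neighbours of degree at most 7, and if there are three of them
    they all have degree exactly 7 ([five_vertex_low_nbrs]). In each case the
    edges from the vertex to the neighbours in question are erased together
    with its label, and a Hall type argument restores them. Finally the
    vertices of degree at most 3 are outnumbered by those of degree [M] and
    [M - 1] ([few_low_vertices]): otherwise an augmenting path argument yields
    a set of low vertices all of whose neighbours are saturated, and the edges
    at this set can be erased and coloured again from lists, by the stable
    matching argument of Galvin.

    These facts contradict two consequences of planarity, as [no_critical]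
    shows: a planar graph on [n > 0] vertices has less than [3 n] edges, and a
    bipartite one has at most [2 n]. The first is applied to the vertices of
    degree at least 3, the second to the edges between vertices of degree 3, 4,
    5 and vertices of degree at least 8, to which the 7-vertices with several
    tight 5-neighbours are added. Adding the two inequalities gives each vertex
    a charge ([vertex_charge]), and the charges add up to a nonnegative number.

    Edge bounds. They hold for all graphs without K5 minor and K33 minor. The
    first follows Mader: contract an edge with at most two common neighbours;
    when there is none, a vertex of degree at most 5 has a neighbourhood that is
    almost complete ([K5_minor_of_arcs]). For the second, either two
    neighbours of a 3-vertex can be identified, or some K_{2,3} appears, whose
    complement either completes a K33 minor or is cut off by a 4-cycle
    ([K33_minor_of_arcs]).

    Minors of plane graphs. Approximate the arcs by polygonal chains, so fine
    that chains of disjoint edges stay far apart ([drawing_flat]). Crossings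
    modulo 2 of a chain with an infinitesimally shifted chain form a bilinear
    form that vanishes on closed chains ([chain_cross_closed]). For four chains
    that leave a point, the crossings summed over the three ways of pairing the
    chains are odd ([star_cross]). In a drawing of K5, and similarly of K33, the
    pairs close up to cycles whose other edges are disjoint, so that the sum
    would be even ([flat_no_K5], [flat_no_K33]). As only the images of disjoint
    edges have to be disjoint, the argument also covers minors, whose edges are
    drawn along paths that overlap. *)

(** * Crossing parity of polygonal chains *)

Section Crossing.
Import Order.TTheory GRing.Theory Num.Theory.
Variable R : realDomainType.
Local Open Scope ring_scope.
Implicit Types (z w a b : R * R) (s t : (R * R) * (R * R)).
Implicit Types (c d : seq ((R * R) * (R * R))).

(** The step [s] is drawn as an L: horizontally first, then vertically. This is
    the parity of the crossings of the L of [s] with the L of [t] moved by an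
    infinitesimal vector towards the upper right: each inequality is strict or
    weak according to how this shift breaks a tie. *)
Definition step_cross s t : bool :=
  let: ((x, y), (x', y')) := s in let: ((u, v), (u', v')) := t in
  (((x <= u') (+) (x' <= u')) && ((v < y) (+) (v' < y)))
  (+) (((u < x') (+) (u' < x')) && ((y <= v) (+) (y' <= v))).

(** Crossings of the L of [s] with the ray that leaves the shifted point [w] to
    the right. *)
Definition step_ray s w : bool :=
  let: ((x, y), (x', y')) := s in let: (u, v) := w in
  (u < x') && ((y <= v) (+) (y' <= v)).

(** Crossings of the L of [s] with a short path through the lower right of [w],
    from [w] moved towards the lower left to [w] moved towards the upper right. *)
Definition step_diag s w : bool :=
  let: ((x, y), (x', y')) := s in let: (u, v) := w in
  ((x' == u) && ((y < v) (+) (y' < v)))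
  (+) ((y == v) && ((x <= u) (+) (x' <= u))).

(** Winding parity at [w] of the band swept by [s] when its shift changes from
    the lower left to the upper right. *)
Definition step_band s w : bool :=
  let: ((u, v), (u', v')) := s in let: (x, y) := w in
  ((y == v) && ((x < u') (+) (x <= u)))
  (+) ((x == u') && ((v < y) (+) (v' <= y))).

(** Moving a point along [t] changes its ray crossings with [s] by the crossings
    of [s] and [t], up to a term that depends on the ends of [s] only and
    disappears when [s] runs through a closed chain. *)
Lemma step_ray_cross t :
  exists g : R * R -> bool, forall s,
    step_ray s t.1 (+) step_ray s t.2 (+) step_cross s t = g s.1 (+) g s.2.
Proof.
case: t => [[u v] [u' v']] /=.
exists (fun z => (u' < z.1) && ((z.2 <= v) (+) (z.2 <= v'))) => -[[x y] [x' y']] /=.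
rewrite (ltNge v) (ltNge v') (leNgt x u') (leNgt x' u').
by case: (u < x') (u' < x') (u' < x) (y <= v) (y <= v') (y' <= v) (y' <= v')
  => [] [] [] [] [] [] [].
Qed.

(** The identities below depend on the signs of a few coordinate differences
    only; they are checked on all sign patterns at once. *)
Definition signs3 (P : comparison -> bool) := [&& P Lt, P Eq & P Gt].
Lemma signs3P P : signs3 P -> forall o, P o.
Proof. by case/and3P => ? ? ? []. Qed.

Definition sign_of (x u : R) : comparison :=
  if x < u then Lt else if x == u then Eq else Gt.
Definition is_lt o := if o is Lt then true else false.
Definition is_eq o := if o is Eq then true else false.
Definition is_gt o := if o is Gt then true else false.

Lemma sign_ofE x u :
  ((x < u) = is_lt (sign_of x u)) * ((u < x) = is_gt (sign_of x u)) *
  ((x == u) = is_eq (sign_of x u)) * ((u == x) = is_eq (sign_of x u)) *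
  ((x <= u) = ~~ is_gt (sign_of x u)) * ((u <= x) = ~~ is_lt (sign_of x u)).
Proof. by rewrite /sign_of; case: (ltgtP x u). Qed.

Definition signs8 P := signs3 (fun o1 => signs3 (fun o2 => signs3 (fun o3 =>
  signs3 (fun o4 => signs3 (fun o5 => signs3 (fun o6 => signs3 (fun o7 =>
  signs3 (P o1 o2 o3 o4 o5 o6 o7)))))))).

Lemma signs8P P : signs8 P ->
  forall o1 o2 o3 o4 o5 o6 o7 o8, P o1 o2 o3 o4 o5 o6 o7 o8.
Proof.
move=> H o1 o2 o3 o4 o5 o6 o7 o8.
exact: (signs3P (signs3P (signs3P (signs3P (signs3P (signs3P (signs3P
  (signs3P H o1) o2) o3) o4) o5) o6) o7) o8).
Qed.

(** Crossing with a shift of [t] and crossing with a shift of [s] differ by the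
    boundary terms of the homotopy between the two opposite shifts. *)
Lemma step_cross_swap s t :
  step_cross s t (+) step_cross t s =
  step_diag s t.1 (+) step_diag s t.2 (+) (step_band t s.1 (+) step_band t s.2).
Proof.
case: s t => [[x y] [x' y']] [[u v] [u' v']] /=; apply/eqP.
rewrite !(sign_ofE x u) !(sign_ofE x u') !(sign_ofE x' u) !(sign_ofE x' u').
rewrite !(sign_ofE y v) !(sign_ofE y v') !(sign_ofE y' v) !(sign_ofE y' v').
move: (sign_of x u) (sign_of x u') (sign_of x' u) (sign_of x' u')
  (sign_of y v) (sign_of y v') (sign_of y' v) (sign_of y' v').
by apply: signs8P; vm_compute.
Qed.

(** Away from the ends of the step, the short path through [z] crosses the step if
    and only if the band winds around [z]; at an end exactly one of the two
    happens. *)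
Lemma step_diag_band s z :
  step_diag s z (+) step_band s z = (s.1 == z) (+) (s.2 == z).
Proof.
case: s z => [[u v] [u' v']] [x y] /=.
rewrite !xpair_eqE !(sign_ofE u x) !(sign_ofE u' x) !(sign_ofE v y) !(sign_ofE v' y).
by case: (sign_of u x) (sign_of u' x) (sign_of v y) (sign_of v' y) => [] [] [] [].
Qed.

Definition chain_sum c (f : (R * R) * (R * R) -> bool) : bool :=
  \big[addb/false]_(s <- c) f s.

Definition chain_cross c d := chain_sum c (fun s => chain_sum d (step_cross s)).
Definition chain_diag c z := chain_sum c (step_diag^~ z).
Definition chain_band c z := chain_sum c (step_band^~ z).

(** The boundary of the chain modulo 2 is [a + b]: 0-chains are tested against all
    functions on points. *)
Definition chain_bound c a b :=
  forall g : R * R -> bool, chain_sum c (fun s => g s.1 (+) g s.2) = g a (+) g b.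

Lemma chain_sumD c f g :
  chain_sum c (fun s => f s (+) g s) = chain_sum c f (+) chain_sum c g.
Proof. exact: big_split. Qed.

Lemma chain_sum_eq c f g : f =1 g -> chain_sum c f = chain_sum c g.
Proof. by move=> fg; apply: eq_bigr => s _; apply: fg. Qed.

Lemma chain_sum_exchange c d (f : (R * R) * (R * R) -> (R * R) * (R * R) -> bool) :
  chain_sum c (fun s => chain_sum d (f s)) =
  chain_sum d (fun t => chain_sum c (f^~ t)).
Proof. exact: exchange_big. Qed.

Lemma chain_sum_cat c d f : chain_sum (c ++ d) f = chain_sum c f (+) chain_sum d f.
Proof. exact: big_cat. Qed.

Lemma chain_crossDl c c' d :
  chain_cross (c ++ c') d = chain_cross c d (+) chain_cross c' d.
Proof. exact: chain_sum_cat. Qed.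

Lemma chain_crossDr c d d' :
  chain_cross c (d ++ d') = chain_cross c d (+) chain_cross c d'.
Proof.
by rewrite /chain_cross -chain_sumD; apply: chain_sum_eq => s; apply: chain_sum_cat.
Qed.

Lemma chain_bound_cat c d a b e :
  chain_bound c a b -> chain_bound d b e -> chain_bound (c ++ d) a e.
Proof.
by move=> cab dbe g; rewrite chain_sum_cat cab dbe; case: (g a) (g b) (g e) => [] [] [].
Qed.

Lemma chain_bound_sym c a b : chain_bound c a b -> chain_bound c b a.
Proof. by move=> cab g; rewrite cab addbC. Qed.

(** The ray crossings of a point with the closed chain [c] are a function of the
    point, and the crossings with [d] telescope along [d]. *)
Lemma chain_cross_closed c d a b :
  chain_bound c a a -> chain_bound d b b -> chain_cross c d = false.
Proof.
move=> ca db; rewrite /chain_cross chain_sum_exchange.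
pose W w := chain_sum c (step_ray^~ w).
have E t : chain_sum c (step_cross^~ t) = W t.1 (+) W t.2.
  have [g gE] := step_ray_cross t.
  have := ca g; rewrite addbb -(chain_sum_eq c gE) !chain_sumD -/(W _) -/(W _).
  by case: (W _) (W _) (chain_sum _ _) => [] [] [].
by rewrite (chain_sum_eq d E) db addbb.
Qed.

Lemma chain_cross_swap c d a a' b b' :
  chain_bound c a a' -> chain_bound d b b' ->
  chain_cross c d (+) chain_cross d c =
  chain_diag c b (+) chain_diag c b' (+) (chain_band d a (+) chain_band d a').
Proof.
move=> ca db.
rewrite {2}/chain_cross chain_sum_exchange /chain_cross -chain_sumD.
under chain_sum_eq => s do rewrite -chain_sumD (chain_sum_eq d (step_cross_swap s)) chain_sumD.
rewrite chain_sumD -db -ca; congr (_ (+) _).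
  rewrite chain_sum_exchange; apply: chain_sum_eq => t; exact: chain_sumD.
by apply: chain_sum_eq => s; apply: chain_sumD.
Qed.

Lemma chain_diag_band c a b z : chain_bound c a b ->
  chain_diag c z (+) chain_band c z = (a == z) (+) (b == z).
Proof.
move=> cab; rewrite /chain_diag /chain_band -chain_sumD -(cab (pred1 z)).
by apply: chain_sum_eq => s; apply: step_diag_band.
Qed.

(** Both chains leave [q] on one of the two sides of the diagonal through [q];
    their symmetrized crossing parity only says whether the sides agree. *)
Lemma star_pair q c d a b : a != q -> b != q ->
  chain_bound c q a -> chain_bound d q b ->
  chain_diag c b = false -> chain_band d a = false ->
  chain_cross c d (+) chain_cross d c = chain_diag c q (+) ~~ chain_diag d q.
Proof.
move=> aq bq cqa dqb cb da.
have := chain_diag_band q dqb; rewrite eqxx (negPf bq) /=.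
rewrite (chain_cross_swap cqa dqb) cb da !addbF.
by case: (chain_diag d q) (chain_band d q) => [] [].
Qed.

(** Bilinearity reduces the sum to the symmetrized crossings of the three pairs
    among [c2], [c3], [c4]. By [star_pair] it counts the pairs of chains that
    leave [q] on the same side, and among three chains and two sides this number
    is odd. *)
Lemma star_cross q c1 c2 c3 c4 a2 a3 a4 :
  a2 != q -> a3 != q -> a4 != q ->
  chain_bound c2 q a2 -> chain_bound c3 q a3 -> chain_bound c4 q a4 ->
  chain_diag c2 a3 = false -> chain_diag c2 a4 = false ->
  chain_diag c3 a4 = false ->
  chain_band c3 a2 = false -> chain_band c4 a2 = false ->
  chain_band c4 a3 = false ->
  chain_cross (c1 ++ c2) (c3 ++ c4) (+) chain_cross (c1 ++ c3) (c2 ++ c4)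
    (+) chain_cross (c1 ++ c4) (c2 ++ c3) = true.
Proof.
move=> q2 q3 q4 b2 b3 b4 d23 d24 d34 e32 e42 e43.
have := star_pair q2 q3 b2 b3 d23 e32.
have := star_pair q2 q4 b2 b4 d24 e42.
have := star_pair q3 q4 b3 b4 d34 e43.
rewrite !chain_crossDl !chain_crossDr.
move: (chain_cross c2 c3) (chain_cross c2 c4) (chain_cross c3 c4) => x23 x24 x34.
move: (chain_cross c3 c2) (chain_cross c4 c2) (chain_cross c4 c3) => x32 x42 x43.
move: (chain_cross c1 c2) (chain_cross c1 c3) (chain_cross c1 c4) => x12 x13 x14.
move: (chain_diag c2 q) (chain_diag c3 q) (chain_diag c4 q) => z2 z3 z4.
move/(canRL (addbK _)) => -> /(canRL (addbK _)) -> /(canRL (addbK _)) ->.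
by case: x12 x13 x14 x32 x42 x43 z2 z3 z4 => [] [] [] [] [] [] [] [] [].
Qed.

Definition sup_close (e : R) z w := (`|z.1 - w.1| <= e) && (`|z.2 - w.2| <= e).

Lemma sup_closeE e z w : sup_close e z w =
  [&& z.1 <= w.1 + e, w.1 <= z.1 + e, z.2 <= w.2 + e & w.2 <= z.2 + e].
Proof.
by rewrite /sup_close !ler_distl !lerBlDr andbC [X in _ && X]andbC -!andbA; do ![case: (_ <= _)].
Qed.

Lemma addb_orb (p q : bool) : p (+) q -> p || q. Proof. by case: p q => [] []. Qed.

Lemma step_cross_close e s t : sup_close e s.1 s.2 -> sup_close e t.1 t.2 ->
  step_cross s t -> sup_close e s.1 t.2 || sup_close e s.2 t.1.
Proof.
case: s t => [[x y] [x' y']] [[u v] [u' v']]; rewrite !sup_closeE /=.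
move=> /and4P[? ? ? ?] /and4P[? ? ? ?] /addb_orb/orP[]/andP[].
  case: (lerP x u') (lerP x' u') (ltrP v y) (ltrP v' y) => [] ? [] ? [] ? [] ? // _ _;
  by apply/orP; left; apply/and4P; split; lra.
case: (ltrP u x') (ltrP u' x') (lerP y v) (lerP y' v) => [] ? [] ? [] ? [] ? // _ _;
by apply/orP; right; apply/and4P; split; lra.
Qed.

Lemma step_diag_close e s w : sup_close e s.1 s.2 ->
  step_diag s w -> sup_close e s.1 w || sup_close e s.2 w.
Proof.
case: s w => [[x y] [x' y']] [u v]; rewrite !sup_closeE /=.
move=> /and4P[? ? ? ?] /addb_orb/orP[]/andP[/eqP ->].
  case: (ltrP y v) (ltrP y' v) => [] ? [] ? // _;
  by apply/orP; right; apply/and4P; split; lra.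
case: (lerP x u) (lerP x' u) => [] ? [] ? // _;
by apply/orP; left; apply/and4P; split; lra.
Qed.

Lemma step_band_close e s w : sup_close e s.1 s.2 ->
  step_band s w -> sup_close e s.1 w || sup_close e s.2 w.
Proof.
case: s w => [[u v] [u' v']] [x y]; rewrite !sup_closeE /=.
move=> /and4P[? ? ? ?] /addb_orb/orP[]/andP[/eqP ->].
  case: (ltrP x u') (lerP x u) => [] ? [] ? // _;
  by apply/orP; left; apply/and4P; split; lra.
case: (ltrP v y) (lerP v' y) => [] ? [] ? // _;
by apply/orP; right; apply/and4P; split; lra.
Qed.

End Crossing.

(** * Minors and flat drawings *)

Definition inside (T : finType) (S : {set T}) (e : rel T) : rel T :=
  [rel x y | [&& x \in S, y \in S & e x y]].

(** [B u] is the branch set of [u]; the host graph is the restriction of [e] to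
    the set [W], so that vertices can be deleted and merged inside one type. *)
Definition has_minor (T U : finType) (W : {set T}) (e : rel T) (k : rel U) : Prop :=
  exists B : U -> {set T},
    [/\ forall u, B u \subset W,
        forall u, B u != set0,
        forall u x y, x \in B u -> y \in B u -> connect (inside (B u) e) x y,
        forall u v x, x \in B u -> x \in B v -> u = v &
        forall u v, k u v -> exists x y, [/\ x \in B u, y \in B v & e x y]].

Definition K5 : rel 'I_5 := [rel i j | i != j].
Definition K33 : rel (bool * 'I_3) := [rel p q | p.1 != q.1].

Section FlatDrawing.
Import Order.TTheory GRing.Theory Num.Theory.
Variables (R : realDomainType) (T : finType) (e : rel T).
Variables (pos : T -> R * R) (arc : T -> T -> seq ((R * R) * (R * R))).

(** What remains of a polygonal drawing: only chains of vertex-disjoint edges are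
    required not to cross, and chains may run into themselves and into chains
    with a common end. The last condition says that a vertex is far from the
    edges that avoid it. *)
Record flat_drawing : Prop := FlatDrawing {
  flat_inj : injective pos;
  flat_bound : forall u v, e u v -> chain_bound (arc u v) (pos u) (pos v);
  flat_cross : forall u v w z, e u v -> e w z ->
    u != w -> u != z -> v != w -> v != z -> chain_cross (arc u v) (arc w z) = false;
  flat_off : forall u v w, e u v -> w != u -> w != v ->
    chain_diag (arc u v) (pos w) = false /\ chain_band (arc u v) (pos w) = false }.

Hypothesis flat : flat_drawing.
Implicit Types (S : {set T}) (d : seq ((R * R) * (R * R))).

(** Chains that follow edges of the graph induced on [S]. *)
Inductive carried S : seq ((R * R) * (R * R)) -> Prop :=
| carried_nil : carried S [::]
| carried_cons u v d : u \in S -> v \in S -> e u v -> carried S d ->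
    carried S (arc u v ++ d).

Lemma carried_cat S d d' : carried S d -> carried S d' -> carried S (d ++ d').
Proof.
by move=> cd cd'; elim: cd => //= u v d1 uS vS uv _ IH; rewrite -catA; apply: carried_cons.
Qed.

Lemma carriedS S S' d : S \subset S' -> carried S d -> carried S' d.
Proof.
move=> /subsetP sub; elim=> [|u v d1 uS vS uv _ IH]; first exact: carried_nil.
by apply: carried_cons => //; apply: sub.
Qed.

Lemma chain_cross0r d : chain_cross d [::] = false.
Proof.
rewrite /chain_cross /chain_sum; apply: big1 => s _; exact: big_nil.
Qed.

Lemma carried_cross S S' d d' : [disjoint S & S'] ->
  carried S d -> carried S' d' -> chain_cross d d' = false.
Proof.
move=> dis; have ne x y : x \in S -> y \in S' -> x != y.
  by move=> xS yS'; apply: contraTneq yS' => <-; rewrite (disjointFr dis xS).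
elim=> [|u v d1 uS vS uv _ IH] cd'; first by rewrite /chain_cross /chain_sum big_nil.
rewrite chain_crossDl IH // addbF.
elim: cd' => [|w z d2 wS zS wz _ IH']; first exact: chain_cross0r.
by rewrite chain_crossDr IH' addbF (flat_cross flat) ?ne.
Qed.

Lemma carried_off S d w : w \notin S -> carried S d ->
  chain_diag d (pos w) = false /\ chain_band d (pos w) = false.
Proof.
move=> wS; elim=> [|u v d1 uS vS uv _ [IH1 IH2]].
  by rewrite /chain_diag /chain_band /chain_sum !big_nil.
have [wu wv] : w != u /\ w != v by split; apply: contraNneq wS => ->.
have [h1 h2] := flat_off flat uv wu wv.
by rewrite /chain_diag /chain_band !chain_sum_cat -/(chain_diag _ _)
  -/(chain_band _ _) -/(chain_diag _ _) -/(chain_band _ _) h1 h2 IH1 IH2.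
Qed.

Lemma chain_bound_nil (a : R * R) : chain_bound [::] a a.
Proof. by move=> g; rewrite /chain_sum big_nil addbb. Qed.

Lemma carried_connect S x y : connect (inside S e) x y ->
  exists2 d, carried S d & chain_bound d (pos x) (pos y).
Proof.
case/connectP => p; elim: p x => [|z p IH] x /=.
  by move=> _ ->; exists [::]; [exact: carried_nil|exact: chain_bound_nil].
case/andP=> /and3P[xS zS xz] pth lst.
have [d cd bd] := IH _ pth lst; exists (arc x z ++ d); first exact: carried_cons.
exact: chain_bound_cat (flat_bound flat xz) bd.
Qed.

Section Model.
Variables (U : finType) (k : rel U) (B : U -> {set T}).
Hypothesis B0 : forall u, B u != set0.
Hypothesis Bconn : forall u x y, x \in B u -> y \in B u -> connect (inside (B u) e) x y.
Hypothesis Bdisj : forall u v x, x \in B u -> x \in B v -> u = v.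
Hypothesis Bedge : forall u v, k u v -> exists x y, [/\ x \in B u, y \in B v & e x y].

(** Each edge of the minor is drawn along a path through the two branch sets,
    between chosen roots, so that disjoint edges are drawn along disjoint sets
    of vertices. *)
Lemma model_chains : exists (r : U -> T) (P : U -> U -> seq ((R * R) * (R * R))),
  (forall u, r u \in B u) /\
  (forall u v, k u v -> carried (B u :|: B v) (P u v) /\
     chain_bound (P u v) (pos (r u)) (pos (r v))).
Proof.
have /fin_all_exists[r rB] : forall u, exists x, x \in B u.
  by move=> u; apply/set0Pn.
exists r.
suff /fin_all_exists[P PP] : forall p : U * U, exists d, k p.1 p.2 ->
    carried (B p.1 :|: B p.2) d /\ chain_bound d (pos (r p.1)) (pos (r p.2)).
  by exists (fun u v => P (u, v)); split=> // u v; apply: (PP (u, v)).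
case=> u v /=; case kuv: (k u v); last by exists [::].
have [x [y [xu yv xy]]] := Bedge kuv.
have [d1 c1 b1] := carried_connect (Bconn (rB u) xu).
have [d2 c2 b2] := carried_connect (Bconn yv (rB v)).
exists (d1 ++ arc x y ++ d2) => _; split.
  apply: carried_cat; first by apply: carriedS c1; apply: subsetUl.
  apply: carried_cons; rewrite ?inE ?xu ?yv ?orbT //.
  by apply: carriedS c2; apply: subsetUr.
by apply: chain_bound_cat b1 _; apply: chain_bound_cat b2; apply: (flat_bound flat).
Qed.

Lemma model_disjoint u v w z : u != w -> u != z -> v != w -> v != z ->
  [disjoint B u :|: B v & B w :|: B z].
Proof.
move=> uw uz vw vz; apply/pred0P => x /=; rewrite !inE.
apply/negP => /andP[/orP[]xu /orP[]xw];
  by rewrite (Bdisj xu xw) eqxx in uw uz vw vz.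
Qed.

Lemma model_notin r w u v : (forall u, r u \in B u) -> w != u -> w != v ->
  r w \notin B u :|: B v.
Proof.
move=> rB wu wv; rewrite inE; apply/norP; split;
  [apply: contraNN wu | apply: contraNN wv] => h; apply/eqP; exact: Bdisj h.
Qed.

End Model.

(** Two closed chains through [q] cross evenly; if the sides opposite to [q] cross
    nothing on the other chain, so do the four chains at [q]. *)
Lemma two_cycles_cross q a b a' b' (ca cb cab ca' cb' cab' : seq ((R * R) * (R * R))) :
  chain_bound ca q a -> chain_bound cb q b -> chain_bound cab a b ->
  chain_bound ca' q a' -> chain_bound cb' q b' -> chain_bound cab' a' b' ->
  chain_cross cab ca' = false -> chain_cross cab cb' = false ->
  chain_cross ca cab' = false -> chain_cross cb cab' = false ->
  chain_cross cab cab' = false ->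
  chain_cross (ca ++ cb) (ca' ++ cb') = false.
Proof.
move=> Ba Bb Bab Ba' Bb' Bab' h1 h2 h3 h4 h5.
have cl : chain_bound (ca ++ (cab ++ cb)) q q.
  by apply: chain_bound_cat Ba _; apply: chain_bound_cat Bab _; apply: chain_bound_sym.
have cl' : chain_bound (ca' ++ (cab' ++ cb')) q q.
  by apply: chain_bound_cat Ba' _; apply: chain_bound_cat Bab' _; apply: chain_bound_sym.
have := chain_cross_closed cl cl'.
by rewrite !chain_crossDl !chain_crossDr h1 h2 h3 h4 h5 /= ?addbF.
Qed.

(** In the star at a vertex of K5, each pairing of the four other vertices
    closes to two triangles that meet at the centre only. *)
Theorem flat_no_K5 : ~ has_minor [set: T] e K5.
Proof.
case=> B [_ B0 Bc Bd Be].
have [r [P [rB PP]]] := model_chains B0 Bc Be.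
have rne i j : i != j -> pos (r i) != pos (r j).
  by apply: contraNN => /eqP/(flat_inj flat) h; apply/eqP/(Bd _ _ (r i)); rewrite // h.
have Pc i j : i != j -> carried (B i :|: B j) (P i j) by move=> /PP[].
have Pb i j : i != j -> chain_bound (P i j) (pos (r i)) (pos (r j)) by move=> /PP[].
have P0 i j l m : i != j -> l != m -> i != l -> i != m -> j != l -> j != m ->
    chain_cross (P i j) (P l m) = false.
  move=> ij lm il im jl jm.
  by apply: carried_cross (Pc _ _ ij) (Pc _ _ lm); apply: model_disjoint.
have Poff i j l : i != j -> l != i -> l != j ->
    chain_diag (P i j) (pos (r l)) = false /\ chain_band (P i j) (pos (r l)) = false.
  by move=> ij li lj; apply: carried_off (Pc _ _ ij); apply: model_notin.
have Z q i j l m : uniq [:: q; i; j; l; m] ->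
    chain_cross (P q i ++ P q j) (P q l ++ P q m) = false.
  rewrite /= !inE !negb_or -!andbA => /and5P[qi qj ql qm /and5P[ij il im jl /and3P[jm lm _]]].
  apply: (two_cycles_cross (Pb _ _ qi) (Pb _ _ qj) (Pb _ _ ij) (Pb _ _ ql) (Pb _ _ qm) (Pb _ _ lm));
  by apply: P0 => //; rewrite eq_sym.
pose o n : 'I_5 := inord n.
have no i j : i < 5 -> j < 5 -> (o i == o j) = (i == j).
  by move=> i5 j5; rewrite -(inj_eq val_inj) /= !inordK.
have Of i j : i < 5 -> j < 5 -> i != 0 -> j != 0 -> i != j ->
    chain_diag (P (o 0) (o i)) (pos (r (o j))) = false /\
    chain_band (P (o 0) (o i)) (pos (r (o j))) = false.
  by move=> i5 j5 i0 j0 ij; apply: Poff; rewrite no // eq_sym.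
have := @star_cross R (pos (r (o 0))) (P (o 0) (o 1)) (P (o 0) (o 2)) (P (o 0) (o 3))
  (P (o 0) (o 4)) (pos (r (o 2))) (pos (r (o 3))) (pos (r (o 4))).
rewrite !Z; do ?[by rewrite /= !inE !no].
move=> h; suff: false (+) false (+) false = true by [].
by apply: h; first [by apply: rne; rewrite no|by apply: Pb; rewrite no|by apply Of].
Qed.

(** The star has its centre in [a 0] and leads to [a 1], [a 2] through [b 0], and to
    [b 1], [b 2] directly, as in the wheel obtained by contracting the edge
    between [a 0] and [b 0]. Two pairings close to pairs of triangles of the wheel;
    in the third one the chains to [a 1] and [a 2] share the edge that was
    contracted, which cancels modulo 2. *)
Theorem flat_no_K33 : ~ has_minor [set: T] e K33.
Proof.
case=> B [_ B0 Bc Bd Be].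
have [r [P [rB PP]]] := model_chains B0 Bc Be.
have rne i j : i != j -> pos (r i) != pos (r j).
  by apply: contraNN => /eqP/(flat_inj flat) h; apply/eqP/(Bd _ _ (r i)); rewrite // h.
have Pc i j : K33 i j -> carried (B i :|: B j) (P i j) by move=> /PP[].
have Pb i j : K33 i j -> chain_bound (P i j) (pos (r i)) (pos (r j)) by move=> /PP[].
have P0 i j l m : K33 i j -> K33 l m -> i != l -> i != m -> j != l -> j != m ->
    chain_cross (P i j) (P l m) = false.
  move=> ij lm il im jl jm.
  by apply: carried_cross (Pc _ _ ij) (Pc _ _ lm); apply: model_disjoint.
have Poff i j l : K33 i j -> l != i -> l != j ->
    chain_diag (P i j) (pos (r l)) = false /\ chain_band (P i j) (pos (r l)) = false.
  by move=> ij li lj; apply: carried_off (Pc _ _ ij); apply: model_notin.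
pose a n : bool * 'I_3 := (true, inord n); pose b n : bool * 'I_3 := (false, inord n).
have no i j : i < 3 -> j < 3 -> (inord i == inord j :> 'I_3) = (i == j).
  by move=> i5 j5; rewrite -(inj_eq val_inj) /= !inordK.
have ab i j : a i != b j by [].
have ba i j : b i != a j by [].
have aa i j : i < 3 -> j < 3 -> (a i == a j) = (i == j) by move=> ? ?; rewrite xpair_eqE /= no.
have bb i j : i < 3 -> j < 3 -> (b i == b j) = (i == j) by move=> ? ?; rewrite xpair_eqE /= no.
pose c i := P (a 0) (b 0) ++ P (b 0) (a i).
have cb i : chain_bound (c i) (pos (r (a 0))) (pos (r (a i))).
  by apply: (chain_bound_cat (Pb _ _ _) (Pb _ _ _)).
have Z i j l m : i \in [:: 1; 2] -> j \in [:: 1; 2] -> l \in [:: 1; 2] -> m \in [:: 1; 2] ->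
    i != l -> j != m ->
    chain_cross (c i ++ P (a 0) (b j)) (c l ++ P (a 0) (b m)) = false.
  move=> hi hj hl hm il jm.
  have [i3 j3 l3 m3] : [/\ i < 3, j < 3, l < 3 & m < 3].
    by move: hi hj hl hm; rewrite !inE; do 4![case/orP=> /eqP ->].
  have [i0 j0 l0 m0] : [/\ 0 != i, 0 != j, 0 != l & 0 != m].
    by move: hi hj hl hm; rewrite !inE; do 4![case/orP=> /eqP ->].
  have [li mj] : l != i /\ m != j by rewrite eq_sym il eq_sym jm.
  apply: (two_cycles_cross (cb i) (Pb (a 0) (b j) _) (Pb (a i) (b j) _) (cb l)
    (Pb (a 0) (b m) _) (Pb (a l) (b m) _)) => //;
  rewrite /c ?chain_crossDl ?chain_crossDr ?P0 //; by rewrite ?aa ?bb // eq_sym.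
have O i j : 0 < i < 3 -> 0 < j < 3 ->
    chain_diag (c i) (pos (r (b j))) = false /\ chain_band (P (a 0) (b j)) (pos (r (a i))) = false.
  move=> /andP[i0 i3] /andP[j0 j3]; rewrite /chain_diag chain_sum_cat -!/(chain_diag _ _).
  rewrite (Poff (a 0) (b 0) (b j) _ _ _).1 ?(Poff (b 0) (a i) (b j) _ _ _).1 //; last first.
  - by rewrite bb // -lt0n.
  - by rewrite bb // -lt0n.
  - by split=> //; apply: (Poff _ _ _ _ _ _).2; rewrite // aa // -lt0n.
have O2 i j : 0 < i < 3 -> 0 < j < 3 -> i != j ->
    chain_diag (P (a 0) (b i)) (pos (r (b j))) = false /\ chain_band (P (a 0) (b i)) (pos (r (b j))) = false.
  by move=> /andP[i0 i3] /andP[j0 j3] ij; apply: Poff; rewrite // bb // eq_sym.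
have := @star_cross R (pos (r (a 0))) (c 1) (c 2) (P (a 0) (b 1)) (P (a 0) (b 2))
  (pos (r (a 2))) (pos (r (b 1))) (pos (r (b 2))).
rewrite !Z //.
have -> : chain_cross (c 1 ++ c 2) (P (a 0) (b 1) ++ P (a 0) (b 2)) = false.
  rewrite /c !chain_crossDl !chain_crossDr.
  rewrite !(P0 (b 0) (a 1)) ?(P0 (b 0) (a 2)) ?addbF ?addbb //; by rewrite ?aa ?bb.
move=> h; suff: false (+) false (+) false = true by [].
by apply: h; first [by apply: rne; rewrite ?aa|by apply: Pb|by apply: cb|by apply O|by apply O2].
Qed.

End FlatDrawing.

(** * Edge counts under deletion and merging *)

Section Minors.
Variable T : finType.
Implicit Types (W : {set T}) (e : rel T).

Lemma inside_sym S e : symmetric e -> symmetric (inside S e).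
Proof. by move=> se x y; rewrite /inside /= se andbCA. Qed.

Lemma has_minorS (U : finType) (k : rel U) W W' e e' :
  W' \subset W -> (forall x y, x \in W' -> y \in W' -> e' x y -> e x y) ->
  has_minor W' e' k -> has_minor W e k.
Proof.
move=> sW se [B [BW B0 Bc Bd Be]]; exists B; split=> //.
- by move=> u; apply: subset_trans sW.
- move=> u x y xu yu; apply: connect_sub (Bc u x y xu yu) => a b /and3P[au bu ab].
  by apply: connect1; rewrite /inside /= au bu se // (subsetP (BW u)).
- move=> u v /Be[x [y [xu yv xy]]]; exists x, y; split=> //.
  by apply: se => //; [apply: (subsetP (BW u))|apply: (subsetP (BW v))].
Qed.

(** A graph whose vertices are the connected fibres of [f] is a minor, and minors
    of minors are minors. *)
Lemma has_minor_lift (U : finType) (k : rel U) W W' e e' (f : T -> T) :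
  symmetric e ->
  (forall y, y \in W' -> exists2 x, x \in W & f x = y) ->
  (forall x x', x \in W -> x' \in W -> f x \in W' -> f x = f x' ->
     connect (inside [set z in W | f z == f x] e) x x') ->
  (forall x y, x \in W' -> y \in W' -> e' x y ->
     exists x' y', [/\ x' \in W, y' \in W, f x' = x, f y' = y & e x' y']) ->
  has_minor W' e' k -> has_minor W e k.
Proof.
move=> syme surj fib lift [B [BW B0 Bc Bd Be]].
exists (fun u => [set z in W | f z \in B u]).
have inB u x : x \in [set z in W | f z \in B u] -> x \in W /\ f x \in B u.
  by rewrite inE => /andP[].
split.
- by move=> u; apply/subsetP => x /inB[].
- move=> u; have [y yu] := set0Pn _ (B0 u).
  have [x xW fx] := surj y (subsetP (BW u) y yu).
  by apply/set0Pn; exists x; rewrite inE xW fx.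
- move=> u x y /inB[xW xu] /inB[yW yu].
  have fibc a b : a \in W -> b \in W -> f a \in B u -> f a = f b ->
      connect (inside [set z in W | f z \in B u] e) a b.
    move=> aW bW au ab; have := fib a b aW bW (subsetP (BW u) _ au) ab.
    apply: connect_sub => c d; rewrite /inside /= !inE.
    move=> /and3P[/andP[cW /eqP fc] /andP[dW /eqP fd] cd]; apply: connect1.
    by rewrite /= !inE cW dW cd fc fd au.
  have /connectP[p] := Bc u _ _ xu yu.
  elim: p x xW xu => [|z p IH] x xW xu /=; first by move=> _ E; apply: fibc.
  case/andP=> /and3P[_ zu fxz] pth lst.
  have [x' [z' [x'W z'W fx' fz' x'z']]] :=
    lift _ _ (subsetP (BW u) _ xu) (subsetP (BW u) _ zu) fxz.
  apply: connect_trans (fibc x x' xW x'W xu (esym fx')) _.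
  apply: connect_trans (connect1 _) (IH z' z'W _ _ _); rewrite ?fz' //.
  by rewrite /inside /= !inE x'W z'W fx' fz' xu zu.
- by move=> u v x /inB[_ xu] /inB[_ xv]; apply: Bd xv.
- move=> u v /Be[x [y [xu yv xy]]].
  have [x' [y' [x'W y'W fx fy xy']]] :=
    lift x y (subsetP (BW u) _ xu) (subsetP (BW v) _ yv) xy.
  by exists x', y'; rewrite !inE x'W y'W fx fy.
Qed.

Definition merge a b e : rel T :=
  [rel x y | (x != y) && [|| e x y, (x == a) && e b y | (y == a) && e x b]].

Lemma merge_sym a b e : symmetric e -> symmetric (merge a b e).
Proof.
move=> se x y; rewrite /merge /= (eq_sym y x) (se y x) (se b x) (se y b).
by rewrite [X in _ = _ && (_ || X)]orbC.
Qed.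

Lemma merge_irr a b e : irreflexive (merge a b e).
Proof. by move=> x; rewrite /merge /= eqxx. Qed.

Lemma star_connected e (S : {set T}) c : symmetric e -> c \in S ->
  (forall x, x \in S -> x != c -> e c x) ->
  forall x y, x \in S -> y \in S -> connect (inside S e) x y.
Proof.
move=> se cS cx x y xS yS.
have cc z : z \in S -> connect (inside S e) c z.
  move=> zS; have [->//|zc] := eqVneq z c.
  by apply: connect1; rewrite /inside /= cS zS cx.
apply: connect_trans (cc _ yS).
by rewrite (sym_connect_sym (inside_sym S se)); apply: cc.
Qed.

Lemma minor_merge (U : finType) (k : rel U) W e a b (S : {set T}) : symmetric e ->
  S \subset W -> a \in S -> b \in S ->
  (forall x y, x \in S -> y \in S -> connect (inside S e) x y) ->
  has_minor (W :\: (S :\ a)) (merge a b e) k -> has_minor W e k.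
Proof.
move=> se /subsetP SW aS bS Sconn.
pose f z := if z \in S then a else z.
have inW' z : z \in W :\: (S :\ a) -> [/\ z \in W, f z = z & z \in S -> z = a].
  rewrite !inE negb_and negbK => /andP[/orP[/eqP ->|zS] zW]; split=> //.
  - by rewrite /f aS.
  - by rewrite /f (negPf zS).
  - by rewrite (negPf zS).
have fb : f b = a by rewrite /f bS.
apply: (@has_minor_lift _ _ _ _ _ _ f) => //.
- by move=> y /inW'[yW fy _]; exists y.
- move=> x x' xW x'W; rewrite /f; case: ifP => xS; case: ifP => x'S W' //.
  + move=> _; apply: connect_sub (Sconn x x' xS x'S) => c d /and3P[cS dS cd].
    by apply: connect1; rewrite /inside /= !inE !SW // cS dS eqxx.
  + by move=> ax'; rewrite -ax' aS in x'S.
  + by move=> xa; rewrite xa aS in xS.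
  + by move=> ->.
- move=> x y /inW'[xW fx _] /inW'[yW fy _] /andP[xy].
  case/or3P=> [h|/andP[/eqP xa h]|/andP[/eqP ya h]].
  + by exists x, y.
  + by exists b, y; rewrite xa fb; split=> //; apply: SW.
  + by exists x, b; rewrite ya fb; split=> //; apply: SW.
Qed.

Lemma minor_contract (U : finType) (k : rel U) W e a b : symmetric e ->
  a \in W -> b \in W -> a != b -> e a b ->
  has_minor (W :\ b) (merge a b e) k -> has_minor W e k.
Proof.
move=> se aW bW nab ab h; apply: (@minor_merge _ k W e a b [set a; b]); rewrite ?inE ?eqxx ?orbT //.
- by apply/subsetP => z; rewrite !inE => /orP[]/eqP->.
- apply: (@star_connected _ _ a); rewrite // ?inE ?eqxx // => x.
  by rewrite !inE => /orP[]/eqP-> //; rewrite eqxx.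
- suff -> : [set a; b] :\ a = [set b] by [].
  by apply/setP => z; rewrite !inE; case: eqVneq => //= ->; rewrite (negPf nab).
Qed.

(** The common neighbour [x] joins [a] and [b] to a connected set. *)
Lemma minor_identify (U : finType) (k : rel U) W e x a b : symmetric e ->
  x \in W -> a \in W -> b \in W -> x != a -> x != b -> a != b -> e x a -> e x b ->
  has_minor (W :\ x :\ b) (merge a b e) k -> has_minor W e k.
Proof.
move=> se xW aW bW xa xb nab exa exb h.
apply: (@minor_merge _ k W e a b [set x; a; b]); rewrite ?inE ?eqxx ?orbT //.
- by apply/subsetP => z; rewrite !inE -orbA => /or3P[]/eqP->.
- apply: (@star_connected _ _ x); rewrite // ?inE ?eqxx // => z.
  by rewrite !inE -orbA => /or3P[]/eqP-> //; rewrite eqxx.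
- suff -> : W :\: ([set x; a; b] :\ a) = W :\ x :\ b by [].
  apply/setP => z; rewrite !inE; case: (eqVneq z a) => [->|_] /=.
    by rewrite (negPf nab) eq_sym xa.
  by rewrite orbF negb_or -andbA andbCA.
Qed.

Definition nbrs W e x := [set y in W | e x y].
(** Ordered pairs, so that each edge is counted twice. *)
Definition arcs W e := [set p : T * T | [&& p.1 \in W, p.2 \in W & e p.1 p.2]].

Lemma arcs_sum W e : #|arcs W e| = \sum_(x in W) #|nbrs W e x|.
Proof.
rewrite -sum1_card (eq_bigl (fun p : T * T => (p.1 \in W) && ((p.2 \in W) && e p.1 p.2))); last first.
  by move=> p; rewrite inE.
rewrite -(pair_big_dep (mem W) (fun x y => (y \in W) && e x y) (fun _ _ => 1)) /=.
by apply: eq_bigr => x _; rewrite -sum1_card; apply: eq_bigl => y; rewrite inE.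
Qed.

Lemma arcsS W W' e e' : W' \subset W ->
  (forall x y, x \in W' -> y \in W' -> e' x y -> e x y) -> arcs W' e' \subset arcs W e.
Proof.
move=> /subsetP sW se; apply/subsetP => p; rewrite !inE => /and3P[h1 h2 h3].
by rewrite !sW // se.
Qed.

Definition rays (x : T) (S : {set T}) : {set T * T} := setX [set x] S :|: setX S [set x].

Lemma card_rays x (S : {set T}) : x \notin S -> #|rays x S| = #|S|.*2.
Proof.
move=> xS; rewrite cardsU !cardsX !cards1 mul1n muln1 (_ : _ :&: _ = set0) ?cards0 ?subn0 ?addnn //.
apply/setP => -[u v]; rewrite !inE /=.
by case: eqVneq => //= ->; rewrite (negPf xS) andbF.
Qed.

Lemma arcs_del W e x : symmetric e -> irreflexive e -> x \in W ->
  #|arcs W e| = #|arcs (W :\ x) e| + #|nbrs W e x|.*2.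
Proof.
move=> se ie xW; rewrite -(card_rays (x := x)); last by rewrite inE ie andbF.
have dis : arcs (W :\ x) e :&: rays x (nbrs W e x) = set0.
  apply/setP => -[u v]; rewrite !inE /=.
  by case: (eqVneq u x) => //=; case: (eqVneq v x); rewrite ?andbF.
rewrite -[RHS]subn0 -(cards0 (T * T)%type) -dis -cardsU.
apply: eq_card => -[u v]; rewrite !inE /=.
case: (eqVneq u x) => [->|ux] /=; case: (eqVneq v x) => [->|vx] /=; rewrite ?xW ?ie ?andbF ?orbF //=.
by rewrite se andbT.
Qed.

(** A neighbour of [b] is lost only if it is also a neighbour of [a], or [a]
    itself. *)
Lemma arcs_merge W e a b : symmetric e -> irreflexive e -> a \in W -> b \in W -> a != b ->
  #|arcs W e| <= #|arcs (W :\ b) (merge a b e)|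
     + (#|[set y in W | e a y && e b y]| + e a b).*2.
Proof.
move=> se ie aW bW ab; rewrite (arcs_del se ie bW).
pose Y := [set y in W | [&& e b y, y != a & ~~ e a y]].
have sub : arcs (W :\ b) e :|: rays a Y \subset arcs (W :\ b) (merge a b e).
  apply/subsetP => -[u v]; rewrite !inE /merge /=.
  case/orP=> [/and3P[/andP[ub uW] /andP[vb vW] uv]|].
    by rewrite ub uW vb vW uv /= andbT; apply: contraTneq uv => ->; rewrite ie.
  case/orP=> /andP[].
    move=> /eqP-> /and4P[vW bv va _].
    have vb : v != b by apply: contraTneq bv => ->; rewrite ie.
    by rewrite ab aW vb vW (eq_sym a) va bv eqxx ?orbT.
  move=> /and4P[uW bu ua _] /eqP->.
  have ub : u != b by apply: contraTneq bu => ->; rewrite ie.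
  by rewrite ab aW ub uW ua (se u b) bu eqxx ?orbT.
have := subset_leq_card sub; rewrite cardsU card_rays; last by rewrite !inE eqxx !andbF.
rewrite (_ : _ :&: _ = set0) ?cards0 ?subn0; last first.
  apply/setP => -[u v]; rewrite !inE /=.
  apply/negP => /andP[/and3P[_ _ uv]] /orP[]/andP[].
    by move=> /eqP E /and4P[_ _ _]; rewrite -E uv.
  by move=> /and4P[_ _ _] + /eqP E; rewrite -E se uv.
have : #|nbrs W e b| <= #|Y| + (#|[set y in W | e a y && e b y]| + e a b).
  have -> : nbrs W e b = Y :|: ([set y in W | e a y && e b y] :|: [set y in [set a] | e a b]).
    apply/setP => y; rewrite !inE; case: (eqVneq y a) => [->|ya] /=.
      by rewrite aW ie (se b a) andbF.
    by rewrite orbF; case: (y \in W) (e b y) (e a y) => [] [] [].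
  apply: leq_trans (leq_card_setU _ _) _; rewrite leq_add2l.
  apply: leq_trans (leq_card_setU _ _) _; rewrite leq_add2l.
  case: (e a b); last by rewrite (_ : [set _ in _ | _] = set0) ?cards0 //; apply/setP => y; rewrite !inE andbF.
  by rewrite (_ : [set _ in _ | _] = [set a]) ?cards1 //; apply/setP => y; rewrite !inE andbT.
lia.
Qed.

Definition del_edge (a b : T) e : rel T :=
  [rel x y | e x y && ((x, y) \notin [:: (a, b); (b, a)])].

Lemma del_edge_sym a b e : symmetric e -> symmetric (del_edge a b e).
Proof.
by move=> se x y; rewrite /del_edge /= se !inE !xpair_eqE orbC (andbC (x == b)) (andbC (x == a)).
Qed.

Lemma del_edge_irr a b e : irreflexive e -> irreflexive (del_edge a b e).
Proof. by move=> ie x; rewrite /del_edge /= ie. Qed.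

Lemma arcs_del_edge W e a b : symmetric e -> a \in W -> b \in W -> a != b -> e a b ->
  #|arcs W e| = #|arcs W (del_edge a b e)| + 2.
Proof.
move=> se aW bW ab eab.
have -> : arcs W e = arcs W (del_edge a b e) :|: [set (a, b); (b, a)].
  apply/setP => -[u v]; rewrite !inE /del_edge /= !inE.
  have [/eqP[-> ->]|h1] := boolP ((u, v) == (a, b)); first by rewrite aW bW eab !orbT.
  have [/eqP[-> ->]|h2] := boolP ((u, v) == (b, a)); first by rewrite aW bW se eab !orbT.
  by rewrite !orbF /= andbT.
rewrite cardsU cards2 xpair_eqE (negPf ab) /= (_ : _ :&: _ = set0) ?cards0 ?subn0 //.
apply/setP => -[u v]; rewrite !inE /=; apply/negP => /andP[/and4P[_ _ _ /norP[h1 /norP[h2 _]]]].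
by rewrite (negPf h1) (negPf h2).
Qed.

End Minors.

(** * Dense graphs have a K5 minor *)

Section K5Bound.
Variable T : finType.
Implicit Types (W : {set T}) (e : rel T).

(** The branch sets are the singletons [v], [h], [q], [x] and the pair of [p] and [y],
    where [y] is only needed to reach [q]; the case [y = p] is a K5 subgraph. *)
Lemma K5_minor_of W e v h q x p y : symmetric e ->
  [:: v; h; q; x; p; y] \subset W -> uniq [:: v; h; q; x; p] ->
  y \notin [:: v; h; q; x] -> (y == p) || e p y ->
  [&& e v h, e v q, e v x & e v p] -> [&& e h q, e h x & e h p] ->
  [&& e q x, e q y & e x p] -> has_minor W e K5.
Proof.
move=> se /subsetP sW un yn py /and4P[vh vq vx vp] /and3P[hq hx hp] /and3P[qx qy xp].
pose B (i : 'I_5) : {set T} := nth set0 [:: [set v]; [set h]; [set q]; [set x]; [set p; y]] i.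
pose c (i : 'I_5) : T := nth v [:: v; h; q; x; p] i.
have cB i : c i \in B i.
  by case: i => [[|[|[|[|[|]]]]] //= ?]; rewrite /B /c /= !inE eqxx.
exists B; split.
- move=> i; apply/subsetP => z; suff : z \in B i -> z \in [:: v; h; q; x; p; y].
    by move=> sub /sub; apply: sW.
  by case: i => [[|[|[|[|[|]]]]] //= ?]; rewrite /B /= !inE => /[dup] ? ->; rewrite ?orbT //.
- by move=> i; apply/set0Pn; exists (c i).
- move=> i; apply: (@star_connected _ _ _ (c i)) => // z; rewrite /B /c.
  case: i => [[|[|[|[|[|]]]]] //= ?]; rewrite !inE; do ?[by move/eqP->; rewrite eqxx].
  by case/orP=> /eqP-> //; rewrite ?eqxx // => /negPf E; move: py; rewrite E.
- move=> i j z; suff dis (i' j' : 'I_5) : (i' < j')%N -> z \in B i' -> z \in B j' -> False.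
    move=> zi zj; apply: val_inj; case: (ltngtP i j) => // lt; first by case: (dis i j).
    by case: (dis j i).
  case: i' => [[|[|[|[|[|]]]]] //= ?]; case: j' => [[|[|[|[|[|]]]]] //= ?] _; rewrite /B /= !inE;
  move: un yn; rewrite /= !inE !negb_or -!andbA =>
    /and5P[n1 n2 n3 n4 /and5P[n5 n6 n7 n8 /and3P[n9 n10 _]]] /and4P[m1 m2 m3 m4];
  move/eqP=> -> ; do ?[case/orP]; by [rewrite ?(negPf n1) ?(negPf n2) ?(negPf n3) ?(negPf n4) ?(negPf n5) ?(negPf n6) ?(negPf n7) ?(negPf n8) ?(negPf n9) ?(negPf n10)|rewrite eq_sym ?(negPf m1) ?(negPf m2) ?(negPf m3) ?(negPf m4)].
- suff edge (i' j' : 'I_5) : (i' < j')%N -> exists x y, [/\ x \in B i', y \in B j' & e x y].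
    move=> i j ij; case: (ltngtP i j) => lt; first exact: edge.
      by have [a [b [? ? ?]]] := edge _ _ lt; exists b, a; rewrite se.
    by move: ij; rewrite /K5 /= -(inj_eq val_inj) /= lt eqxx.
  case: i' => [[|[|[|[|[|]]]]] //= i5]; case: j' => [[|[|[|[|[|]]]]] //= j5] _;
  first [by exists (c (Ordinal i5)), (c (Ordinal j5)); split; [exact: cB|exact: cB|rewrite /c /=]
        |by exists q, y; rewrite /B /= !inE !eqxx ?orbT].
Qed.

Lemma arcs_bound W e : irreflexive e -> #|arcs W e| <= #|W| * #|W|.-1.
Proof.
move=> ie; rewrite arcs_sum -sum_nat_const; apply: leq_sum => x xW.
rewrite (cardsD1 x W) xW /=; apply: subset_leq_card; apply/subsetP => y.
by rewrite !inE => /andP[-> xy]; rewrite andbT; apply: contraTneq xy => ->; rewrite ie.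
Qed.

Lemma low_degree W e d : #|arcs W e| < d * #|W| -> exists2 v, v \in W & #|nbrs W e v| < d.
Proof.
move=> lt; apply/exists_inP; apply: contraLR lt => /exists_inPn h.
by rewrite -leqNgt arcs_sum mulnC -sum_nat_const; apply: leq_sum => x /h; rewrite -leqNgt.
Qed.

Lemma nbrs_common_card W e v y : symmetric e -> v \in W -> e v y -> y \in W -> irreflexive e ->
  #|[set z in W | e v z && e y z]| < #|nbrs W e v|.
Proof.
move=> se vW vy yW ie; apply: proper_card; apply/properP; split.
  by apply/subsetP => z; rewrite !inE => /and3P[-> ->].
by exists y; rewrite !inE yW vy // ie.
Qed.

(** Each vertex of the neighbourhood misses at most one other vertex of it. If
    nothing is missed, [v] and four neighbours form a K5. Otherwise there are five
    neighbours, two of which, [p] and [q], are not adjacent but both adjacent to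
    the other three; merging [p] with one of these three and using an edge
    between the others gives the minor. *)
Lemma dense_nbrs_K5 W e v : symmetric e -> irreflexive e -> v \in W ->
  3 < #|nbrs W e v| < 6 ->
  (forall y, y \in nbrs W e v -> 2 < #|[set z in W | e v z && e y z]|) ->
  has_minor W e K5.
Proof.
move=> se ie vW /andP[N4 N6] dense; set N := nbrs W e v in N4 N6 dense.
have NW z : z \in N -> [/\ z \in W, e v z & v != z].
  by rewrite inE => /andP[-> vz]; split=> //; apply: contraTneq vz => ->; rewrite ie.
have C y : y \in N -> #|N :&: [set z | e y z]| > 2.
  by move=> /dense; congr (_ < #|pred_of_set _|); apply/setP => z; rewrite !inE andbA.
clearbody N; case: (boolP [exists p in N, exists q in N, (p != q) && ~~ e p q]); last first.
  move=> /exists_inPn all.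
  have adj y z : y \in N -> z \in N -> y != z -> e y z.
    move=> /all/exists_inPn h /h; rewrite negb_and !negbK => /orP[/eqP->|//]; by rewrite eqxx.
  have : uniq (enum N) by apply: enum_uniq.
  have : {subset enum N <= N} by move=> z; rewrite mem_enum.
  move: N4; rewrite cardE; case: (enum N) => [|p [|q [|r [|s l]]]] //= _ sub un.
  have [pN qN rN sN] : [/\ p \in N, q \in N, r \in N & s \in N].
    by split; apply: sub; rewrite !inE eqxx ?orbT.
  have [[pW vp np] [qW vq nq] [rW vr nr] [sW vs ns]] := And4 (NW _ pN) (NW _ qN) (NW _ rN) (NW _ sN).
  move: un; rewrite !inE !negb_or -!andbA => /and5P[pq pr ps _ /and5P[qr qs _ rs _]].
  apply: (@K5_minor_of W e v p q r s s) => //.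
  - by apply/subsetP => z; rewrite !inE; do ?[case/orP]; move=> /eqP->.
  - by rewrite /= !inE !negb_or np nq nr ns pq pr ps qr qs rs.
  - by rewrite !inE !negb_or ![s == _]eq_sym ns ps qs rs.
  - by rewrite eqxx.
  - by rewrite vp vq vr vs.
  - by rewrite !adj.
  - by rewrite !adj.
case/exists_inP=> p pN /exists_inP[q qN /andP[pq npq]].
have F y z z' : y \in N -> z \in N -> z' \in N -> y != z -> y != z' -> z != z' -> ~~ e y z -> e y z'.
  move=> yN zN z'N yz yz' zz' nyz; apply: contraTT (C y yN) => nyz'; rewrite -leqNgt.
  have sub : N :&: [set z | e y z] \subset N :\: [set y; z; z'].
    apply/subsetP => t; rewrite !inE => /andP[-> yt]; rewrite andbT.
    by apply/norP; split; [apply/norP; split|]; apply: contraTneq yt => ->; rewrite ?ie.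
  apply: leq_trans (subset_leq_card sub) _; rewrite cardsDS; last first.
    by apply/subsetP => t; rewrite !inE -orbA => /or3P[]/eqP->.
  by rewrite -setUA cardsU1 cards2 !inE negb_or yz yz' zz'; move: N6; clear; lia.
have : 2 < #|N :\ p :\ q| + 1.
  by have := cardsD1 p N; have := cardsD1 q (N :\ p); rewrite !inE (eq_sym q) pq pN qN /=; lia.
have N5 : #|N| = 5.
  apply/eqP; rewrite eqn_leq -ltnS N6 /= ltn_neqAle N4 andbT; apply/negP => /eqP N4'.
  have sub : N :&: [set z | e p z] \subset N :\: [set p; q].
    apply/subsetP => t; rewrite !inE => /andP[-> yt]; rewrite andbT.
    by apply/norP; split; apply: contraTneq yt => ->; rewrite ?ie.
  have := subset_leq_card sub; rewrite cardsDS ?cards2 ?pq -?N4'; last first.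
    by apply/subsetP => t; rewrite !inE => /orP[]/eqP->.
  by have := C p pN; lia.
have : #|N :\ p :\ q| = 3.
  by have := cardsD1 p N; have := cardsD1 q (N :\ p); rewrite !inE (eq_sym q) pq pN qN /=; lia.
have : uniq (enum (N :\ p :\ q)) by apply: enum_uniq.
have : {subset enum (N :\ p :\ q) <= N :\ p :\ q} by move=> z; rewrite mem_enum.
rewrite cardE; case: (enum _) => [|r [|s [|h [|]]]] //= sub un _ _.
have [] : [/\ r \in N :\ p :\ q, s \in N :\ p :\ q & h \in N :\ p :\ q].
  by split; apply: sub; rewrite !inE eqxx ?orbT.
move=> /setD1P[rq /setD1P[rp rN]] /setD1P[sq /setD1P[sp sN]] /setD1P[hq /setD1P[hp hN]].
have pA t : t \in N -> t != p -> t != q -> e p t.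
  by move=> tN tp tq; apply: (F p q) => //; rewrite eq_sym.
have qA t : t \in N -> t != p -> t != q -> e q t.
  by move=> tN tp tq; apply: (F q p) => //; rewrite 1?eq_sym // se.
have K hub x y : uniq [:: hub; x; y] -> hub \in N -> x \in N -> y \in N ->
    hub != p -> hub != q -> x != p -> x != q -> y != p -> y != q -> e hub x -> has_minor W e K5.
  rewrite /= !inE !negb_or => /and3P[/andP[hx hy] xy _] uN xN yN up uq xp xq yp yq ux.
  have [[uW vu nu] [xW vx nx] [yW vy ny]] := And3 (NW _ uN) (NW _ xN) (NW _ yN).
  have [[pW vp np] [qW vq nq]] := conj (NW _ pN) (NW _ qN).
  apply: (@K5_minor_of W e v hub q x p y) => //.
  - by apply/subsetP => z; rewrite !inE; do ?[case/orP]; move=> /eqP->.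
  - by rewrite /= !inE !negb_or nu nq nx np uq hx up (eq_sym q) xq (eq_sym q) pq xp.
  - by rewrite !inE !negb_or ![y == _]eq_sym ny hy xy (eq_sym q) yq.
  - by rewrite pA ?orbT.
  - by rewrite vu vq vx vp.
  - by rewrite se qA // ux se pA.
  - by rewrite !qA //= se pA.
move: un; rewrite !inE !negb_or -!andbA => /and4P[rs rh sh _].
case ers : (e r s); first by apply: (K r s h); rewrite // /= !inE negb_or rs rh sh.
apply: (K r h s); rewrite // /= ?inE ?negb_or ?rs ?rh 1?eq_sym ?sh //.
by apply: (F r s) => //; rewrite ers.
Qed.

(** The hypothesis is [E >= 3 n - 5] for [E] edges and [n] vertices. Contracting an
    edge with at most two common neighbours loses at most three edges and one
    vertex, which preserves it. Spare edges are deleted, so that some vertex has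
    degree at most 5. *)
Theorem K5_minor_of_arcs W e : symmetric e -> irreflexive e ->
  2 < #|W| -> 6 * #|W| <= #|arcs W e| + 10 -> has_minor W e K5.
Proof.
move: {2}#|W|.+1 (ltnSn #|W|) => n; elim: n W e => // n IHn W e + se ie.
move: {2}#|arcs W e|.+1 (ltnSn #|arcs W e|) => m; elim: m e se ie => // m IHm e se ie lem ltW W3 many.
(* Three vertices have at most 6 arcs. *)
have W4 : 3 < #|W|.
  by have := arcs_bound W ie; rewrite ltn_neqAle W3 andbT => h; apply/eqP => E; rewrite -E in h many; lia.
case: (boolP [exists a in W, exists b in W,
    e a b && (#|[set z in W | e a z && e b z]| <= 2)]).
  case/exists_inP=> a aW /exists_inP[b bW /andP[ab few]].
  have nab : a != b by apply: contraTneq ab => ->; rewrite ie.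
  have cW := cardsD1 b W; rewrite bW in cW.
  have := arcs_merge se ie aW bW nab; rewrite ab => many'.
  apply: (minor_contract se aW bW nab ab); apply: IHn.
  - by lia.
  - exact: merge_sym.
  - exact: merge_irr.
  - by lia.
  - by lia.
move=> /exists_inPn dense.
have {}dense a b : a \in W -> b \in W -> e a b -> 2 < #|[set z in W | e a z && e b z]|.
  by move=> /dense/exists_inPn h /h; rewrite negb_and => + ab; rewrite ab /= -ltnNge.
have [big|small] := leqP (6 * #|W|) #|arcs W e|.
  have /card_gt0P[[a b]] : 0 < #|arcs W e| by lia.
  rewrite inE /= => /and3P[aW bW ab].
  have nab : a != b by apply: contraTneq ab => ->; rewrite ie.
  have := arcs_del_edge se aW bW nab ab => cnt.
  apply: (@has_minorS _ _ _ W W e (del_edge a b e)) => //.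
    by move=> x y _ _ /andP[].
  by apply: IHm; rewrite ?(del_edge_sym, del_edge_irr) //; [exact: del_edge_sym|exact: del_edge_irr|lia|lia].
have [v vW dv] := low_degree small.
have [d0|] := posnP #|nbrs W e v|.
  have := arcs_del se ie vW; have := cardsD1 v W; rewrite vW d0 => cW cA.
  apply: (@has_minorS _ _ _ W (W :\ v) e e) => //; first exact: subD1set.
  by apply: IHn => //; lia.
case/card_gt0P=> y; rewrite inE => /andP[yW vy].
apply: (dense_nbrs_K5 se ie vW).
  by rewrite dv andbT; have := nbrs_common_card se vW vy yW ie; have := dense v y vW yW vy; lia.
by move=> z; rewrite inE => /andP[zW vz]; apply: dense.
Qed.

End K5Bound.

(** * Dense bipartite graphs have a K33 minor *)

Section K33Bound.
Variables (T : finType) (side : pred T).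
Implicit Types (W C : {set T}) (e : rel T).

Definition bipartite e := forall x y, e x y -> side x != side y.

Lemma bipartite_irr e : bipartite e -> irreflexive e.
Proof. by move=> be x; apply/negP => /be; rewrite eqxx. Qed.

Definition side_arcs W e := [set p in arcs W e | side p.1].

Lemma arcs_side W e : symmetric e -> bipartite e -> #|arcs W e| = #|side_arcs W e|.*2.
Proof.
move=> se be; rewrite -(cardsID [set p | side p.1] (arcs W e)) -addnn; congr (_ + _).
  by apply: eq_card => p; rewrite !inE.
have swapK : involutive (fun p : T * T => (p.2, p.1)) by case.
rewrite -(card_imset _ (inv_inj swapK)); apply: eq_card => -[u v].
rewrite -[(u, v)]swapK (mem_imset _ _ (inv_inj swapK)) !inE /= se.
case uv: (e u v); rewrite ?andbF //.
by have := be _ _ uv; case: (side u) (side v) (u \in W) (v \in W) => [] [] [] [].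
Qed.

Lemma side_arcs_bound W e : bipartite e ->
  #|side_arcs W e| <= #|[set x in W | side x]| * #|[set x in W | ~~ side x]|.
Proof.
move=> be; rewrite -cardsX; apply: subset_leq_card; apply/subsetP => -[u v].
rewrite !inE /= => /andP[/and3P[-> -> /be]].
by case: (side u) (side v) => [] [].
Qed.

Lemma card_sides W : #|W| = #|[set x in W | side x]| + #|[set x in W | ~~ side x]|.
Proof.
rewrite -(cardsID [set x | side x] W); congr (_ + _); apply: eq_card => x; rewrite !inE //.
by rewrite andbC.
Qed.

Lemma merge_bipartite e a b : bipartite e -> side a = side b -> bipartite (merge a b e).
Proof.
move=> be ab x y /andP[_ /or3P[/be //|/andP[/eqP-> /be]|/andP[/eqP-> /be]]]; by rewrite ab.
Qed.

Lemma del_edge_bipartite e a b : bipartite e -> bipartite (del_edge a b e).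
Proof. by move=> be x y /andP[/be]. Qed.

(** One side consists of [y1], [y2] and the connected set [C]. *)
Lemma K33_minor_of W e y1 y2 x1 x2 x3 C : symmetric e ->
  [:: y1; y2; x1; x2; x3] \subset W -> C \subset W -> uniq [:: y1; y2; x1; x2; x3] ->
  [disjoint C & [:: y1; y2; x1; x2; x3]] -> C != set0 ->
  (forall c c', c \in C -> c' \in C -> connect (inside C e) c c') ->
  (forall x, x \in [:: x1; x2; x3] -> [/\ e y1 x, e y2 x & exists2 c, c \in C & e c x]) ->
  has_minor W e K33.
Proof.
move=> se /subsetP sW CW un dis C0 Cc ex.
pose Y (i : 'I_3) : {set T} := nth set0 [:: [set y1]; [set y2]; C] i.
pose X (i : 'I_3) : T := nth y1 [:: x1; x2; x3] i.
exists (fun p => if p.1 then Y p.2 else [set X p.2]).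
have XW i : X i \in [:: x1; x2; x3] by apply: mem_nth.
have CD c x : c \in C -> x \in [:: y1; y2; x1; x2; x3] -> c != x.
  by move=> cC xl; apply: contraTneq xl => <-; rewrite (disjointFr dis cC).
have sub5 x : x \in [:: x1; x2; x3] -> x \in [:: y1; y2; x1; x2; x3].
  by rewrite !inE => /or3P[]->; rewrite !orbT.
split.
- case=> [[] i] /=.
    case: i => [[|[|[|]]] //= ?]; rewrite /Y //= sub1set sW // !inE eqxx ?orbT //.
  by rewrite sub1set sW // sub5.
- case=> [[] i] /=; last by apply/set0Pn; exists (X i); rewrite inE.
  case: i => [[|[|[|]]] //= ?]; rewrite /Y //=; apply/set0Pn; [exists y1|exists y2]; by rewrite inE.
- case=> [[] i] x y /=; last by rewrite !inE => /eqP-> /eqP->.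
  case: i => [[|[|[|]]] //= ?]; rewrite /Y //=; try exact: Cc.
    by rewrite !inE => /eqP-> /eqP->.
  by rewrite !inE => /eqP-> /eqP->.
- have XY i j x : x \in Y i -> x <> X j.
    move=> xi xE; subst x; move: xi.
    case: i => [[|[|[|]]] //= ?]; rewrite /Y /= ?inE => h.
    + by move: un => /= /andP[/negP + _]; case; rewrite -(eqP h) inE XW orbT.
    + by move: un => /= /and3P[_ /negP + _]; case; rewrite -(eqP h).
    + by have := CD _ _ h (sub5 _ (XW j)); rewrite eqxx.
  case=> [[] i] [[] j] x /=.
  + move=> xi xj; congr (_, _); apply: val_inj; move: xi xj.
    have y12 : y1 != y2 by move: un; rewrite /= !inE !negb_or -!andbA => /andP[].
    have Cy1 c : c \in C -> c != y1 by move=> /CD; apply; rewrite inE eqxx.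
    have Cy2 c : c \in C -> c != y2 by move=> /CD; apply; rewrite !inE eqxx orbT.
    case: i => [[|[|[|]]] //= ?]; case: j => [[|[|[|]]] //= ?]; rewrite /Y //= ?inE.
    * by move=> /eqP-> E; rewrite E in y12.
    * by move=> /eqP-> /Cy1; rewrite eqxx.
    * by move=> /eqP-> E; rewrite eq_sym E in y12.
    * by move=> /eqP-> /Cy2; rewrite eqxx.
    * by move=> /Cy1/negPf->.
    * by move=> /Cy2/negPf->.
  + by rewrite inE => /XY h /eqP /h.
  + by rewrite inE => /eqP h /XY /(_ h).
  + rewrite !inE => /eqP-> /eqP; rewrite /X => /eqP; rewrite nth_uniq //; last first.
      by move: un => /= /and3P[_ _].
    by move=> /eqP /val_inj->.
- have TF i j : exists x y, [/\ x \in Y i, y \in [set X j] & e x y].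
    have [h1 h2 [c cC cx]] := ex _ (XW j).
    by case: i => [[|[|[|]]] //= ?]; rewrite /Y /=; [exists y1|exists y2|exists c]; exists (X j); rewrite ?inE.
  case=> [[] i] [[] j]; rewrite /K33 /= ?eqxx // => _.
  by have [x [y [h1 h2 h3]]] := TF j i; exists y, x; rewrite se.
Qed.

Lemma mem_arcs W e u v : ((u, v) \in arcs W e) = [&& u \in W, v \in W & e u v].
Proof. by rewrite inE. Qed.

(** The two parts share the 4-cycle: 4 vertices, and 4 edges that make 8 arcs. *)
Lemma four_cycle_split W C e y1 y2 x2 x3 : symmetric e -> C \subset W ->
  [:: y1; y2; x2; x3] \subset W -> uniq [:: y1; y2; x2; x3] ->
  [disjoint C & [:: y1; y2; x2; x3]] ->
  [&& e y1 x2, e y1 x3, e y2 x2 & e y2 x3] ->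
  (forall c z, c \in C -> z \in W -> e c z -> z \in C \/ z \in [:: y1; y2; x2; x3]) ->
  #|W| + 4 = #|C :|: [set y1; y2; x2; x3]| + #|W :\: C| /\
  #|arcs W e| + 8 <= #|arcs (C :|: [set y1; y2; x2; x3]) e| + #|arcs (W :\: C) e|.
Proof.
move=> se CW sW un dis /and4P[e12 e13 e22 e23] sep.
set Q := [set y1; y2; x2; x3].
have QE z : (z \in Q) = (z \in [:: y1; y2; x2; x3]) by rewrite !inE -!orbA.
have Q4 : #|Q| = 4 by rewrite (eq_card QE); exact: (card_uniqP un).
have CQ : C :&: Q = set0.
  by apply/setP => z; rewrite in_setI QE in_set0; apply/negP => /andP[zC]; rewrite (disjointFr dis zC).
have QW : Q \subset W by apply/subsetP => z; rewrite QE; apply: (subsetP sW).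
clearbody Q.
split; first by rewrite cardsU CQ cards0 subn0 Q4 cardsDS //; have := subset_leq_card CW; clear; lia.
set A := arcs (C :|: Q) e; set B := arcs (W :\: C) e.
have cov : arcs W e \subset A :|: B.
  apply/subsetP => -[u v]; rewrite in_setU !mem_arcs => /and3P[uW vW uv].
  rewrite uv !in_setU !in_setD uW vW !andbT.
  have [uC|uC] := boolP (u \in C).
    by have [->//|vQ] := sep _ _ uC vW uv; rewrite (QE v) vQ orbT.
  have [vC|vC] := boolP (v \in C); last by rewrite orbT.
  by rewrite se in uv; have [h|uQ] := sep _ _ vC uW uv; [rewrite h in uC|rewrite (QE u) uQ].
have AB8 : 8 <= #|A :&: B|.
  have y12 : y1 \notin [set x2; x3] /\ y2 \notin [set x2; x3].
    by move: un; rewrite /= !inE !negb_or -!andbA => /and5P[_ -> -> -> /andP[-> _]].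
  have nx : x2 != x3 by move: un; rewrite /= !inE !negb_or -!andbA => /and5P[_ _ _ _ /and3P[_ -> _]].
  have ny : y1 != y2 by move: un; rewrite /= !inE !negb_or -!andbA => /and5P[-> _ _ _].
  have sub : rays y1 [set x2; x3] :|: rays y2 [set x2; x3] \subset A :&: B.
    have QP z : z \in Q -> (z \in C :|: Q) && (z \in W :\: C).
      by move=> zQ; have := in_setI z C Q; rewrite CQ !inE zQ (subsetP QW) // andbT orbT => <-.
    have PP u v : u \in Q -> v \in Q -> e u v -> (u, v) \in A :&: B.
      by move=> /QP/andP[u1 u2] /QP/andP[v1 v2] uv; rewrite in_setI !mem_arcs u1 u2 v1 v2 uv.
    apply/subsetP => -[u v] h.
    suff [uQ vQ uv] : [/\ u \in Q, v \in Q & e u v] by apply: PP.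
    rewrite !QE; move: h; rewrite !inE /=; do ![case/orP]; case/andP; do ?[case/orP]; move=> /eqP->;
      do ?[case/orP]; move=> /eqP->; rewrite ?eqxx ?orbT //; by rewrite se.
  apply: leq_trans (subset_leq_card sub); rewrite cardsU !card_rays ?cards2 ?nx; [|by case: y12..].
  rewrite (_ : _ :&: _ = set0) ?cards0 //.
  apply/setP => -[u v]; rewrite !inE /=; case: y12; rewrite !inE !negb_or => /andP[n1 n2] /andP[n3 n4].
  apply/negP; case/andP=> /orP[]/andP[h1 h2] /orP[]/andP[h3 h4].
  + by rewrite -(eqP h1) (eqP h3) eqxx in ny.
  + by move: h3; rewrite (eqP h1) (negPf n1) (negPf n2).
  + by move: h1; rewrite (eqP h3) (negPf n3) (negPf n4).
  + by rewrite -(eqP h2) (eqP h4) eqxx in ny.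
have := subset_leq_card cov; rewrite cardsU; have := subset_leq_card (subsetIl A B).
by move: AB8; clear; lia.
Qed.

End K33Bound.

Section K33Extremal.
Variables (T : finType) (side : pred T).
Implicit Types (W C : {set T}) (e : rel T).

(** Let [C] be the component of [y3] outside the K_{2,3}. If it touches all [x_i]
    it is the sixth branch set of a K33 minor. Otherwise a 4-cycle of the
    K_{2,3} separates it from the [x_i] that it does not touch, and as the two
    parts share 4 vertices and 4 edges, one of them is again too dense. *)
Lemma K23_reduction W e y1 y2 x1 x2 x3 y3 : symmetric e -> bipartite side e ->
  [:: y1; y2; x1; x2; x3; y3] \subset W -> uniq [:: y1; y2; x1; x2; x3; y3] ->
  (forall x, x \in [:: x1; x2; x3] -> e y1 x && e y2 x) ->
  4 * #|W| <= #|arcs W e| + 6 ->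
  has_minor W e K33 \/
  exists W', [/\ W' \subset W, #|W'| < #|W|, 2 < #|W'| & 4 * #|W'| <= #|arcs W' e| + 6].
Proof.
move=> se be /subsetP sW un ex many.
pose l := [:: y1; y2; x1; x2; x3]; pose D := [set z in W | z \notin l].
(* The component of y3 outside the K_{2,3}. *)
pose C := [set z in D | connect (inside D e) y3 z].
have : uniq (l ++ [:: y3]) by [].
rewrite cat_uniq has_seq1 => /and3P[un5 y3l _].
have y3D : y3 \in D by rewrite inE y3l sW // !inE eqxx ?orbT.
have y3C : y3 \in C by rewrite inE y3D connect0.
have CD : C \subset D by apply/subsetP => z; rewrite inE => /andP[].
have CW : C \subset W by apply: subset_trans CD _; apply/subsetP => z; rewrite inE => /andP[].
have Cl : [disjoint C & l].
  by apply/pred0P => z /=; apply/negP => /andP[/(subsetP CD)]; rewrite inE => /andP[_ /negP].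
have lW : l \subset W.
  by apply/subsetP => z zl; apply: sW; rewrite -[[:: y1; _; _; _; _; _]]/(l ++ [:: y3]) mem_cat zl.
have Cstep c z : c \in C -> z \in D -> e c z -> z \in C.
  rewrite in_set => /andP[cD cc] zD cz; rewrite in_set zD /=.
  by apply: connect_trans cc (connect1 _); rewrite /inside /= cD zD cz.
have Cconn c c' : c \in C -> c' \in C -> connect (inside C e) c c'.
  have base z : z \in C -> connect (inside C e) y3 z.
    rewrite inE => /andP[_ /connectP[p]].
    move: (y3C); elim: p (y3) => [|t p IH] s sC /=; first by move=> _ ->.
    case/andP=> /and3P[sD tD st] pth lst; have tC := Cstep _ _ sC tD st.
    by apply: connect_trans (connect1 _) (IH t tC pth lst); rewrite /inside /= sC tC.
  move=> /base h /base; apply: connect_trans.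
  by rewrite (sym_connect_sym (inside_sym C se)).
have xl x : x \in [:: x1; x2; x3] -> x \in l by rewrite !inE => /or3P[]->; rewrite !orbT.
have split3 x xj xk : perm_eq [:: x; xj; xk] [:: x1; x2; x3] ->
    (forall c, c \in C -> ~~ e c x) ->
    exists W', [/\ W' \subset W, #|W'| < #|W|, 2 < #|W'| & 4 * #|W'| <= #|arcs W' e| + 6].
  move=> pe nox.
  have mem z : (z \in [:: x; xj; xk]) = (z \in [:: x1; x2; x3]) by apply: perm_mem.
  have pl : perm_eq [:: x; y1; y2; xj; xk] l.
    rewrite perm_sym -[l]/([:: y1; y2] ++ [:: x1; x2; x3]).
    apply: perm_trans (_ : perm_eq ([:: y1; y2] ++ [:: x; xj; xk]) _).
      by rewrite perm_cat2l perm_sym.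
    by rewrite (perm_catCA [:: y1; y2] [:: x] [:: xj; xk]).
  have unl : uniq [:: x; y1; y2; xj; xk] by rewrite (perm_uniq pl).
  have meml z : (z \in l) = (z == x) || (z \in [:: y1; y2; xj; xk]).
    by rewrite -(perm_mem pl).
  have [exj exk] : e y1 xj && e y2 xj /\ e y1 xk && e y2 xk.
    by split; apply: ex; rewrite -mem !inE eqxx ?orbT.
  have [|||||cW cA] := @four_cycle_split _ W C e y1 y2 xj xk se CW.
  - by apply/subsetP => z zl; apply: (subsetP lW); rewrite meml zl orbT.
  - by case/andP: unl.
  - apply/pred0P => z /=; apply/negP => /andP[zC zl].
    by have := disjointFr Cl zC; rewrite meml zl orbT.
  - by case/andP: exj => -> ->; case/andP: exk => -> ->.
  - move=> c z cC zW cz; have [zl|zl] := boolP (z \in l); last first.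
      by left; apply: Cstep cC _ cz; rewrite inE zW.
    move: zl; rewrite meml => /orP[/eqP zx|]; last by right.
    by have := nox c cC; rewrite -zx cz.
  have xW : x \in W by apply: (subsetP lW); rewrite meml eqxx.
  have xC : x \notin C by apply/negP => /(disjointFr Cl); rewrite meml eqxx.
  set Q := [set y1; y2; xj; xk] in cW cA.
  have QE z : (z \in Q) = (z \in [:: y1; y2; xj; xk]) by rewrite !inE -!orbA.
  have QW : Q \subset W.
    by apply/subsetP => z; rewrite QE => zl; apply: (subsetP lW); rewrite meml zl orbT.
  have Q4 : #|Q| = 4 by rewrite (eq_card QE); apply/card_uniqP; case/andP: unl.
  have xQ : x \notin Q by rewrite QE; case/andP: unl.
  have QC : Q \subset W :\: C.
    apply/subsetP => z zQ; rewrite inE (subsetP QW) // andbT; apply/negP => /(disjointFr Cl).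
    by rewrite meml -QE zQ orbT.
  have W1 : #|C :|: Q| < #|W|.
    apply: proper_card; apply/properP; split; first by rewrite subUset CW.
    by exists x; rewrite // inE negb_or xC.
  have W2 : #|W :\: C| < #|W|.
    apply: proper_card; apply/properP; split; first exact: subsetDl.
    by exists y3; [apply: (subsetP CW)|rewrite inE y3C].
  have c1 : 2 < #|C :|: Q| by apply: leq_trans (subset_leq_card (subsetUr C Q)); rewrite Q4.
  have c2 : 2 < #|W :\: C| by apply: leq_trans (subset_leq_card QC); rewrite Q4.
  have [h1|h1] := leqP (4 * #|C :|: Q|) (#|arcs (C :|: Q) e| + 6).
    by exists (C :|: Q); rewrite subUset CW.
  exists (W :\: C); split=> //; first exact: subsetDl.
  have := arcs_side W se be; have := arcs_side (C :|: Q) se be.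
  have := arcs_side (W :\: C) se be; move: many h1 cW cA; clear; lia.
have [/allP touch|] := boolP (all (fun x => [exists c in C, e c x]) [:: x1; x2; x3]).
  left; apply: (@K33_minor_of _ W e y1 y2 x1 x2 x3 C) => //.
    by apply/set0Pn; exists y3.
  move=> x xx; have /andP[-> ->] := ex x xx; split=> //.
  by have /exists_inP[c cC cx] := touch x xx; exists c.
rewrite -has_predC => /hasP[x xx /exists_inPn nox]; right.
move: xx nox; rewrite !inE => /or3P[]/eqP-> nox.
- by apply: (split3 x1 x2 x3).
- by apply: (split3 x2 x1 x3) => //; rewrite (perm_catCA [:: x2] [:: x1]).
- by apply: (split3 x3 x1 x2) => //; rewrite (perm_catC [:: x3]).
Qed.

(** The hypothesis is [E >= 2 n - 3]. Deleting a vertex of degree at most 2, or a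
    3-vertex [v] followed by the identification of two of its neighbours with
    at most one further common neighbour, loses at most two edges per vertex.
    Otherwise [v] and two common neighbours form a K_{2,3} with them. *)
Theorem K33_minor_of_arcs W e : symmetric e -> bipartite side e ->
  2 < #|W| -> 4 * #|W| <= #|arcs W e| + 6 -> has_minor W e K33.
Proof.
move: {2}#|W|.+1 (ltnSn #|W|) => n; elim: n W e => // n IHn W e + se be.
move: {2}#|arcs W e|.+1 (ltnSn #|arcs W e|) => m; elim: m e se be => // m IHm e se be lem ltW W3 many.
have ie := bipartite_irr be.
(* A bipartite graph on three vertices has at most two edges. *)
have W4 : 3 < #|W|.
  have := side_arcs_bound W be; have := card_sides side W; have := arcs_side W se be.
  rewrite ltn_neqAle W3 andbT => h1 h2 h3; apply/eqP => E.
  move: h1 h2 h3 many; rewrite -E; set s1 := #|side_arcs _ _ _|.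
  set p := #|[set x in W | _]|; set q := #|[set x in W | _]|; move=> h1 h2 h3.
  have : p \in iota 0 4 by rewrite mem_iota; lia.
  by rewrite !inE => /or4P[]/eqP pE; move: h2 h3; rewrite pE; lia.
case: (boolP [exists v in W, #|nbrs W e v| <= 2]).
  case/exists_inP=> v vW dv.
  have := arcs_del se ie vW; have := cardsD1 v W; rewrite vW => cW cA.
  apply: (@has_minorS _ _ _ W (W :\ v) e e) => //; first exact: subD1set.
  by apply: IHn => //; lia.
move=> /exists_inPn deg; have {}deg v : v \in W -> 2 < #|nbrs W e v|.
  by move=> /deg; rewrite -ltnNge.
have [big|small] := leqP (4 * #|W|) #|arcs W e|.
  have /card_gt0P[[a b]] : 0 < #|arcs W e| by lia.
  rewrite inE /= => /and3P[aW bW ab].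
  have nab : a != b by apply: contraTneq ab => ->; rewrite ie.
  have := arcs_del_edge se aW bW nab ab => cnt.
  apply: (@has_minorS _ _ _ W W e (del_edge a b e)) => //.
    by move=> x y _ _ /andP[].
  by apply: IHm => //; [exact: del_edge_sym|exact: del_edge_bipartite|lia|lia].
have [v vW dv] := low_degree small.
have d3 : #|nbrs W e v| = 3 by have := deg v vW; lia.
have : uniq (enum (nbrs W e v)) by apply: enum_uniq.
have : {subset enum (nbrs W e v) <= nbrs W e v} by move=> z; rewrite mem_enum.
move: (d3); rewrite cardE; case: (enum _) => [|y1 [|y2 [|y3 [|]]]] //= _ sub.
rewrite !inE !negb_or -!andbA => /and4P[y12 y13 y23 _].
have [] : [/\ y1 \in nbrs W e v, y2 \in nbrs W e v & y3 \in nbrs W e v].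
  by split; apply: sub; rewrite !inE eqxx ?orbT.
rewrite !inE => /andP[y1W vy1] /andP[y2W vy2] /andP[y3W vy3].
(* The neighbourhoods of v and of y1 lie on different sides. *)
have W6 : 5 < #|W|.
  have sub6 : nbrs W e v :|: nbrs W e y1 \subset W.
    by apply/subsetP => z; rewrite !inE => /orP[]/andP[].
  have := subset_leq_card sub6; rewrite cardsU (_ : _ :&: _ = set0) ?cards0 ?subn0.
    by have := deg v vW; have := deg y1 y1W; clear; lia.
  apply/setP => z; rewrite !inE; apply/negP => /andP[/andP[_ /be vz] /andP[_ /be y1z]].
  by have := be _ _ vy1; case: (side v) (side z) (side y1) vz y1z => [] [] [].
have ne z : e v z -> v != z by move=> vz; apply: contraTneq vz => ->; rewrite ie.
have sy : side y1 = side y2.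
  by have := be _ _ vy1; have := be _ _ vy2; case: (side v) (side y1) (side y2) => [] [] [].
have y1v : y1 \in W :\ v by rewrite !inE y1W eq_sym ne.
have y2v : y2 \in W :\ v by rewrite !inE y2W eq_sym ne.
have [few|] := leqP #|[set z in W :\ v | e y1 z && e y2 z]| 1.
  apply: (minor_identify se vW y1W y2W (ne _ vy1) (ne _ vy2) y12 vy1 vy2).
  have := arcs_merge se ie y1v y2v y12.
  have -> : e y1 y2 = false by apply/negP => /be; rewrite sy eqxx.
  have := arcs_del se ie vW; rewrite d3.
  have := cardsD1 v W; have := cardsD1 y2 (W :\ v); rewrite vW y2v => c1 c2 c3 c4.
  rewrite addn0 in c4; apply: IHn.
  - by move: c1 c2 ltW; clear; lia.
  - exact: merge_sym.
  - exact: merge_bipartite.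
  - by move: c1 c2 W6; clear; lia.
  - by move: c1 c2 c3 c4 many few; clear; lia.
case/card_gt1P=> z [z' []]; rewrite !inE.
move=> /andP[/andP[zv zW] /andP[y1z y2z]] /andP[/andP[zv' zW'] /andP[y1z' y2z']] zz'.
have ns a b : e y1 a -> e v b -> a != b.
  move=> /be h1 /be h2; have := be _ _ vy1; apply: contraTneq => E; rewrite -E in h2.
  by case: (side v) (side a) (side y1) h1 h2 => [] [] [].
have [] := @K23_reduction W e y1 y2 v z z' y3 se be _ _ _ many.
- by apply/subsetP => t; rewrite !inE; do ?[case/orP]; move=> /eqP->.
- have z1 b : e v b -> (b == z = false) * (z == b = false).
    by move=> vb; rewrite eq_sym !(negPf (ns _ _ y1z vb)).
  have z2 b : e v b -> (b == z' = false) * (z' == b = false).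
    by move=> vb; rewrite eq_sym !(negPf (ns _ _ y1z' vb)).
  have nv b : e v b -> (b == v = false) * (v == b = false).
    by move=> vb; rewrite eq_sym !(negPf (ne _ vb)).
  rewrite /= !inE (negPf y12) (negPf y13) (negPf y23) (negPf zz').
  rewrite !(nv _ vy1, nv _ vy2, nv _ vy3, z1 _ vy1, z1 _ vy2, z1 _ vy3, z2 _ vy1, z2 _ vy2, z2 _ vy3).
  by rewrite (eq_sym v z) (negPf zv) (eq_sym v z') (negPf zv').
- by move=> x; rewrite !inE => /or3P[]/eqP->; rewrite ?(se _ v) ?vy1 ?y1z ?y1z'.
- by [].
case=> W' [sW' ltW' W'3 many'].
by apply: (@has_minorS _ _ _ W W' e e) => //; apply: IHn => //; apply: leq_trans ltW' _.
Qed.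

Corollary bipartite_arcs_bound W e : symmetric e -> bipartite side e ->
  ~ has_minor W e K33 -> #|side_arcs side W e| <= 2 * #|W|.
Proof.
move=> se be nK; have [W3|W3] := ltnP 2 #|W|.
  have := arcs_side W se be; case: (leqP (4 * #|W|) (#|arcs W e| + 6)) => [h|]; last by lia.
  by case: nK; apply: K33_minor_of_arcs.
have := side_arcs_bound W be; have := card_sides side W.
set s := #|side_arcs _ _ _|; set p := #|[set x in W | _]|; set q := #|[set x in W | _]|; nia.
Qed.

End K33Extremal.

(** * Labellings and their local extension *)

Definition far (a b : nat) : bool := (a.+1 < b) || (b.+1 < a).

Lemma far_sym a b : far a b = far b a. Proof. by rewrite /far orbC. Qed.

Section Labelling.
Variables (T : finType) (m : nat).
Implicit Types (e : rel T) (phi : T -> nat) (psi al : T -> T -> nat).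

(** Labels of edges are given by a function of the two ends, and constrained on the
    edges of [e] only, so that subgraphs need no change of type. The labels are
    [0, ..., m - 1]. *)
Record labelling e phi psi : Prop := Labelling {
  lab_vertex : forall x, phi x < m;
  lab_edge : forall x y, e x y -> psi x y < m;
  lab_sym : forall x y, psi x y = psi y x;
  lab_vv : forall x y, e x y -> phi x != phi y;
  lab_ee : forall x y z, e x y -> e x z -> y != z -> psi x y != psi x z;
  lab_ve : forall x y, e x y -> far (phi x) (psi x y) }.

Definition labellable e := exists phi psi, labelling e phi psi.

Definition critical e := [/\ symmetric e, irreflexive e, ~ labellable e &
  forall e', symmetric e' -> (forall x y, e' x y -> e x y) ->
    (exists x y, e x y && ~~ e' x y) -> labellable e'].

Definition cut (F : rel T) e : rel T := [rel x y | [&& e x y, ~~ F x y & ~~ F y x]].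

(** The vertices of [A] get the new labels [x], and the edges [F a b], with [a] in
    [A], the new labels [al a b]; old labels of the vertices in [A] and of these
    edges are ignored. *)
Lemma extend_labelling e (A : {set T}) (F : rel T) phi psi (x : T -> nat) al :
  symmetric e ->
  (forall a b, F a b -> a \in A /\ e a b) ->
  (forall a b, a \in A -> b \in A -> ~~ e a b) ->
  labelling (cut F e) phi psi ->
  (forall a, a \in A -> x a < m) ->
  (forall a b, a \in A -> e a b -> x a != phi b) ->
  (forall a b, a \in A -> e a b -> ~~ F a b -> far (x a) (psi a b)) ->
  (forall a b, F a b -> [/\ al a b < m, far (x a) (al a b) & far (phi b) (al a b)]) ->
  (forall a b c, F a b -> e a c -> ~~ F a c -> al a b != psi a c) ->
  (forall a b c, F a b -> e b c -> ~~ F c b -> al a b != psi b c) ->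
  (forall a b c, F a b -> F a c -> b != c -> al a b != al a c) ->
  (forall a b c, F a b -> F c b -> a != c -> al a b != al c b) ->
  labellable e.
Proof.
move=> se FA ind [pv pe ps pvv pee pve] xm xv xe alok ala alb alaa albb.
have notF a b : F a b -> ~~ F b a.
  move=> /FA[aA ab]; apply/negP => /FA[bA _]; by have := ind _ _ aA bA; rewrite ab.
have FnA a b : F a b -> b \notin A.
  by move=> /FA[aA ab]; apply/negP => bA; have := ind _ _ aA bA; rewrite ab.
pose phi' z := if z \in A then x z else phi z.
pose psi' a b := if F a b then al a b else if F b a then al b a else psi a b.
have keep a b : e a b -> ~~ F a b -> ~~ F b a -> cut F e a b by rewrite /cut /= => -> -> ->.
exists phi', psi'; split.
- by move=> z; rewrite /phi'; case: ifP => zA; [apply: xm|apply: pv].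
- move=> a b ab; rewrite /psi'; case: ifP => Fab; first by case: (alok _ _ Fab).
  by case: ifP => Fba; [case: (alok _ _ Fba)|apply: pe; rewrite keep ?Fab ?Fba].
- move=> a b; rewrite /psi'; case: ifP => Fab; case: ifP => Fba //.
  by have := notF _ _ Fab; rewrite Fba.
- move=> a b ab; rewrite /phi'; case: ifP => aA; case: ifP => bA.
  + by have := ind _ _ aA bA; rewrite ab.
  + exact: xv.
  + by rewrite eq_sym; apply: xv; rewrite // se.
  + by apply: pvv; apply: keep => //; apply/negP => /FA[]; rewrite ?aA ?bA.
- move=> a b c ab ac bc; rewrite /psi'.
  case Fab: (F a b); case Fac: (F a c).
  + exact: alaa.
  + have -> : F c a = false by apply/negP => /FnA; case: (FA _ _ Fab) => ->.
    by apply: ala => //; rewrite Fac.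
  + have -> : F b a = false by apply/negP => /FnA; case: (FA _ _ Fac) => ->.
    by rewrite eq_sym; apply: ala => //; rewrite Fab.
  + case Fba: (F b a); case Fca: (F c a).
    * exact: albb.
    * by apply: alb; rewrite ?Fca.
    * by rewrite eq_sym; apply: alb; rewrite ?Fba.
    * by apply: pee; rewrite // keep ?Fab ?Fac ?Fba ?Fca.
- move=> a b ab; rewrite /psi' /phi'; case: ifP => aA.
    case: ifP => Fab; first by case: (alok _ _ Fab).
    have -> : F b a = false by apply/negP => /FnA; rewrite aA.
    by apply: xe; rewrite ?Fab.
  have -> : F a b = false by apply/negP => /FA[]; rewrite aA.
  case: ifP => Fba; first by case: (alok _ _ Fba).
  by apply: pve; apply: keep; rewrite ?Fba //; apply/negP => /FA[]; rewrite aA.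
Qed.

Lemma card_bigcup_const (I J : finType) (P : {set I}) (F : I -> {set J}) k :
  (forall i, i \in P -> #|F i| <= k) -> #|\bigcup_(i in P) F i| <= #|P| * k.
Proof.
move=> Fk; apply: leq_trans (_ : \sum_(i in P) #|F i| <= _).
  elim/big_rec2: _ => [|i c S _ IH]; first by rewrite cards0.
  by apply: leq_trans (leq_card_setU _ _) _; rewrite leq_add2l.
by rewrite -sum_nat_const; apply: leq_sum.
Qed.

Definition window (c : nat) : {set 'I_m} := [set i : 'I_m | ~~ far c i].

Lemma card_window c : #|window c| <= 3.
Proof.
pose g (i : 'I_m) : 'I_3 := inord (i.+1 - c).
rewrite -(card_in_imset (f := g)); first by rewrite -[X in _ <= X](card_ord 3) max_card.
move=> i j; rewrite !inE /far => hi hj /(congr1 val); rewrite /g /= !inordK.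
- by move=> h; apply: val_inj => /=; move: h hi hj; clear; lia.
- by move: hj; clear; lia.
- by move: hi; clear; lia.
Qed.

Definition exactly (c : nat) : {set 'I_m} := [set i : 'I_m | c == i :> nat].

Lemma card_exactly c : #|exactly c| <= 1.
Proof.
apply/card_le1_eqP => i j; rewrite !inE => /eqP ic /eqP jc.
by apply: val_inj; rewrite /= -ic -jc.
Qed.

Lemma label_seq (S : {set 'I_m}) : exists s : seq nat,
  [/\ uniq s, size s = #|S|, forall n, n \in s -> n < m &
     forall n (nm : n < m), n \in s -> Ordinal nm \in S].
Proof.
exists [seq val i | i <- enum S]; split.
- by rewrite map_inj_uniq ?enum_uniq //; apply: val_inj.
- by rewrite size_map -cardE.
- by move=> n /mapP[i _ ->]; apply: ltn_ord.
- move=> n nm /mapP[i]; rewrite mem_enum => iS nE.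
  by suff -> : Ordinal nm = i by []; apply: val_inj; rewrite /= nE.
Qed.

Definition deg e x := #|[set y | e x y]|.

(** Erase the label of [u] and of its edges to [vs]. The list [X] contains the
    labels that [u] can take next to its neighbours and its remaining edges, and
    [L v] those available for the edge between [u] and [v], before the label of
    [u] is taken into account. The label of an end excludes at most three labels for
    an edge, and the label of an edge at most three for its ends. *)
Lemma star_obstruction e u (vs : seq T) : critical e -> uniq vs -> vs != [::] ->
  (forall v, v \in vs -> e u v) ->
  exists (X : seq nat) (L : T -> seq nat),
  [/\ uniq X /\ (forall v, uniq (L v)),
      m <= size X + deg e u + 3 * (deg e u - size vs),
      forall v, v \in vs -> m <= size (L v) + 3 + (deg e u - size vs) + (deg e v).-1 &
      ~ exists x (al : T -> nat), [/\ x \in X, {in vs &, injective al},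
          forall v, v \in vs -> al v \in L v & forall v, v \in vs -> far x (al v)]].
Proof.
case=> se ie nlab sub un vs0 uvs.
pose F : rel T := [rel a b | (a == u) && (b \in vs)].
have [phi [psi lab]] : labellable (cut F e).
  apply: sub.
  - by move=> a b; rewrite /cut /= se; case: (F a b) (F b a) => [] [].
  - by move=> a b /and3P[].
  - case: vs vs0 uvs @F {un} => // v vs _ /(_ v) h F; exists u, v.
    by rewrite h ?inE ?eqxx // /cut /F /= !inE !eqxx /= andbF.
pose N := [set y | e u y]; pose N' := [set y in N | y \notin vs].
have cN' : #|N'| = deg e u - size vs.
  have -> : N' = N :\: [set y in vs] by apply/setP => y; rewrite !inE andbC.
  rewrite cardsDS; first by congr (_ - _); rewrite cardsE; apply/card_uniqP.
  by apply/subsetP => y; rewrite !inE => /uvs.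
pose Xf := \bigcup_(v in N) exactly (phi v) :|: \bigcup_(v in N') window (psi u v).
pose Lf v := window (phi v) :|: \bigcup_(w in N') exactly (psi u w)
   :|: \bigcup_(w in [set w | e v w] :\ u) exactly (psi v w).
have [X [Xu Xs Xm XX]] := label_seq (~: Xf).
have /fin_all_exists[L LP] : forall v, exists s : seq nat,
  [/\ uniq s, size s = #|~: Lf v|, forall n, n \in s -> n < m &
     forall n (nm : n < m), n \in s -> Ordinal nm \in ~: Lf v] by move=> v; apply: label_seq.
exists X, L; split; first by split=> // v; case: (LP v).
- rewrite Xs -[X in X <= _](card_ord m) -(cardsC Xf) addnC -addnA leq_add2l.
  apply: leq_trans (leq_card_setU _ _) _; apply: leq_add.
    by rewrite -[deg e u]muln1; apply: card_bigcup_const => v _; apply: card_exactly.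
  by rewrite mulnC -cN'; apply: card_bigcup_const => v _; apply: card_window.
- move=> v vvs; case: (LP v) => _ -> _ _.
  rewrite -[X in X <= _](card_ord m) -(cardsC (Lf v)) addnC -!addnA leq_add2l addnA.
  apply: leq_trans (leq_card_setU _ _) _; apply: leq_add.
    apply: leq_trans (leq_card_setU _ _) _; apply: leq_add; first exact: card_window.
    by rewrite -cN' -[X in _ <= X]muln1; apply: card_bigcup_const => w _; apply: card_exactly.
  have -> : (deg e v).-1 = #|[set w | e v w] :\ u|.
    by rewrite /deg (cardsD1 u [set w | e v w]) inE se uvs.
  by rewrite -[X in _ <= X]muln1; apply: card_bigcup_const => w _; apply: card_exactly.
- case=> x [al [xX inj alL xal]]; apply: nlab.
  have XP : [/\ x < m, forall v, e u v -> x != phi v &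
      forall v, e u v -> v \notin vs -> far x (psi u v)].
    have xm := Xm _ xX; have := XX _ xm xX; rewrite in_setC in_setU negb_or => /andP[h1 h2].
    split=> // v uv.
      by apply: contraNneq h1 => xv; apply/bigcupP; exists v; rewrite inE ?uv //= xv eqxx.
    move=> vvs; apply: contraNT h2 => nf; apply/bigcupP; exists v; first by rewrite !inE uv.
    by rewrite inE far_sym.
  have LLP v : v \in vs -> [/\ al v < m, far (phi v) (al v),
      forall w, e u w -> w \notin vs -> al v != psi u w & forall w, e v w -> w != u -> al v != psi v w].
    move=> vvs; have aL := alL v vvs; case: (LP v) => _ _ Lm LL.
    have am := Lm _ aL; have := LL _ am aL.
    rewrite in_setC !in_setU !negb_or -andbA => /and3P[h1 h2 h3]; split=> //.
    - by rewrite inE negbK in h1.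
    - by move=> w uw wvs; apply: contraNneq h2 => E; apply/bigcupP; exists w; rewrite !inE ?uw ?wvs //= E eqxx.
    - by move=> w vw wu; apply: contraNneq h3 => E; apply/bigcupP; exists w; rewrite !inE ?wu ?vw //= E eqxx.
  case: XP => xm xphi xpsi.
  apply: (@extend_labelling e [set u] F phi psi (fun _ => x) (fun _ b => al b) se) => //.
  + by move=> a b /andP[/eqP-> /uvs]; rewrite inE.
  + by move=> a b; rewrite !inE => /eqP-> /eqP->; rewrite ie.
  + by move=> a b; rewrite inE => /eqP->; apply: xphi.
  + by move=> a b; rewrite inE => /eqP-> ub; rewrite /F /= eqxx; apply: xpsi.
  + by move=> a b /andP[_ bvs]; case: (LLP b bvs) => ? ? _ _; split=> //; apply: xal.
  + move=> a b c /andP[/eqP-> bvs] uc; rewrite /F /= eqxx /= => cvs.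
    by case: (LLP b bvs) => _ _ h _; apply: h.
  + move=> a b c /andP[_ bvs] bc; rewrite /F /= bvs andbT => cu.
    by case: (LLP b bvs) => _ _ _ h; apply: h.
  + move=> a b c /andP[_ bvs] /andP[_ cvs]; apply: contra_neq => E; exact: inj E.
  + by move=> a b c /andP[/eqP-> _] /andP[/eqP-> _]; rewrite eqxx.
Qed.

End Labelling.

(** * Distinct representatives far from a label *)

Section Representatives.
Implicit Types (s X A : seq nat).

Definition near_count x A := count (fun a => ~~ far x a) A.

Lemma nearE x a : ~~ far x a = (a \in [:: x.-1; x; x.+1]).
Proof. by rewrite !inE /far; lia. Qed.

Lemma pick_avoid s f : uniq s -> size f < size s -> exists2 a, a \in s & a \notin f.
Proof.
move=> us; rewrite ltnNge => h; apply/hasP; apply: contraR h => /hasPn h.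
by apply: uniq_leq_size => // a /h; rewrite negbK.
Qed.

Lemma size_far x A : size [seq a <- A | far x a] + near_count x A = size A.
Proof. by rewrite size_filter -[RHS](count_predC (far x)). Qed.

Lemma near_count_le x A : uniq A -> near_count x A <= 3.
Proof.
move=> uA; rewrite /near_count -size_filter -[3]/(size [:: x.-1; x; x.+1]).
by apply: uniq_leq_size; [exact: filter_uniq|move=> a; rewrite mem_filter nearE => /andP[]].
Qed.

Lemma near_count_full x A : uniq A -> 2 < near_count x A ->
  [/\ 0 < x, x.-1 \in A, x \in A & x.+1 \in A].
Proof.
move=> uA; rewrite /near_count -size_filter => h.
have sub : {subset [seq a <- A | ~~ far x a] <= [:: x.-1; x; x.+1]}.
  by move=> a; rewrite mem_filter nearE => /andP[].
(* Three near elements exhaust the window, which has three elements only if x > 0. *)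
have un := leq_size_uniq (filter_uniq _ uA) sub h.
have [_ E] := uniq_min_size (filter_uniq _ uA) sub h.
have inA a : a \in [:: x.-1; x; x.+1] -> a \in A by rewrite -E mem_filter => /andP[].
split; [|by apply: inA; rewrite !inE eqxx ?orbT..].
by move: un; rewrite /= !inE; case: x {h sub E inA}.
Qed.

Lemma seq_min s : s != [::] -> exists2 a, a \in s & {in s, forall b, a <= b}.
Proof.
elim: s => // a s IH _; have [->|/IH[b bs bmin]] := eqVneq s [::].
  by exists a; rewrite ?inE // => b; rewrite inE => /eqP->.
have [ab|ba] := leqP a b.
  by exists a; rewrite ?inE ?eqxx // => c; rewrite inE => /predU1P[->//|/bmin]; apply: leq_trans.
exists b; rewrite ?inE ?bs ?orbT // => c; rewrite inE => /predU1P[->|/bmin //]; exact: ltnW.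
Qed.

Lemma seq_max s : s != [::] -> exists2 a, a \in s & {in s, forall b, b <= a}.
Proof.
elim: s => // a s IH _; have [->|/IH[b bs bmin]] := eqVneq s [::].
  by exists a; rewrite ?inE // => b; rewrite inE => /eqP->.
have [ab|ba] := leqP b a.
  exists a; rewrite ?inE ?eqxx // => c; rewrite inE => /predU1P[->//|/bmin h]; exact: leq_trans ab.
exists b; rewrite ?inE ?bs ?orbT // => c; rewrite inE => /predU1P[->|/bmin //]; exact: ltnW.
Qed.

(** If [x - 1], [x], [x + 1] all lie in [A] for every [x] in [X], then the predecessor of
    the least and the successor of the greatest element of [X] are two further
    elements of [A]. *)
Lemma interior_bound X A : uniq X -> uniq A -> X != [::] ->
  (forall x, x \in X -> 2 < near_count x A) -> size X + 2 <= size A.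
Proof.
move=> uX uA X0 full; have full' x (xX : x \in X) := near_count_full uA (full x xX).
have [x0 x0X min] := seq_min X0; have [x1 x1X max] := seq_max X0.
have [p0 i0 _ _] := full' x0 x0X; have [p1 _ _ i1] := full' x1 x1X.
rewrite addn2 -[_.+2]/(size (x0.-1 :: x1.+1 :: X)); apply: uniq_leq_size.
  rewrite /= uX inE negb_or !andbT -andbA; apply/and3P; split.
  - by have := max _ x0X; apply: contraTneq; lia.
  - by apply/negP => /min; lia.
  - by apply/negP => /max; lia.
by move=> y; rewrite !inE => /or3P[/eqP->|/eqP->|/full'[]].
Qed.

Lemma sum_const_seq (s : seq nat) k : \sum_(a <- s) k = size s * k.
Proof. by rewrite -sum1_size big_distrl; apply: eq_bigr => a _; rewrite /= mul1n. Qed.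

(** Each [x] in [X] is near at least two elements of [A], and each element of [A] is near
    at most three numbers. The least element of [A] is near at most two elements
    of [X], as its predecessor is near no other element of [A]; likewise for the
    greatest. *)
Lemma window_bound X A : uniq X -> uniq A -> 1 < size A ->
  (forall x, x \in X -> 1 < near_count x A) -> 2 * size X + 2 <= 3 * size A.
Proof.
move=> uX uA A2 two.
have A0 : A != [::] by case: (A) A2.
have [a0 a0A min] := seq_min A0; have [a1 a1A max] := seq_max A0.
have one s a : uniq s -> a \in s -> \sum_(b <- s) (b == a) = 1.
  move=> us sa; have <- : count_mem a s = 1 by rewrite count_uniq_mem // sa.
  by rewrite -sum1_count [RHS]big_mkcond; apply: eq_bigr => b _ /=; case: eqP.
have a01 : a0 != a1.
  apply: contraTneq A2 => E; rewrite -leqNgt -[1]/(size [:: a0]); apply: uniq_leq_size => // b bA.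
  by have := min b bA; have := max b bA; rewrite inE -E; lia.
have sumE : \sum_(a <- A) near_count a X = \sum_(x <- X) near_count x A.
  under eq_bigr do rewrite /near_count -sum1_count big_mkcond /=.
  rewrite exchange_big; apply: eq_bigr => x _.
  by rewrite /near_count -sum1_count [RHS]big_mkcond; apply: eq_bigr => a _; rewrite far_sym.
have low : 2 * size X <= \sum_(x <- X) near_count x A.
  rewrite mulnC -sum_const_seq big_seq [X in _ <= X]big_seq; apply: leq_sum => x; exact: two.
have high : \sum_(a <- A) (near_count a X + (a == a0) + (a == a1)) <= 3 * size A.
  rewrite mulnC -sum_const_seq big_seq [X in _ <= X]big_seq; apply: leq_sum => a aA.
  have c3 := near_count_le a uX.
  have less k : k \notin X -> k \in [:: a.-1; a; a.+1] -> uniq [:: a.-1; a; a.+1] ->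
      near_count a X <= 2.
    move=> kX ka un; have un' := rem_uniq k un.
    rewrite /near_count -size_filter -[2]/(size [:: a.-1; a; a.+1]).-1 -(size_rem ka).
    apply: uniq_leq_size; first exact: filter_uniq.
    move=> b; rewrite mem_filter nearE => /andP[h bX]; rewrite mem_rem_uniq // inE h andbT.
    by apply: contraNneq kX => <-.
  have two' k : k \in X -> exists b c, [/\ b \in A, c \in A, b < c, ~~ far k b & ~~ far k c].
    move=> /two; rewrite /near_count -size_filter.
    have : uniq [seq a <- A | ~~ far k a] by apply: filter_uniq.
    have : forall b, b \in [seq a <- A | ~~ far k a] -> b \in A /\ ~~ far k b.
      by move=> b; rewrite mem_filter => /andP[].
    case: filter => [|b [|c l]] //= mem /andP[]; rewrite inE negb_or => /andP[bc _] _ _.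
    have [bA bk] := mem b ltac:(by rewrite inE eqxx).
    have [cA ck] := mem c ltac:(by rewrite !inE eqxx orbT).
    have [lt|gt|E] := ltngtP b c; [by exists b, c|by exists c, b|by rewrite E eqxx in bc].
  have un3 : 0 < a -> uniq [:: a.-1; a; a.+1] by rewrite /= !inE => a_gt0; lia.
  have h0 : a == a0 -> near_count a X <= 2.
    move=> /eqP aE; have [a_eq0|a_gt0] := posnP a.
      rewrite /near_count -size_filter -[2]/(size [:: 0; 1]); apply: uniq_leq_size.
        exact: filter_uniq.
      by move=> b; rewrite mem_filter nearE a_eq0 !inE => /andP[+ _]; lia.
    apply: (@less a.-1); rewrite ?un3 // ?inE ?eqxx //.
    apply/negP => /two'[b [c [bA cA bc]]]; rewrite /far; have := min _ bA; have := min _ cA.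
    by rewrite -aE; move: bc a_gt0; clear; lia.
  have h1 : a == a1 -> near_count a X <= 2.
    move=> /eqP aE; have [a_eq0|a_gt0] := posnP a.
      rewrite /near_count -size_filter -[2]/(size [:: 0; 1]); apply: uniq_leq_size.
        exact: filter_uniq.
      by move=> b; rewrite mem_filter nearE a_eq0 !inE => /andP[+ _]; lia.
    apply: (@less a.+1); rewrite ?un3 // ?inE ?eqxx ?orbT //.
    apply/negP => /two'[b [c [bA cA bc]]]; rewrite /far; have := max _ bA; have := max _ cA.
    by rewrite -aE; move: bc a_gt0; clear; lia.
  have n01 : ~~ ((a == a0) && (a == a1)).
    by apply/negP => /andP[/eqP E0 /eqP E1]; rewrite -E0 -E1 eqxx in a01.
  move: h0 h1 n01; case: (a == a0); case: (a == a1) => //= h0 h1 _;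
    rewrite ?addn0 ?addn1 //; [exact: h0 | exact: h1].
move: high; rewrite !big_split /= !one // sumE; move: low; clear; lia.
Qed.

Lemma three_representatives (b1 b2 b3 : seq nat) : uniq b1 -> uniq b2 -> uniq b3 ->
  1 < size b1 -> 0 < size b2 -> 0 < size b3 ->
  [\/ exists a1 a2 a3, [/\ a1 \in b1, a2 \in b2, a3 \in b3 & uniq [:: a1; a2; a3]],
      exists p, b2 = [:: p] /\ b3 = [:: p] |
      [/\ size b1 = 2, {subset b2 <= b1} & {subset b3 <= b1}]].
Proof.
move=> u1 u2 u3 s1 s2 s3.
have [/hasP[a2 a2b /hasP[a3 a3b n23]]|/hasPn same] :=
    boolP (has (fun a2 => has (fun a3 => a2 != a3) b3) b2).
  have [/hasP[a1 a1b]|/hasPn in23] := boolP (has (fun a => a \notin [:: a2; a3]) b1).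
    by rewrite !inE negb_or => /andP[n12 n13]; constructor 1; exists a1, a2, a3;
      rewrite /= !inE n23 (negPf n12) (negPf n13).
  have sub : {subset b1 <= [:: a2; a3]} by move=> a /in23; rewrite negbK.
  have [sz E] := uniq_min_size u1 sub s1.
  have [a2b1 a3b1] : a2 \in b1 /\ a3 \in b1 by rewrite !E !inE !eqxx orbT.
  have [/hasP[c cb cn]|/hasPn sub2] := boolP (has (fun c => c \notin b1) b2).
    constructor 1; exists a2, c, a3; split=> //.
    rewrite E !inE negb_or in cn; case/andP: cn => h1 h2.
    by rewrite /= !inE negb_or (eq_sym a2) h1 n23 h2.
  have [/hasP[c cb cn]|/hasPn sub3] := boolP (has (fun c => c \notin b1) b3).
    constructor 1; exists a3, a2, c; split=> //.
    rewrite E !inE negb_or in cn; case/andP: cn => h1 h2.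
    by rewrite /= !inE negb_or (eq_sym a3 a2) n23 (eq_sym a3) h2 (eq_sym a2) h1.
  by constructor 3; split=> // [a /sub2|a /sub3]; rewrite negbK.
have all_eq a b : a \in b2 -> b \in b3 -> a = b.
  by move=> /same/hasPn h /h; rewrite negbK => /eqP.
constructor 2; move: all_eq; case: b2 u2 s2 {same} => // p l2 u2 _; case: b3 u3 s3 => // q l3 u3 _ h.
have pq : p = q by apply: h; rewrite inE eqxx.
exists p; split.
  case: l2 u2 h => // r l2 /=; rewrite !inE negb_or -andbA => /andP[pr _] h.
  by move: pr; rewrite pq (h r q) ?inE ?eqxx ?orbT.
rewrite -pq in u3 h *; case: l3 u3 h => // r l3 /=; rewrite !inE negb_or -andbA => /andP[pr _] h.
by move: pr; rewrite (h p r) ?inE ?eqxx ?orbT.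
Qed.

Definition far_from x A := [seq a <- A | far x a].

Lemma mem_far_from x A a : (a \in far_from x A) = far x a && (a \in A).
Proof. by rewrite mem_filter. Qed.

Lemma near_in_interior x A a : uniq A -> 2 < near_count x A -> ~~ far x a -> a \in A.
Proof.
by move=> uA /(near_count_full uA)[_ h1 h2 h3]; rewrite nearE !inE => /or3P[]/eqP->.
Qed.

(** Trim the sets to sizes 5, 4, 4. If no [x] works, [three_representatives]
    leaves two reasons: [A2 = A3] contains the whole window of [x], or [A1] contains
    it together with [A2] and [A3]. If the second reason occurs once, all windows
    lie in [A1]; otherwise they all lie in [A2]. Either way [interior_bound]
    bounds [X] by three elements. *)
Lemma three_far_representatives X A1 A2 A3 : uniq X -> uniq A1 -> uniq A2 -> uniq A3 ->
  3 < size X -> 4 < size A1 -> 3 < size A2 -> 3 < size A3 ->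
  exists x a1 a2 a3, [/\ x \in X, uniq [:: a1; a2; a3] &
    [/\ a1 \in far_from x A1, a2 \in far_from x A2 & a3 \in far_from x A3]].
Proof.
move=> uX.
wlog exact : A1 A2 A3 / size A1 = 5 /\ size A2 = 4 /\ size A3 = 4.
  move=> W u1 u2 u3 sX s1 s2 s3.
  case: (W (take 5 A1) (take 4 A2) (take 4 A3) _ _ _ _ sX _ _ _);
    rewrite ?take_uniq ?size_takel //.
  move=> x [a1 [a2 [a3 [xX un [h1 h2 h3]]]]].
  exists x, a1, a2, a3; split=> //.
  have tk n A a : a \in far_from x (take n A) -> a \in far_from x A.
    by rewrite !mem_far_from => /andP[-> /mem_take].
  by split; [apply: tk h1|apply: tk h2|apply: tk h3].
case: exact => z1 [z2 z3] u1 u2 u3 sX _ _ _.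
pose good x := has (fun a1 => has (fun a2 => has (fun a3 => uniq [:: a1; a2; a3])
  (far_from x A3)) (far_from x A2)) (far_from x A1).
have [/hasP[x xX /hasP[a1 h1 /hasP[a2 h2 /hasP[a3 h3 un]]]]|/hasPn bad] := boolP (has good X).
  by exists x, a1, a2, a3.
exfalso.
have X0 : X != [::] by case: (X) sX.
have cases x : x \in X ->
   (2 < near_count x A2 /\ {subset A2 <= A3} ) \/
   [/\ 2 < near_count x A1, {subset A2 <= A1} & {subset A3 <= A1}].
  move=> xX.
  have [c1 c2 c3] := And3 (near_count_le x u1) (near_count_le x u2) (near_count_le x u3).
  have [f1 f2 f3] := And3 (size_far x A1) (size_far x A2) (size_far x A3).
  rewrite -!/(far_from _ _) in f1 f2 f3.
  have g1 : 1 < size (far_from x A1) by move: c1 f1 z1; clear; lia.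
  have g2 : 0 < size (far_from x A2) by move: c2 f2 z2; clear; lia.
  have g3 : 0 < size (far_from x A3) by move: c3 f3 z3; clear; lia.
  case: (@three_representatives (far_from x A1) (far_from x A2) (far_from x A3) (filter_uniq _ u1) (filter_uniq _ u2) (filter_uniq _ u3) g1 g2 g3).
  - move=> [a1 [a2 [a3 [h1 h2 h3 un]]]]; case/negP: (bad x xX).
    by apply/hasP; exists a1 => //; apply/hasP; exists a2 => //; apply/hasP; exists a3.
  - move=> [p [E2 E3]]; left.
    rewrite E2 /= in f2; rewrite E3 /= in f3.
    have n2 : 2 < near_count x A2 by move: f2 z2; clear; lia.
    have n3 : 2 < near_count x A3 by move: f3 z3; clear; lia.
    split=> // a aA; have [fa|nfa] := boolP (far x a); last exact: near_in_interior nfa.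
    have : a \in far_from x A2 by rewrite mem_far_from fa.
    by rewrite E2 -E3 mem_far_from => /andP[].
  - move=> [E s2 s3]; right.
    have n1 : 2 < near_count x A1 by move: f1 z1 E; clear; lia.
    have subA B : {subset far_from x B <= far_from x A1} -> {subset B <= A1}.
      move=> sub a aB; have [fa|nfa] := boolP (far x a); last exact: near_in_interior nfa.
      by have := sub a; rewrite !mem_far_from fa aB => /(_ isT).
    by split=> //; apply: subA.
have mono x A B : uniq A -> {subset A <= B} -> near_count x A <= near_count x B.
  move=> uA sub; rewrite /near_count -!size_filter; apply: uniq_leq_size.
    exact: filter_uniq.
  by move=> a; rewrite !mem_filter => /andP[-> /sub].
have [/hasP[y yX /andP[sub2 full]]|/hasPn none] :=
    boolP (has (fun x => all (mem A1) A2 && (2 < near_count x A1)) X).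
  suff : size X + 2 <= size A1 by rewrite z1; move: sX; clear; lia.
  apply: interior_bound => //.
  move=> x /cases[[n2 _]|[]//]; apply: leq_trans n2 _; apply: mono => // a; exact: (allP sub2).
suff : size X + 2 <= size A2 by rewrite z2; move: sX; clear; lia.
apply: interior_bound => //.
move=> x xX; case: (cases x xX) => [[]//|[n1 s2 _]].
by case/negP: (none x xX); rewrite n1 andbT; apply/allP => a /s2.
Qed.

(** By [window_bound] some [x] is near at most one element of [A1], which then can be
    served last. The greedy choice for the other sets fails only if two
    elements of each are left, and then [A2 = A3]; in this case take instead a
    number near at most one element of [A3], hence of [A2]. *)
Lemma four_far_representatives X A1 A2 A3 A4 : uniq X -> uniq A1 -> uniq A2 -> uniq A3 -> uniq A4 ->
  6 < size X -> 4 < size A1 -> 4 < size A2 -> 4 < size A3 -> 4 < size A4 ->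
  exists x a1 a2 a3 a4, [/\ x \in X, uniq [:: a1; a2; a3; a4] &
    [/\ a1 \in far_from x A1, a2 \in far_from x A2, a3 \in far_from x A3 & a4 \in far_from x A4]].
Proof.
move=> uX.
wlog exact : A1 A2 A3 A4 / [/\ size A1 = 5, size A2 = 5, size A3 = 5 & size A4 = 5].
  move=> W u1 u2 u3 u4 sX s1 s2 s3 s4.
  case: (W (take 5 A1) (take 5 A2) (take 5 A3) (take 5 A4) _ _ _ _ _ sX _ _ _ _);
    rewrite ?take_uniq ?size_takel //.
  move=> x [a1 [a2 [a3 [a4 [xX un [h1 h2 h3 h4]]]]]].
  exists x, a1, a2, a3, a4; split=> //.
  have tk n A a : a \in far_from x (take n A) -> a \in far_from x A.
    by rewrite !mem_far_from => /andP[-> /mem_take].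
  by split; [apply: tk h1|apply: tk h2|apply: tk h3|apply: tk h4].
case: exact => z1 z2 z3 z4 u1 u2 u3 u4 sX _ _ _ _.
have sparse A : uniq A -> size A = 5 -> exists2 x, x \in X & near_count x A <= 1.
  move=> uA zA; apply/hasP; apply: contraLR sX => /hasPn h; rewrite -leqNgt.
  suff : 2 * size X + 2 <= 3 * size A by rewrite zA; clear; lia.
  apply: window_bound; rewrite ?zA //.
  by move=> x /h; rewrite -ltnNge.
have fsz x A : uniq A -> size A = 5 -> size (far_from x A) + near_count x A = 5.
  by move=> _ <-; apply: size_far.
have f2 x A : uniq A -> size A = 5 -> 1 < size (far_from x A).
  by move=> uA zA; have := fsz x A uA zA; have := near_count_le x uA; lia.
have [x xX n1] := sparse A1 u1 z1.
have b1 : 3 < size (far_from x A1) by have := fsz x A1 u1 z1; lia.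
have pick B f y A : uniq A -> B = far_from y A -> size f < size B -> exists2 a, a \in B & a \notin f.
  by move=> uA -> h; apply: pick_avoid => //; apply: filter_uniq.
(* Four elements of the first list are far from x, so it can be served last. *)
have fin : (exists a2 a3 a4, [/\ uniq [:: a2; a3; a4], a2 \in far_from x A2,
      a3 \in far_from x A3 & a4 \in far_from x A4]) ->
    exists x a1 a2 a3 a4, [/\ x \in X, uniq [:: a1; a2; a3; a4] &
    [/\ a1 \in far_from x A1, a2 \in far_from x A2, a3 \in far_from x A3 & a4 \in far_from x A4]].
  case=> a2 [a3 [a4 [un h2 h3 h4]]].
  have [a1 h1 n] := pick _ [:: a2; a3; a4] x A1 u1 erefl b1.
  by exists x, a1, a2, a3, a4; split=> //; rewrite cons_uniq n un.
have [p|[p|p]] : 2 < size (far_from x A2) \/ 2 < size (far_from x A3) \/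
   (size (far_from x A2) = 2 /\ size (far_from x A3) = 2).
  by have := f2 x A2 u2 z2; have := f2 x A3 u3 z3; lia.
- have [a4 h4 _] := pick _ [::] x A4 u4 erefl (ltnW (f2 x A4 u4 z4)).
  have [a3 h3 n3] := pick _ [:: a4] x A3 u3 erefl (f2 x A3 u3 z3).
  have [a2 h2 n2] := pick _ [:: a3; a4] x A2 u2 erefl p.
  by apply: fin; exists a2, a3, a4; rewrite cons_uniq n2 cons_uniq n3.
- have [a4 h4 _] := pick _ [::] x A4 u4 erefl (ltnW (f2 x A4 u4 z4)).
  have [a2 h2 n2] := pick _ [:: a4] x A2 u2 erefl (f2 x A2 u2 z2).
  have [a3 h3 n3] := pick _ [:: a2; a4] x A3 u3 erefl p.
  apply: fin; exists a2, a3, a4; split=> //.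
  move: n2 n3; rewrite /= !inE !negb_or => n24 /andP[n32 n34].
  by rewrite (eq_sym a2 a3) n32 n24 n34.
case: p => e2 e3.
have [/hasP[a h2 n3]|/hasPn sub23] := boolP (has (fun a => a \notin far_from x A3) (far_from x A2)).
  have [a4 h4 n4] := pick _ [:: a] x A4 u4 erefl (f2 x A4 u4 z4).
  have [a3 h3 n34] := pick _ [:: a4] x A3 u3 erefl (f2 x A3 u3 z3).
  apply: fin; exists a, a3, a4; split=> //; move: n4 n34; rewrite /= !inE negb_or => n4 n34.
  rewrite n34 (eq_sym a a4) n4 !andbT; apply: contraNneq n3 => ->; exact: h3.
have full A : uniq A -> size A = 5 -> size (far_from x A) = 2 -> 2 < near_count x A.
  by move=> uA zA E; have := fsz x A uA zA; lia.
have sub : {subset A2 <= A3}.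
  move=> a aA; have [fa|nfa] := boolP (far x a); last exact: near_in_interior (full _ u3 z3 e3) nfa.
  have := sub23 a; rewrite negbK !mem_far_from fa aA => /(_ isT) /andP[]//.
(* At x both lists keep the same two elements, and contain the window of x. *)
have [y yX m3] := sparse A3 u3 z3.
have m2 : near_count y A2 <= 1.
  apply: leq_trans m3; rewrite /near_count -!size_filter; apply: uniq_leq_size.
    exact: filter_uniq.
  by move=> a; rewrite !mem_filter => /andP[-> /sub].
have g2 : 3 < size (far_from y A2) by have := fsz y A2 u2 z2; lia.
have g3 : 3 < size (far_from y A3) by have := fsz y A3 u3 z3; lia.
have [a1 h1 _] := pick _ [::] y A1 u1 erefl (ltnW (f2 y A1 u1 z1)).
have [a4 h4 n4] := pick _ [:: a1] y A4 u4 erefl (f2 y A4 u4 z4).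
have [a3 h3 n3] := pick _ [:: a1; a4] y A3 u3 erefl (ltnW g3).
have [a2 h2 n2] := pick _ [:: a1; a3; a4] y A2 u2 erefl g2.
exists y, a1, a2, a3, a4; split=> //; move: n2 n3 n4; rewrite /= !inE !negb_or.
move=> /and3P[n21 n23 n24] /andP[n31 n34] n4.
by rewrite (eq_sym a1 a2) n21 (eq_sym a1 a3) n31 (eq_sym a1 a4) n4 n23 n24 n34.
Qed.
End Representatives.

(** * Reducible stars *)

Section Configurations.
Variables (T : finType) (M : nat) (e : rel T).
Hypothesis M12 : 12 <= M.
Hypothesis crit : critical (M + 3) e.

Lemma star_representatives (vs : seq T) (X : seq nat) (L : T -> seq nat) x (reps : seq nat) u :
  uniq vs -> uniq reps -> size reps = size vs -> x \in X ->
  (forall i, i < size vs -> nth 0 reps i \in far_from x (L (nth u vs i))) ->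
  exists x (al : T -> nat), [/\ x \in X, {in vs &, injective al},
          forall v, v \in vs -> al v \in L v & forall v, v \in vs -> far x (al v)].
Proof.
move=> uv ua sz xX h; exists x, (fun v => nth 0 reps (index v vs)).
have H v : v \in vs -> nth 0 reps (index v vs) \in far_from x (L v).
  by move=> vvs; have := h (index v vs); rewrite index_mem nth_index // => /(_ vvs).
split=> //.
- move=> v w vvs wvs /eqP; rewrite nth_uniq ?sz ?index_mem // => /eqP E.
  by rewrite -(nth_index u vvs) E nth_index.
- by move=> v /H; rewrite mem_far_from => /andP[].
- by move=> v /H; rewrite mem_far_from => /andP[].
Qed.

Lemma degree_at_least (vs : seq T) u : uniq vs -> (forall v, v \in vs -> e u v) -> size vs <= deg e u.
Proof.
move=> uv h; rewrite -(card_uniqP uv); apply: subset_leq_card; apply/subsetP => v /h.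
by rewrite inE.
Qed.

(** The edge is labelled first; a vertex of degree at most 3 sees at most three
    vertices and three edges, which exclude at most 12 labels. *)
Lemma low_vertex_edge u v : e u v -> deg e u <= 3 -> M + 2 <= deg e u + deg e v.
Proof.
move=> uv d3; rewrite leqNgt; apply/negP => small.
have nv w : w \in [:: v] -> e u w by rewrite inE => /eqP->.
have d1 := @degree_at_least [:: v] u isT nv.
have d2 : 0 < deg e v.
  by case: crit => se _ _ _; apply/card_gt0P; exists u; rewrite inE se.
have [X [L [[uX uL] sX sL []]]] := @star_obstruction _ _ e u [:: v] crit isT isT nv.
have := sL v (mem_head _ _); rewrite /= in d1 sX * => sLv.
have [a aL _] : exists2 a, a \in L v & a \notin [::].
  by apply: pick_avoid => //; move: sLv small d1 d2 d3; rewrite /=; clear; lia.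
have [x xX nx] : exists2 x, x \in X & x \notin [:: a.-1; a; a.+1].
  by apply: pick_avoid => //; move: sX d3 d1 M12; rewrite /=; clear; lia.
apply: (@star_representatives [:: v] X L x [:: a] u) => //.
by case=> // _; rewrite /= mem_far_from aL far_sym andbT; move: nx; rewrite -nearE negbK.
Qed.

(** Two labels remain for [u] and three for the edge. If none of the three is far
    from the first or from the second label of [u], they lie in the
    intersection of two distinct windows, which has at most two elements. *)
Lemma four_vertex_edge u v : e u v -> deg e u = 4 -> 7 < deg e v.
Proof.
move=> uv d4; rewrite ltnNge; apply/negP => small.
have nv w : w \in [:: v] -> e u w by rewrite inE => /eqP->.
have [X [L [[uX uL] sX sL []]]] := @star_obstruction _ _ e u [:: v] crit isT isT nv.
have := sL v (mem_head _ _); rewrite /= d4 in sX * => sLv.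
have s2 : 1 < size X by move: sX M12; clear; lia.
have s3 : 2 < size (L v) by move: sLv small M12; clear; lia.
case: X uX {sX} s2 => [|x [|y X]] //= /andP[xy _] _.
have {}xy : x != y by move: xy; rewrite inE negb_or => /andP[].
have [a aL fa] : exists2 a, a \in L v & far x a || far y a.
  apply/hasP; apply: contraLR s3 => /hasPn near; rewrite -leqNgt.
  rewrite -[2]/(size [:: minn x y; (minn x y).+1]); apply: uniq_leq_size => // a /near.
  by rewrite !inE /far; move: xy; clear; lia.
case/orP: fa => fa.
  apply: (@star_representatives [:: v] _ L x [:: a] u) => //; first exact: mem_head.
  by case=> // _; rewrite /= mem_far_from aL fa.
apply: (@star_representatives [:: v] _ L y [:: a] u) => //; first by rewrite !inE eqxx orbT.
by case=> // _; rewrite /= mem_far_from aL fa.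
Qed.

Lemma five_vertex_three_low u v1 v2 v3 : deg e u = 5 -> uniq [:: v1; v2; v3] ->
  [&& e u v1, e u v2 & e u v3] -> deg e v1 <= 6 -> deg e v2 <= 7 -> deg e v3 <= 7 -> False.
Proof.
move=> d5 un /and3P[uv1 uv2 uv3] d1 d2 d3.
have nv w : w \in [:: v1; v2; v3] -> e u w by rewrite !inE => /or3P[]/eqP->.
have [X [L [[uX uL] sX sL []]]] := star_obstruction (vs := _ :: _) crit un isT nv.
move: (sL v1 ltac:(by rewrite !inE eqxx)) (sL v2 ltac:(by rewrite !inE eqxx orbT))
  (sL v3 ltac:(by rewrite !inE eqxx !orbT)) => l1 l2 l3.
rewrite /= d5 in sX l1 l2 l3.
have [x [a1 [a2 [a3 [xX una [h1 h2 h3]]]]]] : exists x a1 a2 a3,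
    [/\ x \in X, uniq [:: a1; a2; a3] &
    [/\ a1 \in far_from x (L v1), a2 \in far_from x (L v2) & a3 \in far_from x (L v3)]].
  apply: three_far_representatives => //; clear -M12 sX l1 l2 l3 d1 d2 d3; lia.
apply: (@star_representatives _ X L x [:: a1; a2; a3] u un una erefl xX).
by case=> [|[|[|]]].
Qed.

Lemma five_vertex_four_low u v1 v2 v3 v4 : deg e u = 5 -> uniq [:: v1; v2; v3; v4] ->
  [&& e u v1, e u v2, e u v3 & e u v4] ->
  deg e v1 <= 7 -> deg e v2 <= 7 -> deg e v3 <= 7 -> deg e v4 <= 7 -> False.
Proof.
move=> d5 un /and4P[uv1 uv2 uv3 uv4] d1 d2 d3 d4.
have nv w : w \in [:: v1; v2; v3; v4] -> e u w by rewrite !inE => /or4P[]/eqP->.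
have [X [L [[uX uL] sX sL []]]] := star_obstruction (vs := _ :: _) crit un isT nv.
move: (sL v1 ltac:(by rewrite !inE eqxx)) (sL v2 ltac:(by rewrite !inE eqxx orbT))
  (sL v3 ltac:(by rewrite !inE eqxx !orbT)) (sL v4 ltac:(by rewrite !inE eqxx !orbT)) => l1 l2 l3 l4.
rewrite /= d5 in sX l1 l2 l3 l4.
have [x [a1 [a2 [a3 [a4 [xX una [h1 h2 h3 h4]]]]]]] : exists x a1 a2 a3 a4,
    [/\ x \in X, uniq [:: a1; a2; a3; a4] &
    [/\ a1 \in far_from x (L v1), a2 \in far_from x (L v2), a3 \in far_from x (L v3)
      & a4 \in far_from x (L v4)]].
  apply: four_far_representatives => //; clear -M12 sX l1 l2 l3 l4 d1 d2 d3 d4; lia.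
apply: (@star_representatives _ X L x [:: a1; a2; a3; a4] u un una erefl xX).
by case=> [|[|[|[|]]]].
Qed.

End Configurations.

(** * Stable matchings and saturated assignments *)

Section StableMatching.
Variable T : finType.
Implicit Types (F N : {set T * T}) (p q : T * T).
Variables (ka kb : T * T -> nat).

(** The numbers [ka] and [kb] rank the edges at a vertex of the first and of the
    second side; small numbers are preferred. *)
Definition keyed F := forall p q, p \in F -> q \in F ->
  (p.1 = q.1 -> ka p = ka q -> p = q) /\ (p.2 = q.2 -> kb p = kb q -> p = q).

Definition beats q p := ((q.1 == p.1) && (ka q < ka p)) || ((q.2 == p.2) && (kb q < kb p)).

(** If a favourite edge [p] of its first vertex is preferred by its second
    vertex to [q], then [q] is beaten as soon as [p] is matched or beaten, so [q]
    can be dropped. When there is no such pair, the favourites form a matching. *)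
Lemma stable_matching F : keyed F -> exists N, [/\ N \subset F,
  forall p q, p \in N -> q \in N -> p.1 = q.1 \/ p.2 = q.2 -> p = q &
  forall p, p \in F -> p \notin N -> exists2 q, q \in N & beats q p].
Proof.
move: {2}#|F| (leqnn #|F|) => n; elim: n F => [|n IH] F.
  rewrite leqn0 cards_eq0 => /eqP-> _; exists set0.
  by split=> [|p q|p]; rewrite ?sub0set ?inE.
move=> Fn key.
pose fav p := [forall q in F, (q.1 == p.1) ==> (ka p <= ka q)].
have [/existsP[p /existsP[q /and5P[pF qF favp pq2 lt]]]|no] :=
    boolP [exists p, exists q, [&& p \in F, q \in F, fav p, p.2 == q.2 & kb p < kb q]].
  have [N [NF mat dom]] : exists N, [/\ N \subset F :\ q,
      forall p q, p \in N -> q \in N -> p.1 = q.1 \/ p.2 = q.2 -> p = q &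
      forall p, p \in F :\ q -> p \notin N -> exists2 q, q \in N & beats q p].
    apply: IH; first by have := cardsD1 q F; rewrite qF; move: Fn; clear; lia.
    by move=> r s /setD1P[_ rF] /setD1P[_ sF]; apply: key.
  exists N; split=> //; first by apply: subset_trans NF (subD1set _ _).
  move=> r rF rN; have [rq|rq] := eqVneq r q; last by apply: dom; rewrite // !inE rq.
  subst r; have [pN|pN] := boolP (p \in N).
    by exists p; rewrite // /beats pq2 lt orbT.
  have pD : p \in F :\ q by rewrite !inE pF andbT; apply: contraTneq lt => ->; rewrite ltnn.
  have [r rN' /orP[]/andP[E lt']] := dom p pD pN.
    have /setD1P[_ rF'] := subsetP NF r rN'.
    by have := forall_inP favp r rF'; rewrite E /= leqNgt lt'.
  exists r => //; rewrite /beats (eqP E) pq2 (ltn_trans lt' lt) orbT //.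
exists [set p in F | fav p].
have mat1 p q : p \in F -> q \in F -> fav p -> fav q -> p.1 = q.1 -> p = q.
  move=> pF qF /forall_inP fp /forall_inP fq E; apply: (key p q pF qF).1 => //.
  by apply/eqP; rewrite eqn_leq (implyP (fp q qF)) ?E // (implyP (fq p pF)) ?E.
split.
- by apply/subsetP => p; rewrite inE => /andP[].
- move=> p q; rewrite !inE => /andP[pF fp] /andP[qF fq] [|E]; first exact: mat1.
  have no' r s : r \in F -> s \in F -> fav r -> r.2 = s.2 -> kb s <= kb r.
    move=> rF sF fr E'; rewrite leqNgt; apply: contra no => lt.
    by apply/existsP; exists r; apply/existsP; exists s; rewrite rF sF fr E' eqxx.
  by apply: (key p q pF qF).2 => //; apply/eqP; rewrite eqn_leq !no'.
- move=> p pF; rewrite inE pF /= => nfav.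
  have [q /andP[qF /eqP E] qmin] : exists2 q, (q \in F) && (q.1 == p.1) &
      forall r, (r \in F) && (r.1 == p.1) -> ka q <= ka r.
    case: (@arg_minnP _ p (fun q => (q \in F) && (q.1 == p.1)) ka); first by rewrite pF eqxx.
    by move=> q hq hmin; exists q.
  have fq : fav q.
    by apply/forall_inP => r rF; apply/implyP; rewrite E => /eqP Er; apply: qmin; rewrite rF Er eqxx.
  exists q; first by rewrite inE qF.
  rewrite /beats E eqxx /= ltn_neqAle qmin ?pF ?eqxx // andbT.
  by apply/orP; left; apply: contra nfav => /eqP h; rewrite -((key q p qF pF).1 E h).
Qed.

Variable C : finType.

Definition losses F p := #|[set q in F | (q.1 == p.1) && (ka q < ka p)]|
  + #|[set q in F | (q.2 == p.2) && (kb q < kb p)]|.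

(** Galvin: give one colour to a stable matching of the edges whose list
    contains it. The other edges with this colour in their lists lose one colour and
    at least one preferred edge, so the hypothesis is preserved. *)
Lemma list_edge_colouring F (L : T * T -> {set C}) (c0 : C) : keyed F ->
  (forall p, p \in F -> losses F p < #|L p|) ->
  exists col : T * T -> C, (forall p, p \in F -> col p \in L p) /\
    forall p q, p \in F -> q \in F -> p != q -> p.1 = q.1 \/ p.2 = q.2 -> col p != col q.
Proof.
move: {2}#|F| (leqnn #|F|) => n; elim: n F L => [|n IH] F L.
  rewrite leqn0 cards_eq0 => /eqP-> _ _; exists (fun _ => c0).
  by split=> p; [|move=> q]; rewrite inE.
move=> Fn key big.
have [->|/set0Pn[p0 p0F]] := eqVneq F set0.
  by exists (fun _ => c0); split=> p; [|move=> q]; rewrite inE.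
have /card_gt0P[g gL] : 0 < #|L p0| by apply: leq_ltn_trans (big _ p0F).
pose Fg := [set p in F | g \in L p].
have subF p : p \in Fg -> p \in F by rewrite inE => /andP[].
have [N [NF mat dom]] : exists N, [/\ N \subset Fg,
      forall p q, p \in N -> q \in N -> p.1 = q.1 \/ p.2 = q.2 -> p = q &
      forall p, p \in Fg -> p \notin N -> exists2 q, q \in N & beats q p].
  by apply: stable_matching => p q /subF pF /subF qF; apply: key.
have NF' p : p \in N -> p \in F by move=> /(subsetP NF)/subF.
have N0 : exists q, q \in N.
  have [pN|pN] := boolP (p0 \in N); first by exists p0.
  by have [|q qN _] := dom p0 _ pN; [rewrite inE p0F | exists q].
have losing p q : q \in N -> p \in F -> beats q p -> losses (F :\: N) p < losses F p.
  move=> qN pF; rewrite /losses /beats.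
  have mono (P : pred (T * T)) : #|[set q in F :\: N | P q]| <= #|[set q in F | P q]|.
    by apply/subset_leq_card/subsetP => r; rewrite !inE -andbA => /and3P[_ -> ->].
  have strict (P : pred (T * T)) : P q -> #|[set q in F :\: N | P q]| < #|[set q in F | P q]|.
    move=> Pq; apply: proper_card; apply/properP; split.
      by apply/subsetP => r; rewrite !inE -andbA => /and3P[_ -> ->].
    by exists q; rewrite !inE ?qN ?NF' //.
  case/orP=> h.
    by rewrite -addSn leq_add ?mono // (strict (fun q => (q.1 == p.1) && (ka q < ka p))).
  by rewrite -addnS leq_add ?mono // (strict (fun q => (q.2 == p.2) && (kb q < kb p))).
have losses_le p : losses (F :\: N) p <= losses F p.
  by apply: leq_add; apply/subset_leq_card/subsetP => r; rewrite !inE -andbA => /and3P[_ -> ->].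
have [col [colL colD]] : exists col : T * T -> C,
    (forall p, p \in F :\: N -> col p \in L p :\ g) /\
    forall p q, p \in F :\: N -> q \in F :\: N -> p != q -> p.1 = q.1 \/ p.2 = q.2 -> col p != col q.
  apply: IH.
  - have [q qN] := N0; have : #|F :\: N| < #|F|.
      apply: proper_card; apply/properP; split; first exact: subsetDl.
      by exists q; rewrite ?inE ?qN ?NF'.
    by move=> lt; rewrite -ltnS; apply: leq_trans lt Fn.
  - by move=> p q /setDP[pF _] /setDP[qF _]; apply: key.
  - move=> p /setDP[pF pN]; have := big p pF; rewrite (cardsD1 g (L p)).
    have [gp|gp] := boolP (g \in L p); last by rewrite add0n; apply: leq_ltn_trans.
    have [|q qN bqp] := dom p _ pN; first by rewrite inE pF.
    by have := losing p q qN pF bqp; rewrite add1n ltnS; apply: leq_trans.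
have colg p : p \in F -> p \notin N -> col p != g.
  by move=> pF pN; have := colL p; rewrite !inE pN pF => /(_ isT)/andP[].
exists (fun p => if p \in N then g else col p); split.
- move=> p pF; case: ifP => pN; first by have := subsetP NF p pN; rewrite inE => /andP[].
  by have := colL p; rewrite !inE pN pF => /(_ isT)/andP[].
- move=> p q pF qF pq adj; case: ifP => pN; case: ifP => qN.
  + by case/eqP: pq; apply: mat.
  + by rewrite eq_sym colg ?qN.
  + by rewrite colg ?pN.
  + by apply: colD; rewrite // !inE ?pN ?qN.
Qed.

End StableMatching.

Section Assignment.
Variables (T : finType) (X : {set T}) (e : rel T) (cap : T -> nat).
Implicit Types f : {ffun T -> option T}.

Definition load f b := #|[set a | f a == Some b]|.

Definition assignment f :=
  (forall a b, f a = Some b -> a \in X /\ e a b) /\ (forall b, load f b <= cap b).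

Definition dom f := [set a | f a != None].

Definition swap_step f : rel T := [rel a a' | [exists b, e a b && (f a' == Some b)]].

Definition set_at f z b : {ffun T -> option T} := [ffun y => if y == z then Some b else f y].

Lemma set_atE f z b y : set_at f z b y = if y == z then Some b else f y.
Proof. by rewrite ffunE. Qed.

(** The last vertex [z] of the path moves to [b], which frees a place for its
    predecessor. *)
Lemma augment f a0 p b : assignment f -> a0 \in X -> f a0 = None ->
  path (swap_step f) a0 p -> uniq (a0 :: p) -> e (last a0 p) b -> load f b < cap b ->
  exists2 f', assignment f' & dom f' = a0 |: dom f.
Proof.
elim/last_ind: p f b => [|p z IH] f b [fe fcap] a0X fa0 /=.
  move=> _ _ ab lt; exists (set_at f a0 b); last first.
    by apply/setP => y; rewrite !inE set_atE; case: (eqVneq y a0).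
  split=> [a b'|b']; first by rewrite set_atE; case: eqP => [->|_ /fe//] [<-].
  have [->|bb] := eqVneq b' b.
    apply: leq_trans lt; rewrite /load (_ : [set a | _] = a0 |: [set a | f a == Some b]).
      by apply: leq_trans (leq_card_setU _ _) _; rewrite cards1.
    by apply/setP => y; rewrite !inE set_atE; case: (eqVneq y a0); rewrite ?eqxx.
  apply: leq_trans (fcap b'); apply: subset_leq_card; apply/subsetP => y.
  rewrite !inE set_atE; case: (eqVneq y a0) => // _; rewrite -[_ == _]/(b == b') eq_sym (negPf bb) //.
rewrite rcons_path last_rcons => /andP[pth /existsP[b1 /andP[lb1 /eqP fz]]].
rewrite mem_rcons rcons_uniq inE negb_or => /and3P[/andP[a0z a0p] zp up] zb lt.
have zX : z \in X by case: (fe _ _ fz).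
pose f1 := set_at f z b.
have load_b : load f1 b <= (load f b).+1.
  rewrite /load (_ : [set a | _] = z |: [set a | f a == Some b]).
    by apply: leq_trans (leq_card_setU _ _) _; rewrite cards1.
  by apply/setP => y; rewrite !inE set_atE; case: (eqVneq y z); rewrite ?eqxx.
have load_b' b' : b' != b -> load f1 b' <= load f b' - (b' == b1).
  move=> bb; have sub : [set a | f1 a == Some b'] \subset [set a | f a == Some b'] :\: [set a in [set z] | b' == b1].
    apply/subsetP => y; rewrite !inE set_atE; case: (eqVneq y z) => [->|yz] /=; last by [].
    by rewrite -[_ == _]/(b == b') eq_sym (negPf bb).
  apply: leq_trans (subset_leq_card sub) _.
  case: eqP => [->|_]; last first.
    by rewrite subn0; apply/subset_leq_card/subsetP => y; rewrite !inE => /andP[].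
  have -> : [set a in [set z] | true] = [set z] by apply/setP => y; rewrite !inE andbT.
  by rewrite subn1 /load (cardsD1 z [set a | f a == Some b1]) inE fz eqxx.
have dom1 : dom f1 = dom f by apply/setP => y; rewrite !inE set_atE; case: (eqVneq y z) => // ->; rewrite fz.
rewrite -dom1; apply: (IH f1 b1).
- split=> [a b'|b']; first by rewrite set_atE; case: eqP => [->|_ /fe//] [<-].
  have [->|bb] := eqVneq b' b; first exact: leq_trans load_b lt.
  by apply: leq_trans (load_b' _ bb) _; apply: leq_trans (fcap b'); apply: leq_subr.
- by [].
- by rewrite set_atE (negPf a0z).
- move: pth zp; elim: (p) (a0) => //= y q IHq x /andP[/existsP[c /andP[xc fy]] pq].
  rewrite inE negb_or => /andP[zy zq]; rewrite IHq // andbT.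
  by apply/existsP; exists c; rewrite xc set_atE (eq_sym y z) (negPf zy) fy.
- by rewrite /= a0p up.
- by [].
- have [b1b|b1b] := eqVneq b1 b.
    have -> : f1 = f by apply/ffunP => y; rewrite set_atE; case: eqP => // ->; rewrite fz b1b.
    by rewrite b1b.
  apply: leq_ltn_trans (load_b' _ b1b) _; rewrite eqxx subn1.
  apply: leq_trans (fcap b1); rewrite prednK // /load; apply/card_gt0P; exists z.
  by rewrite inE fz.
Qed.

(** Start from an unassigned vertex and follow the alternating paths. If they only
    reach saturated vertices, the set of vertices reached on the side of [X]
    is the obstruction. *)
Lemma assignment_or_obstruction :
  (exists2 f, assignment f & X \subset dom f) \/
  exists f (S : {set T}), [/\ assignment f, S != set0, S \subset X &
    forall a b, a \in S -> e a b -> load f b = cap b /\ forall a', f a' = Some b -> a' \in S].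
Proof.
suff main n f : #|X| - #|dom f| <= n -> assignment f ->
  (exists2 f, assignment f & X \subset dom f) \/
  exists f (S : {set T}), [/\ assignment f, S != set0, S \subset X &
    forall a b, a \in S -> e a b -> load f b = cap b /\ forall a', f a' = Some b -> a' \in S].
  apply: (main #|X| [ffun=> None]); first exact: leq_subr.
  split=> [a b|b]; first by rewrite ffunE.
  by rewrite /load (_ : [set a | _] = set0) ?cards0 //; apply/setP => y; rewrite !inE ffunE.
elim: n f => [|n IH] f; rewrite ?leqn0 ?subn_eq0 => fn asg.
  left; exists f => //; case: (asg) => fe _.
  have domX : dom f \subset X.
    by apply/subsetP => y; rewrite inE; case fy: (f y) => [b|] // _; case: (fe _ _ fy).
  by have /eqP <- : dom f == X by rewrite eqEcard domX.
have [tot|/subsetPn[a0 a0X]] := boolP (X \subset dom f); first by left; exists f.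
rewrite inE negbK => /eqP fa0.
pose S := [set a | connect (swap_step f) a0 a].
have SX : S \subset X.
  apply/subsetP => a; rewrite inE => /connectP[p]; elim/last_ind: p => [|p z _] /=; first by move=> _ ->.
  rewrite rcons_path last_rcons => /andP[_ /existsP[b /andP[_ /eqP fz]]] ->.
  by case: asg => fe _; case: (fe _ _ fz).
have [/existsP[a /existsP[b /and3P[aS ab lt]]]|sat] :=
    boolP [exists a, exists b, [&& a \in S, e a b & load f b < cap b]].
  move: aS; rewrite inE => /connectP[p0 pth0 lst0]; case/shortenP: pth0 lst0 => p pth up _ lst.
  rewrite lst in ab.
  have [f' asg' dom'] := augment asg a0X fa0 pth up ab lt.
  apply: (IH f') => //; rewrite dom' cardsU1 inE fa0 /=; move: fn; clear; lia.
right; exists f, S; split=> //; first by apply/set0Pn; exists a0; rewrite inE connect0.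
move=> a b aS ab; split.
  apply/eqP; rewrite eqn_leq; case: (asg) => _ -> /=; rewrite leqNgt.
  by apply: contra sat => lt; apply/existsP; exists a; apply/existsP; exists b; rewrite aS ab.
move=> a' fa'; move: aS; rewrite !inE => aS; apply: (connect_trans aS); apply: connect1.
by apply/existsP; exists b; rewrite ab fa' eqxx.
Qed.

End Assignment.

(** * Vertices of degree at most three *)

Section LowVertices.
Variables (T : finType) (M : nat) (e : rel T).
Hypothesis M12 : 12 <= M.
Hypothesis crit : critical (M + 3) e.
Hypothesis degM : forall x, deg e x <= M.

Definition low_vertices := [set x | 0 < deg e x <= 3].
(** How many vertices of degree at most 3 a neighbour can pay for in the final
    count. *)
Definition capacity b := if deg e b == M then 2 else if deg e b == M.-1 then 1 else 0.

(** All edges at [S] are labelled again, before [S]. The available labels of the edge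
    between [a] and [b] only depend on [b]. Let [a] prefer the vertex assigned to it,
    and let [b] prefer the vertices that are not assigned to it: then fewer
    edges are preferred to a given one than labels are available. The vertices
    of [S], pairwise not adjacent, are labelled at the end as in
    [low_vertex_edge]. *)
Lemma masters_saturated_reducible (f : {ffun T -> option T}) (S : {set T}) :
  assignment low_vertices e capacity f -> S != set0 -> S \subset low_vertices ->
  (forall a b, a \in S -> e a b ->
     load f b = capacity b /\ forall a', f a' = Some b -> a' \in S) -> False.
Proof.
case=> fe fcap S0 /subsetP SX sat; case: (crit) => se ie nlab sub.
have d3 a : a \in S -> deg e a <= 3 by move=> /SX; rewrite inE => /andP[].
have big a b : a \in S -> e a b -> M.-1 <= deg e b.
  by move=> aS ab; have := low_vertex_edge M12 crit ab (d3 a aS); have := d3 a aS; move: M12; clear; lia.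
have ind a b : a \in S -> b \in S -> ~~ e a b.
  move=> aS bS; apply/negP => ab; have := big a b aS ab; have := d3 b bS; move: M12; clear; lia.
pose F : rel T := [rel a b | (a \in S) && e a b].
have [phi [psi lab]] : labellable (M + 3) (cut F e).
  apply: sub.
  - by move=> a b; rewrite /cut /= se; case: (F a b) (F b a) => [] [].
  - by move=> a b /and3P[].
  - have [a aS] := set0Pn _ S0; have := SX a aS; rewrite inE => /andP[/card_gt0P[b]].
    by rewrite inE => ab _; exists a, b; rewrite /cut /F /= aS ab /= ?andbF.
pose m := M + 3.
pose N b := [set a in S | e a b]; pose K b := [set w | e b w] :\: S.
have degE b : deg e b = #|N b| + #|K b|.
  rewrite /deg -(cardsID S [set w | e b w]); congr (_ + _); apply: eq_card => w.
  by rewrite !inE andbC se.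
pose L (p : T * T) : {set 'I_m} :=
  ~: (window m (phi p.2) :|: \bigcup_(w in K p.2) exactly m (psi p.2 w)).
have Lsize p : M + #|N p.2| <= #|L p| + deg e p.2.
  have h1 := leq_card_setU (window m (phi p.2)) (\bigcup_(w in K p.2) exactly m (psi p.2 w)).
  have h2 := card_window m (phi p.2).
  have h3 := @card_bigcup_const _ _ (K p.2) (fun w => exactly m (psi p.2 w)) 1
    (fun w _ => card_exactly m (psi p.2 w)).
  have h4 : #|window m (phi p.2) :|: \bigcup_(w in K p.2) exactly m (psi p.2 w)| <= 3 + #|K p.2|.
    by apply: leq_trans h1 _; apply: leq_add h2 _; rewrite muln1 in h3.
  rewrite [#|L p|]cardsCs setCK card_ord degE; move: h4; rewrite /m; clear; lia.
pose FS := [set p : T * T | F p.1 p.2].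
have [rk [n [rank_inj rank_lt]]] : exists (rk : T -> nat) n,
    injective rk /\ forall x, rk x < n.
  exists (fun x : T => nat_of_ord (enum_rank x)), #|T|; split=> [x y h|x]; last exact: ltn_ord.
  by apply: enum_rank_inj; apply: val_inj.
(* The vertex assigned to a comes first for a; the vertices assigned to b come last for b. *)
pose ka (p : T * T) : nat := if f p.1 == Some p.2 then 0 else (rk p.2).+1.
pose kb (p : T * T) : nat := if f p.1 == Some p.2 then n + rk p.1 else rk p.1.
have key : keyed ka kb FS.
  move=> [a b] [a' b'] _ _ /=; split.
    move=> <-; rewrite /ka /=; case: eqP => h1; case: eqP => h2 //.
      by move=> _; move: h2; rewrite h1 => -[->].
    by move=> [/rank_inj->].
  move=> <-; rewrite /kb /=; case: eqP => _; case: eqP => _.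
  - by move=> /addnI/rank_inj->.
  - by move=> h; have := rank_lt a'; move: h; clear; lia.
  - by move=> h; have := rank_lt a; move: h; clear; lia.
  - by move=> /rank_inj->.
have lossE (p : T * T) : p \in FS -> losses ka kb FS p < #|L p|.
  case: p => a b; rewrite inE /= => /andP[aS ab].
  have [loadb backb] := sat a b aS ab.
  have aN : a \in N b by rewrite inE aS.
  have lossa : #|[set q in FS | (q.1 == a) && (ka q < ka (a, b))]| <= (f a != Some b).*2.
    case: (eqVneq (f a) (Some b)) => [fab|nfab] /=.
      rewrite leqn0 cards_eq0; apply/eqP/setP => -[c d]; rewrite !inE /=.
      by rewrite /ka /= fab eqxx ltn0 !andbF.
    apply: leq_trans (_ : (deg e a).-1 <= _); last first.
      by have := d3 a aS; clear; lia.
    rewrite /deg (cardsD1 b [set y | e a y]) inE ab add1n /=.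
    rewrite -(card_in_imset (f := fun q : T * T => q.2)); last first.
      move=> [c d] [c' d']; rewrite !inE /= => /and3P[_ /eqP-> _] /and3P[_ /eqP-> _] -> //.
    apply/subset_leq_card/subsetP => d /imsetP[[c d']]; rewrite !inE /= => /and3P[/andP[_ cd] /eqP ca lt] ->.
    by rewrite -ca cd andbT; apply: contraTneq lt => ->; rewrite ca ltnn.
  have lossb : #|[set q in FS | (q.2 == b) && (kb q < kb (a, b))]| +
      (if f a == Some b then 1 else (capacity b).+1) <= #|N b|.
    have inN q : q \in [set q in FS | (q.2 == b) && (kb q < kb (a, b))] ->
        [/\ q.1 \in N b, q.1 != a & q.2 = b].
      rewrite !inE => /and3P[/andP[h1 h2] /eqP E lt]; rewrite h1 -E h2; split=> //.
      by apply: contraTneq lt => h; rewrite [q]surjective_pairing E h ltnn.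
    have inj : {in [set q in FS | (q.2 == b) && (kb q < kb (a, b))] &, injective (fun q : T * T => q.1)}.
      by move=> [c d] [c' d'] /inN[_ _ /= ->] /inN[_ _ /= ->] ->.
    rewrite -(card_in_imset inj).
    case: (eqVneq (f a) (Some b)) => [fab|nfab].
      rewrite [#|N b|](cardsD1 a) aN addnC leq_add2l; apply/subset_leq_card/subsetP => c.
      by move=> /imsetP[q /inN[h1 h2 h3] ->]; rewrite in_setD1 h2.
    rewrite -loadb -addSnnS.
    have fN : [set a' | f a' == Some b] \subset N b :\ a.
      apply/subsetP => a'; rewrite in_set => /eqP fa'; rewrite in_setD1 in_set (backb _ fa').
      rewrite (fe _ _ fa').2 !andbT; apply: contraNneq nfab => <-; exact/eqP.
    rewrite addSn addnC -addnS; rewrite [#|N b|](cardsD1 a) aN add1n addnS ltnS.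
    rewrite -(cardsID [set a' | f a' == Some b] (N b :\ a)) (setIidPr fN) leq_add2l.
    apply/subset_leq_card/subsetP => c /imsetP[q qF ->]; have [h1 h2 h3] := inN q qF.
    rewrite in_setD in_setD1 h2 h1 in_set !andbT; apply/eqP => fq.
    move: qF; rewrite in_set => /and3P[_ _]; rewrite /kb /= (negPf nfab) h3 fq eqxx.
    by have := rank_lt a; clear; lia.
  move: (Lsize (a, b)) (big a b aS ab) (degM b) lossa lossb; rewrite /losses /= /capacity.
  move: #|L (a, b)| #|N b| #|[set q in FS | _]| #|[set q in FS | _]| (deg e b) M12 => l nb x y d.
  by clear; case: (f a == Some b); case: (d =P M) => h1; case: (d =P M.-1) => h2 /=; lia.
have m0 : 0 < m by rewrite /m; move: M12; clear; lia.
have [col [colL colD]] := list_edge_colouring (Ordinal m0) key lossE.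
have exX a : exists i : 'I_m, a \in S -> (forall b, e a b -> i != phi b :> nat) /\
    (forall b, e a b -> far i (col (a, b))).
  have [aS|aS] := boolP (a \in S); last by exists (Ordinal m0).
  pose B := \bigcup_(b in [set b | e a b]) exactly m (phi b)
    :|: \bigcup_(b in [set b | e a b]) window m (col (a, b)).
  have /card_gt0P[i] : 0 < #|~: B|.
    have h1 := @card_bigcup_const _ _ [set b | e a b] (fun b => exactly m (phi b)) 1
      (fun b _ => card_exactly m (phi b)).
    have h2 := @card_bigcup_const _ _ [set b | e a b] (fun b => window m (col (a, b))) 3
      (fun b _ => card_window m (col (a, b))).
    have h3 : #|B| <= deg e a * 1 + deg e a * 3.
      by apply: leq_trans (leq_card_setU _ _) _; apply: leq_add.
    rewrite cardsCs setCK card_ord subn_gt0; apply: leq_ltn_trans h3 _.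
    by rewrite /m; have := d3 a aS; move: M12; clear; lia.
  rewrite in_setC in_setU negb_or => /andP[h1 h2]; exists i => _; split=> b ab.
    by apply: contraNneq h1 => E; apply/bigcupP; exists b; rewrite !inE ?E.
  rewrite far_sym; apply: contraNT h2 => nf; apply/bigcupP; exists b; by rewrite !inE.
have /fin_all_exists[x xP] := exX.
apply: nlab; apply: (@extend_labelling _ _ e S F phi psi (fun a => x a) (fun a b => col (a, b)) se) => //.
- by move=> a b /andP[].
- by move=> a b aS ab; apply: (xP a aS).1.
- by move=> a b aS ab; rewrite /F /= aS ab.
- move=> a b Fab; have /andP[aS ab] := Fab; split=> //; first exact: (xP a aS).2.
  have := colL (a, b); rewrite inE => /(_ Fab).
  by rewrite in_setC in_setU negb_or !inE negbK => /andP[].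
- by move=> a b c /andP[aS ab] ac; rewrite /F /= aS ac.
- move=> a b c Fab bc; have /andP[aS ab] := Fab; rewrite /F /= se bc andbT => cS.
  have := colL (a, b); rewrite inE => /(_ Fab).
  rewrite in_setC in_setU negb_or => /andP[_]; apply: contraNneq => E.
  by apply/bigcupP; exists c; rewrite !inE ?cS ?bc //= E.
- move=> a b c Fab Fac bc; have : col (a, b) != col (a, c).
    by apply: colD; rewrite ?inE ?xpair_eqE ?eqxx //=; left.
  by apply: contra_neq => /val_inj.
- move=> a b c Fab Fcb ac; have : col (a, b) != col (c, b).
    by apply: colD; rewrite ?inE ?xpair_eqE ?(negPf ac) //=; right.
  by apply: contra_neq => /val_inj.
Qed.

Theorem few_low_vertices :
  #|low_vertices| <= 2 * #|[set x | deg e x == M]| + #|[set x | deg e x == M.-1]|.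
Proof.
case: (assignment_or_obstruction low_vertices e capacity) => [[f [fe fcap] tot]|]; last first.
  case=> f [S [asg S0 SX sat]]; case: (masters_saturated_reducible asg S0 SX sat).
apply: leq_trans (subset_leq_card tot) _.
apply: leq_trans (_ : \sum_b load f b <= _).
  have -> : dom f = \bigcup_b [set a | f a == Some b].
    apply/setP => a; rewrite inE; apply/idP/bigcupP.
      by case fa: (f a) => [b|] // _; exists b; rewrite ?inE ?fa.
    by case=> b _; rewrite inE => /eqP->.
  elim/big_rec2: _ => [|b n U _ IH]; first by rewrite cards0.
  by apply: leq_trans (leq_card_setU _ _) _; rewrite leq_add2l.
apply: leq_trans (leq_sum _ (fun b _ => fcap b)) _.
have sum_ind (P : pred T) k : \sum_b (if P b then k else 0) = k * #|[set x | P x]|.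
  by rewrite -big_mkcond /= sum_nat_const mulnC; congr (_ * _); apply: eq_card => b; rewrite !inE.
rewrite -(sum_ind (fun x => deg e x == M)) -[#|[set x | deg e x == M.-1]|]mul1n.
rewrite -(sum_ind (fun x => deg e x == M.-1)) -big_split; apply: leq_sum => b _.
by rewrite /capacity; do 2!case: ifP.
Qed.

End LowVertices.

(** * The counting argument *)

Section Counting.
Variables (T : finType) (M : nat) (e : rel T).
Hypothesis M12 : 12 <= M.
Hypothesis crit : critical (M + 3) e.
Hypothesis degM : forall x, deg e x <= M.
Hypothesis noK5 : ~ has_minor [set: T] e K5.
Hypothesis noK33 : ~ has_minor [set: T] e K33.

Local Notation d := (deg e).

Lemma crit_sym : symmetric e. Proof. by case: crit. Qed.
Lemma crit_irr : irreflexive e. Proof. by case: crit. Qed.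

Definition nbrs_in (B : {set T}) x := #|[set y in B | e x y]|.

Lemma double_count (A B : {set T}) :
  \sum_(x in A) nbrs_in B x = \sum_(y in B) nbrs_in A y.
Proof.
have E (A' B' : {set T}) : \sum_(x in A') nbrs_in B' x = \sum_(x in A') \sum_(y in B') e x y.
  apply: eq_bigr => x _; rewrite /nbrs_in -sum1_card (eq_bigl (fun y => (y \in B') && e x y)).
    by rewrite big_mkcondr; apply: eq_bigr => y _; case: (e x y).
  by move=> y; rewrite inE.
rewrite !E exchange_big; apply: eq_bigr => y _; apply: eq_bigr => x _.
by rewrite crit_sym.
Qed.

Lemma nbrs_in_le B x : nbrs_in B x <= d x.
Proof. by apply/subset_leq_card/subsetP => y; rewrite !inE => /andP[]. Qed.

Lemma exists_edge : exists u v, e u v.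
Proof.
case: (boolP [exists u, exists v, e u v]) => [/existsP[u /existsP[v uv]]|]; first by exists u, v.
move=> /existsPn h; have no u v : e u v = false.
  by apply/negbTE; have /existsPn := h u; apply.
case: crit => _ _ nl _; case: nl; exists (fun _ => 0), (fun _ _ => 0).
by split=> [x|x y|x y|x y|x y z|x y]; rewrite ?no // addn3.
Qed.

Lemma deg_gt1 u v : e u v -> 1 < d u.
Proof.
move=> uv; rewrite ltnNge; apply/negP => d1.
have := low_vertex_edge M12 crit uv (leq_trans d1 (isT : 1 <= 3)); have := degM v; move: d1; clear; lia.
Qed.

(** A 2-vertex would contribute too little to the edge bound, hence it is removed
    beforehand. Vertices of degree 0 are also left out. *)
Definition core := [set x | 2 < d x].
Definition two_vertices := [set x | d x == 2].

Lemma two_vertex_nbr u v : e u v -> d u = 2 -> d v = M.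
Proof.
move=> uv d2; have := low_vertex_edge M12 crit uv; rewrite d2 => /(_ isT); have := degM v.
clear; lia.
Qed.

Lemma core_neq0 : 0 < #|core|.
Proof.
have [u [v uv]] := exists_edge; have [d2|d2] := eqVneq (d u) 2.
  by apply/card_gt0P; exists v; rewrite inE (two_vertex_nbr uv d2); move: M12; clear; lia.
by apply/card_gt0P; exists u; rewrite inE ltn_neqAle eq_sym d2 (deg_gt1 uv).
Qed.

Lemma deg_core x : d x = nbrs_in core x + nbrs_in two_vertices x.
Proof.
rewrite /deg /nbrs_in -(cardsID core [set y | e x y]); congr (_ + _); apply: eq_card => y.
  by rewrite !inE andbC.
rewrite !inE -leqNgt; case xy: (e x y); rewrite ?andbF ?andbT //=.
by rewrite eqn_leq andbC; have := deg_gt1 (etrans (crit_sym y x) xy) => ->.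
Qed.

(** A 2-vertex outside the core takes away two edges from the core. *)
Lemma core_degree_sum : \sum_(x in core) d x < 6 * #|core| + 2 * #|two_vertices|.
Proof.
under eq_bigr do rewrite deg_core.
rewrite big_split /=; have -> : \sum_(x in core) nbrs_in core x = #|arcs core e|.
  by rewrite arcs_sum.
have ar : #|arcs core e| < 6 * #|core|.
  have [W3|W3] := ltnP 2 #|core|.
    rewrite ltnNge; apply/negP => many; apply: noK5.
    apply: (@has_minorS _ _ _ _ core e e) => //; rewrite ?subsetT //.
    by apply: K5_minor_of_arcs; [exact: crit_sym|exact: crit_irr| |move: many; clear; lia].
  have := arcs_bound core crit_irr; have := core_neq0; move: W3; clear; nia.
rewrite double_count.
have : \sum_(y in two_vertices) nbrs_in core y <= 2 * #|two_vertices|.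
  rewrite mulnC -sum_nat_const; apply: leq_sum => y; rewrite inE => /eqP <-; exact: nbrs_in_le.
by move: ar; clear; lia.
Qed.

Definition low_nbrs x := [set y | e x y && (d y <= 7)].

(** Four low neighbours are excluded by [five_vertex_four_low], and three with one
    of degree at most 6 by [five_vertex_three_low]. *)
Lemma five_vertex_low_nbrs x : d x = 5 -> #|low_nbrs x| <= 3 /\ (#|low_nbrs x| = 3 -> forall y, y \in low_nbrs x -> d y = 7).
Proof.
move=> d5; split.
  rewrite leqNgt; apply/negP => l4.
  have : uniq (enum (low_nbrs x)) by apply: enum_uniq.
  have : {subset enum (low_nbrs x) <= low_nbrs x} by move=> z; rewrite mem_enum.
  move: l4; rewrite cardE; case: (enum _) => [|v1 [|v2 [|v3 [|v4 l]]]] //= _ sub un.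
  have [] : [/\ v1 \in low_nbrs x, v2 \in low_nbrs x, v3 \in low_nbrs x & v4 \in low_nbrs x].
    by split; apply: sub; rewrite !inE eqxx ?orbT.
  rewrite !inE => /andP[e1 d1] /andP[e2 d2] /andP[e3 d3] /andP[e4 d4].
  apply: (@five_vertex_four_low _ _ _ M12 crit x v1 v2 v3 v4) => //; last by rewrite e1 e2 e3.
  move: un; rewrite /= !inE !negb_or -!andbA.
  by move=> /and5P[-> -> -> _ /and5P[-> -> _ -> _]].
move=> l3 y yl.
have /andP[ey dy] : e x y && (d y <= 7) by rewrite inE in yl.
apply/eqP; rewrite eqn_leq dy leqNgt; apply/negP => dy6.
have : #|low_nbrs x :\ y| = 2 by have := cardsD1 y (low_nbrs x); rewrite yl l3; clear; lia.
move=> /eqP/cards2P[v [w [vw E]]].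
have [] : v \in low_nbrs x :\ y /\ w \in low_nbrs x :\ y by rewrite E !inE !eqxx orbT.
rewrite !inE => /and3P[vy ev dv] /and3P[wy ew dw].
apply: (@five_vertex_three_low _ _ _ M12 crit x y v w) => //; last by rewrite ey ev.
by rewrite /= !inE negb_or !(eq_sym y) vy wy vw.
Qed.

(** The 5-vertices with only two neighbours of degree at least 8. *)
Definition tight := [set x | (d x == 5) && (#|low_nbrs x| == 3)].
(** A tight vertex needs one unit from its 7-neighbours. A 7-vertex with at most one
    tight neighbour can pay for it; one with more tight neighbours is better
    counted among the large vertices. *)
Definition rich7 := [set y | (d y == 7) && (1 < nbrs_in tight y)].
Definition poor7 := [set y | (d y == 7) && (nbrs_in tight y <= 1)].
Definition small := [set x | 2 < d x < 6].
Definition large := [set y | 7 < d y] :|: rich7.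

Lemma small_not_large x : x \in small -> x \notin large.
Proof. by rewrite !inE; case: (_ < nbrs_in _ _); rewrite ?andbF ?andbT; clear; lia. Qed.

(** The bound for bipartite graphs without K33 minor, applied to the edges
    between small and large vertices. *)
Lemma small_large_bound : \sum_(x in small) nbrs_in large x <= 2 * (#|small| + #|large|).
Proof.
pose f : rel T := [rel x y | e x y && ((x \in small) && (y \in large) || (x \in large) && (y \in small))].
have fs : symmetric f by move=> x y; rewrite /f /= crit_sym orbC (andbC (x \in large)) (andbC (x \in small)).
have fb : bipartite [pred x | x \in small] f.
  move=> x y /andP[_ /orP[]/andP[h1 h2]] /=.
    by rewrite h1; apply: contraTN h2 => /eqP h; apply: small_not_large; rewrite -h.
  by rewrite h2 eqb_id; apply: contraTN h1 => h; apply: small_not_large.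
have := @bipartite_arcs_bound _ [pred x | x \in small] (small :|: large) f fs fb.
rewrite cardsU (_ : small :&: large = set0) ?cards0 ?subn0; last first.
  by apply/setP => x; rewrite inE in_set0; apply/negP => /andP[/small_not_large/negP].
move=> bnd; apply: leq_trans (bnd _); last first.
  move=> h; apply: noK33; apply: has_minorS h; first exact: subsetT.
  by move=> x y _ _ /andP[].
rewrite /side_arcs -sum1_card.
rewrite (eq_bigl (fun p : T * T => (p.1 \in small) && ((p.2 \in large) && e p.1 p.2))); last first.
  move=> [x y]; rewrite in_set mem_arcs /f /= ![_ \in small :|: _]in_setU.
  case xs: (x \in small); rewrite ?andbF //= andbT.
  by rewrite (negPf (small_not_large xs)) /= orbF; case: (y \in large) (e x y) => [] []; rewrite ?orbT ?andbF.
rewrite -(pair_big_dep (mem small) (fun x y => (y \in large) && e x y) (fun _ _ => 1)) /=.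
apply: leq_sum => x _; rewrite /nbrs_in -sum1_card.
by rewrite (eq_bigl (fun y => (y \in large) && e x y)) // => y; rewrite inE.
Qed.

Lemma card_indicator (A P : {set T}) : P \subset A -> #|P| = \sum_(x in A) (x \in P).
Proof.
move=> /setIidPr PA; rewrite -{1}PA -sum1_card (eq_bigl (fun x => (x \in A) && (x \in P))).
  by rewrite big_mkcondr; apply: eq_bigr => x _; case: (x \in P).
by move=> x; rewrite inE.
Qed.

Lemma card_low_nbrs x : #|low_nbrs x| + nbrs_in [set y | 7 < d y] x = d x.
Proof.
rewrite /deg -(cardsID (low_nbrs x) [set y | e x y]); congr (_ + _); apply: eq_card => y.
  by rewrite !inE; case: (e x y).
by rewrite !inE; case: (e x y); rewrite ?andbF ?andbT //= -ltnNge.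
Qed.

Lemma nbrs_in_large x : nbrs_in large x = nbrs_in [set y | 7 < d y] x + nbrs_in rich7 x.
Proof.
rewrite /nbrs_in -(cardsID [set y | 7 < d y] [set y in large | e x y]).
congr (_ + _); apply: eq_card => y; rewrite !inE.
  by case: (7 < d y); rewrite ?andbT ?andbF.
case: eqP => [->|_]; rewrite /= ?orbF; first by case: (e x y); rewrite ?andbF ?andbT.
by case: (7 < d y); rewrite ?andbF.
Qed.

Lemma tight_sevens x : x \in tight -> nbrs_in rich7 x + nbrs_in poor7 x = 3.
Proof.
rewrite inE => /andP[/eqP d5 /eqP l3]; rewrite -[RHS]l3; have [_ /(_ l3) all7] := five_vertex_low_nbrs d5.
rewrite -(cardsID rich7 (low_nbrs x)); congr (_ + _); apply: eq_card => y.
  rewrite in_set [RHS]in_setI; case: (boolP (y \in rich7)) => yr; rewrite ?andbF // andbT.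
  by move: yr; rewrite !inE => /andP[/eqP-> _]; rewrite andbT.
rewrite in_set [RHS]in_setD; have [yl|] := boolP (y \in low_nbrs x).
  have := all7 y yl; move: yl; rewrite !inE => /andP[-> _] ->; by rewrite eqxx /= -leqNgt !andbT.
rewrite andbF !inE; case: eqP => [->|] //=; rewrite andbT => /negPf->; by rewrite andbF.
Qed.

Lemma low_nbrs_small_deg x : 2 < d x < 5 -> #|low_nbrs x| = 0.
Proof.
move=> dx; apply/eqP; rewrite cards_eq0; apply/eqP/setP => y; rewrite !inE.
apply/negP => /andP[xy dy]; have [d3|d4] : d x = 3 \/ d x = 4 by move: dx; clear; lia.
  have := low_vertex_edge M12 crit xy; rewrite d3 => /(_ isT); move: dy M12; clear; lia.
by have := four_vertex_edge M12 crit xy d4; rewrite ltnNge dy.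
Qed.

(** The left side is the cost of [x] in the sum of both edge bounds, together with
    what [x] pays for others: a vertex of degree [M], or [M - 1], can pay four, or
    three, units for the low vertices assigned to it, and a low vertex needs two. *)
Lemma vertex_charge x : x \in core ->
  6 + 2 * (x \in small) + 2 * (x \in large) + (x \in tight) * nbrs_in rich7 x + (x \in poor7)
    + 4 * (d x == M) + 3 * (d x == M.-1)
  <= d x + (x \in small) * nbrs_in large x + 2 * (d x == 3) + (x \in tight) + (x \in rich7).
Proof.
move=> xc; have d3 : 2 < d x by rewrite inE in xc.
have hi := card_low_nbrs x; have tl := nbrs_in_large x.
have nM k : k < 11 -> ((k == M) = false) * ((k == M.-1) = false).
  by move=> k11; split; apply/negbTE; move: k11 M12; clear; lia.
have [dx|dx|] : [\/ d x = 3, d x = 4 | 4 < d x] by move: d3; clear; case: (d x) => [|[|[|[|[|n]]]]] // _; [constructor 1|constructor 2|constructor 3].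
- have l0 := low_nbrs_small_deg (x := x); rewrite dx in l0 hi.
  by rewrite !inE dx !nM //= tl; move: hi; rewrite l0 //; clear; lia.
- have l0 := low_nbrs_small_deg (x := x); rewrite dx in l0 hi.
  by rewrite !inE dx !nM //= tl; move: hi; rewrite l0 //; clear; lia.
move=> d4; have [dx|dx|dx] : [\/ d x = 5, d x = 6 | 6 < d x].
  by move: d4; clear; case: (d x) => [|[|[|[|[|[|[|n]]]]]]] // _; [constructor 1|constructor 2|constructor 3].
- have [lo3 _] := five_vertex_low_nbrs dx; rewrite !inE dx !nM //= tl; rewrite dx in hi.
  by move: hi lo3; case: eqP => h; rewrite /=; move: h; clear; lia.
- by rewrite !inE dx !nM.
(* A poor 7-vertex has one unit left, a rich one lacks one. *)
have [dx7|dx8] : d x = 7 \/ 7 < d x by move: dx; clear; lia.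
  by rewrite !inE dx7 !nM //= (leqNgt (nbrs_in tight x)); case: (1 < nbrs_in tight x).
have -> : x \in small = false by rewrite inE; move: dx8; clear; lia.
have -> : x \in tight = false by rewrite inE; move: dx8; clear; lia.
have -> : x \in poor7 = false by rewrite inE; move: dx8; clear; lia.
have -> : x \in rich7 = false by rewrite inE; move: dx8; clear; lia.
have -> : x \in large = true by rewrite !inE dx8.
move: dx8 (degM x) M12; clear; case: eqP => h1; case: eqP => h2; lia.
Qed.

(** Each 7-neighbour of a tight vertex is rich or poor. With [R] and [P] the numbers
    of edges from tight to rich and to poor vertices, there are [(R + P) / 3]
    tight vertices, at most [R / 2] rich ones and at least [P] poor ones, so
    that the charges [R - tight - rich + poor] do not become negative. *)
Theorem no_critical : False.
Proof.
have tot : \sum_(x in core) (6 + 2 * (x \in small) + 2 * (x \in large) +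
      (x \in tight) * nbrs_in rich7 x + (x \in poor7) + 4 * (d x == M) + 3 * (d x == M.-1))
  <= \sum_(x in core) (d x + (x \in small) * nbrs_in large x + 2 * (d x == 3) + (x \in tight) + (x \in rich7)).
  by apply: leq_sum => x; apply: vertex_charge.
have sumb (P : {set T}) (F : T -> nat) : P \subset core ->
    \sum_(x in core) (x \in P) * F x = \sum_(x in P) F x.
  move=> /setIidPr PA; rewrite -{2}PA.
  rewrite [RHS](eq_bigl (fun x => (x \in core) && (x \in P))); last by move=> x; rewrite inE.
  by rewrite big_mkcondr; apply: eq_bigr => x _; case: (x \in P); rewrite ?mul1n.
have sub_core (P : {set T}) : (forall x, x \in P -> 2 < d x) -> P \subset core.
  by move=> h; apply/subsetP => x /h; rewrite inE.
have c_small : small \subset core by apply: sub_core => x; rewrite inE => /andP[].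
have c_tri : tight \subset core by apply: sub_core => x; rewrite inE => /andP[/eqP->].
have c_rich : rich7 \subset core by apply: sub_core => x; rewrite inE => /andP[/eqP->].
have c_poor : poor7 \subset core by apply: sub_core => x; rewrite inE => /andP[/eqP->].
have c_large : large \subset core.
  by apply: sub_core => x; rewrite !inE => /orP[|/andP[/eqP->//]]; clear; lia.
have c_k k : 2 < k -> [set x | d x == k] \subset core.
  by move=> k2; apply: sub_core => x; rewrite inE => /eqP->.
have sumd k : 2 < k -> \sum_(x in core) (d x == k) = #|[set x | d x == k]|.
  by move=> k2; rewrite (card_indicator (c_k k k2)); apply: eq_bigr => x _; rewrite inE.
have e1 : \sum_(x in tight) nbrs_in rich7 x + \sum_(x in tight) nbrs_in poor7 x = 3 * #|tight|.
  by rewrite -big_split mulnC -sum_nat_const; apply: eq_bigr => x; apply: tight_sevens.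
have e2 : 2 * #|rich7| <= \sum_(x in tight) nbrs_in rich7 x.
  rewrite double_count mulnC -sum_nat_const; apply: leq_sum => y; by rewrite inE => /andP[].
have e3 : \sum_(x in tight) nbrs_in poor7 x <= #|poor7|.
  rewrite double_count -[#|poor7|]muln1 -sum_nat_const; apply: leq_sum => y; by rewrite inE => /andP[].
have low : #|two_vertices| + #|[set x | d x == 3]| = #|low_vertices e|.
  rewrite -[RHS](cardsID two_vertices); congr (_ + _); apply: eq_card => x; rewrite !inE.
    by case: eqP => [->|]; rewrite ?andbF.
  case: (posnP (d x)) => [->//|d0] /=.
  by have [y] := card_gt0P d0; rewrite inE => /deg_gt1; clear; lia.
have masters := few_low_vertices M12 crit degM.
have M2 : 2 < M by move: M12; clear; lia.
have M3 : 2 < M.-1 by move: M12; clear; lia.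
move: tot; rewrite !big_split /= !big1_eq !sumd // !sumb // -!card_indicator // sum_nat_const.
move: core_degree_sum small_large_bound e1 e2 e3 low masters.
move: (\sum_(x in core) d x) (\sum_(x in small) _) (\sum_(x in tight) nbrs_in rich7 x)
  (\sum_(x in tight) nbrs_in poor7 x) #|core| #|two_vertices| #|small| #|large| #|tight| #|rich7| #|poor7|
  #|low_vertices e| #|[set x | d x == 3]| #|[set x | d x == M]| #|[set x | d x == M.-1]|.
clear; lia.
Qed.

End Counting.

(** * From plane drawings to flat drawings *)

Section Curves.
Import Order.TTheory GRing.Theory Num.Theory numFieldNormedType.Exports.
Variable R : realType.
Local Open Scope ring_scope.
Local Notation I01 := (fun t : R => 0 <= t <= 1).

(** Compactness of the unit interval, with a single small parameter. *)
Lemma unit_interval_uniform (P : R -> R -> Prop) :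
  (forall t : R, I01 t -> exists2 d : R, 0 < d &
     forall t' : R, I01 t' -> `|t - t'| < d -> forall eps : R, 0 < eps < d -> P eps t') ->
  exists2 eps : R, 0 < eps & forall t : R, I01 t -> P eps t.
Proof.
move=> loc.
have /compact_near_coveringP cov := @segment_compact R 0 1.
have := cov R (0^'+)%classic (fun eps t => 0 < eps -> I01 t -> P eps t) _ _.
case.
- move=> t; rewrite /= in_itv /= => t01.
  have [d d0 dP] := loc t t01.
  exists (ball t d, [set eps | 0 < eps < d]%classic); first split => /=.
  + exact: nbhsx_ballx.
  + near=> eps; apply/andP; split; near: eps.
      exact: nbhs_right_gt.
    exact: nbhs_right_lt.
  + move=> [t' eps] /= [tt' /andP[eps0 epsd]] _ t'01; apply: (dP t') => //.
    by apply/andP.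
- move=> d /= d0 dP; exists (d / 2); first by lra.
  move=> t t01; apply: (dP (d / 2)) => /=.
  + by rewrite /ball_ /= sub0r normrN gtr0_norm; lra.
  + by lra.
  + by rewrite in_itv.
  + by lra.
  + by [].
Unshelve. all: by end_near. Qed.

Definition cts01 (f : R -> R * R) := forall t : R, I01 t -> forall eps : R, 0 < eps ->
  exists2 d : R, 0 < d & forall t' : R, I01 t' -> `|t - t'| < d -> sup_close eps (f t) (f t').

Lemma within_cts01 (f : R -> R * R) :
  {within `[0, 1]%classic, continuous f}%classic -> cts01 f.
Proof.
move=> /subspace_continuousP fc t t01 eps eps0.
have := fc t _ (ball (f t) eps) (nbhsx_ballx _ _ eps0).
rewrite /= in_itv /= => /(_ t01); rewrite /within /=.
case=> d /= d0 dP; exists d => // t' t'01 tt'.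
have [/= h1 h2] := dP t' tt' ltac:(by rewrite /= in_itv).
by rewrite /sup_close !ltW.
Qed.

Lemma cts01_uniform f eps : cts01 f -> 0 < eps ->
  exists2 d : R, 0 < d & forall t t' : R, I01 t -> I01 t' -> `|t - t'| < d -> sup_close eps (f t) (f t').
Proof.
move=> fc eps0.
have [|d d0 dP] := @unit_interval_uniform
   (fun d t => forall t' : R, I01 t' -> `|t - t'| < d -> sup_close eps (f t) (f t')).
  move=> t t01; have [|d d0 dP] := fc t t01 (eps / 2); first by lra.
  exists (d / 2); first by lra.
  move=> t' t'01 tt' d' /andP[d'0 d'd] t'' t''01 t't''.
  have c1 : sup_close (eps / 2) (f t) (f t') by apply: dP => //; lra.
  have c2 : sup_close (eps / 2) (f t) (f t'').
    apply: dP => //; have -> : t - t'' = (t - t') + (t' - t'') by ring.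
    by apply: le_lt_trans (ler_normD _ _) _; lra.
  move: c1 c2; rewrite !sup_closeE => /and4P[? ? ? ?] /and4P[? ? ? ?].
  by apply/and4P; split; lra.
by exists d => // t t' t01 t'01; apply: dP.
Qed.

Lemma sup_close_le (eps eps' : R) z w : eps <= eps' -> sup_close eps z w -> sup_close eps' z w.
Proof. by move=> le /andP[h1 h2]; rewrite /sup_close !(le_trans _ le). Qed.

Lemma sup_close_neq (z w : R * R) : z <> w -> exists2 eps : R, 0 < eps & ~~ sup_close eps z w.
Proof.
move=> zw; pose e := Num.max `|z.1 - w.1| `|z.2 - w.2|.
have e0 : 0 < e.
  rewrite lt_max !normr_gt0 !subr_eq0 -negb_and; apply/negP => /andP[/eqP h1 /eqP h2].
  by apply: zw; apply/eqP; rewrite -pair_eqE /= h1 h2 !eqxx.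
exists (e / 2); first by lra.
rewrite /sup_close -ge_max -/e; apply/negP; lra.
Qed.

Lemma point_curve_far f z : cts01 f -> (forall t : R, I01 t -> f t <> z) ->
  exists2 eps : R, 0 < eps & forall t : R, I01 t -> ~~ sup_close eps (f t) z.
Proof.
move=> fc fz; apply: unit_interval_uniform => t t01.
have [eps eps0 epsP] := sup_close_neq (fz t t01).
have [|d d0 dP] := fc t t01 (eps / 2); first by lra.
exists (Num.min d (eps / 2)); first by rewrite lt_min; apply/andP; split; lra.
move=> t' t'01; rewrite lt_min => /andP[td te] eps'; rewrite lt_min => /and3P[e0 ed ee].
apply: contraNN epsP => c1; have c2 := dP t' t'01 td.
move: c1 c2; rewrite !sup_closeE => /and4P[? ? ? ?] /and4P[? ? ? ?].
by apply/and4P; split; lra.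
Qed.

(** Disjoint compact sets have a positive distance. *)
Lemma curve_curve_far f g : cts01 f -> cts01 g ->
  (forall s t : R, I01 s -> I01 t -> f s <> g t) ->
  exists2 eps : R, 0 < eps & forall s t, I01 s -> I01 t -> ~~ sup_close eps (f s) (g t).
Proof.
move=> fc gc fg.
have [|d d0 dP] := @unit_interval_uniform
   (fun d t => forall t' : R, I01 t' -> ~~ sup_close d (f t) (g t')).
  move=> s s01; have [|eps eps0 epsP] := @point_curve_far g (f s) gc.
    by move=> t t01 E; apply: (fg s t).
  have [|d d0 dP] := fc s s01 (eps / 2); first by lra.
  exists (Num.min d (eps / 2)); first by rewrite lt_min; apply/andP; split; lra.
  move=> s' s'01; rewrite lt_min => /andP[td te] eps'; rewrite lt_min => /and3P[e0 ed ee].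
  move=> t t01; apply: contraNN (epsP t t01) => c1; have c2 := dP s' s'01 td.
  move: c1 c2; rewrite !sup_closeE => /and4P[? ? ? ?] /and4P[? ? ? ?].
  by apply/and4P; split; lra.
by exists d => // t t' t01 t'01; apply: dP.
Qed.

Definition polyline (f : R -> R * R) (n : nat) : seq ((R * R) * (R * R)) :=
  [seq (f (i%:R / n%:R), f (i.+1%:R / n%:R)) | i <- iota 0 n].

Lemma polyline_bound f n : (0 < n)%N -> chain_bound (polyline f n) (f 0) (f 1).
Proof.
move=> n0 g; rewrite /chain_sum big_map /=.
pose h i := g (f (i%:R / n%:R)).
have -> : g (f 0) (+) g (f 1) = h 0%N (+) h n.
  by rewrite /h mul0r divff // pnatr_eq0 -lt0n.
suff H m : \big[addb/false]_(i <- iota 0 m) (h i (+) h i.+1) = h 0%N (+) h m by exact: H.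
elim: m => [|m IH]; first by rewrite big_nil addbb.
rewrite -addn1 iotaD big_cat /= {}IH big_cons big_nil addbF add0n addn1.
by case: (h 0%N) (h m) (h m.+1) => [] [] [].
Qed.

Lemma polyline_steps f n eps d s : 0 < d -> (d^-1 < n%:R) ->
  (forall t t' : R, I01 t -> I01 t' -> `|t - t'| < d -> sup_close eps (f t) (f t')) ->
  s \in polyline f n ->
  sup_close eps s.1 s.2 /\ exists t t', [/\ I01 t, I01 t', s.1 = f t & s.2 = f t'].
Proof.
move=> d0 dn fd /mapP[i]; rewrite mem_iota add0n => /andP[_ ilt] -> /=.
have n0 : 0 < n%:R :> R by rewrite ltr0n; apply: leq_trans ilt.
have t01 j : (j <= n)%N -> I01 (j%:R / n%:R).
  by move=> jn; rewrite divr_ge0 ?ler0n //= ler_pdivrMr // mul1r ler_nat.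
split; last by exists (i%:R / n%:R), (i.+1%:R / n%:R); split=> //; apply: t01; rewrite // ltnW.
apply: fd; [by apply: t01; rewrite ltnW | exact: t01 |].
rewrite -mulrBl -natr1 opprD addrA subrr sub0r mulN1r normrN gtr0_norm ?invr_gt0 //.
by rewrite -(invrK d) ltf_pV2 // posrE ?invr_gt0.
Qed.

Lemma common_eps (I : finType) (Q : I -> R -> Prop) :
  (forall i a b, 0 < b <= a -> Q i a -> Q i b) ->
  (forall i, exists2 a : R, 0 < a & Q i a) ->
  exists2 a : R, 0 < a & forall i, Q i a.
Proof.
move=> mono exQ.
have /fin_all_exists[a aP] : forall i, exists a : R, 0 < a /\ Q i a.
  by move=> i; have [a a0 Qa] := exQ i; exists a.
have m0 : 0 < \big[Num.min/1]_i a i.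
  by elim/big_ind: _ => // [x y x0 y0|i _]; [rewrite lt_min x0 | case: (aP i)].
exists (\big[Num.min/1]_i a i) => // i.
by apply: (mono i (a i)); [rewrite m0 bigmin_le | case: (aP i)].
Qed.

Section Drawing.
Variables (G : sgraph) (pos : G -> R * R) (arc : edge G -> R -> R * R).
Hypothesis drawn : plane_drawing pos arc.

Lemma arc_cts (e : edge G) : cts01 (arc e).
Proof. exact/within_cts01/(drawing_arc_cont drawn). Qed.

Lemma unit_interval_cases (t : R) : I01 t -> [\/ t = 0, t = 1 | t \in `]0, 1[].
Proof.
move=> /andP[]; rewrite le_eqVlt => /orP[/eqP <-|t0]; first by constructor 1.
by rewrite le_eqVlt => /orP[/eqP ->|t1]; [constructor 2|constructor 3; rewrite in_itv /= t0].
Qed.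

Lemma arc_off_vertex (e : edge G) (w : G) (t : R) : w \notin val e -> I01 t -> arc e t <> pos w.
Proof.
move=> we t01; have [u [v [E e0 e1]]] := drawing_ends drawn e.
case: (unit_interval_cases t01) => [->|->|]; last exact: (drawing_avoids_vertices drawn).
  by rewrite e0 => /(drawing_pos_inj drawn) uw; rewrite E -uw !inE eqxx in we.
by rewrite e1 => /(drawing_pos_inj drawn) vw; rewrite E -vw !inE eqxx orbT in we.
Qed.

Lemma arc_end (e : edge G) (t : R) : I01 t -> t \notin `]0, 1[ -> exists2 w, w \in val e & arc e t = pos w.
Proof.
move=> t01 tn; have [u [v [-> e0 e1]]] := drawing_ends drawn e.
case: (unit_interval_cases t01) => [->|->|h]; last by rewrite h in tn.
  by exists u; rewrite // !inE eqxx.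
by exists v; rewrite // !inE eqxx orbT.
Qed.

Lemma arcs_off (e f : edge G) (s t : R) : [disjoint val e & val f] -> I01 s -> I01 t ->
  arc e s <> arc f t.
Proof.
move=> dis s01 t01.
have [si|/(arc_end e s01)[w we ->]] := boolP (s \in `]0, 1[); last first.
  by move/esym; apply: arc_off_vertex => //; rewrite (disjointFr dis we).
have [ti|/(arc_end f t01)[w wf ->]] := boolP (t \in `]0, 1[); last first.
  by apply: arc_off_vertex => //; rewrite (disjointFl dis wf).
apply: (drawing_no_crossing drawn) => //; apply/eqP => ef.
have [u [v [E _ _]]] := drawing_ends drawn e.
have ue : u \in val e by rewrite E !inE eqxx.
by have := disjointFr dis ue; rewrite -ef ue.
Qed.

Lemma drawing_separation : exists2 eps : R, 0 < eps &
  (forall e f : edge G, [disjoint val e & val f] -> forall s t : R, I01 s -> I01 t ->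
     ~~ sup_close eps (arc e s) (arc f t)) /\
  (forall (e : edge G) (w : G), w \notin val e -> forall t : R, I01 t ->
     ~~ sup_close eps (arc e t) (pos w)).
Proof.
have mono z w (a b : R) : 0 < b <= a -> ~~ sup_close a z w -> ~~ sup_close b z w.
  by move=> /andP[_ ba]; apply: contraNN; apply: sup_close_le.
have [a a0 aP] : exists2 eps : R, 0 < eps & forall p : edge G * edge G,
    [disjoint val p.1 & val p.2] -> forall s t : R, I01 s -> I01 t ->
     ~~ sup_close eps (arc p.1 s) (arc p.2 t).
  apply: common_eps.
    by move=> p a b ba h dis s t s01 t01; apply: mono ba _; apply: h.
  case=> e f /=; have [dis|dis] := boolP [disjoint val e & val f]; last by exists 1.
  have [|a a0 aP] := curve_curve_far (@arc_cts e) (@arc_cts f).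
    by move=> s t; apply: arcs_off.
  by exists a => // _; apply: aP.
have [b b0 bP] : exists2 eps : R, 0 < eps & forall p : edge G * G,
    p.2 \notin val p.1 -> forall t : R, I01 t -> ~~ sup_close eps (arc p.1 t) (pos p.2).
  apply: common_eps.
    by move=> p a' b ba h dis s s01; apply: mono ba _; apply: h.
  case=> e w /=; have [dis|dis] := boolP (w \notin val e); last by exists 1.
  have [|b b0 bP] := point_curve_far (z := pos w) (@arc_cts e).
    by move=> t; apply: arc_off_vertex.
  by exists b => // _; apply: bP.
exists (Num.min a b); first by rewrite lt_min a0.
split=> [e f dis s t s01 t01|e w we t t01].
  by apply: (mono _ _ a); [rewrite lt_min a0 b0 ge_min lexx | apply: (aP (e, f))].
by apply: (mono _ _ b); [rewrite lt_min a0 b0 ge_min lexx orbT | apply: (bP (e, w))].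
Qed.

Lemma edge_of_adj (u v : G) : adj u v -> exists2 e : edge G, val e = [set u; v]%SET &
  insub [set u; v]%SET = Some e.
Proof.
move=> uv; have h : [set u; v]%SET \in edges G by apply/imset2P; exists u v; rewrite ?inE.
by exists (Sub [set u; v]%SET h); rewrite ?SubK ?insubT.
Qed.

(** Fix [eps] smaller than the distance of disjoint arcs and of vertices to arcs
    that avoid them, and sample the arcs so finely that consecutive points are
    [eps]-close: crossings would produce [eps]-close points. *)
Theorem drawing_flat : exists c, flat_drawing (@adj G) pos c.
Proof.
have [eps eps0 [sepE sepV]] := drawing_separation.
have [d d0 dP] : exists2 d : R, 0 < d & forall (e : edge G) (t t' : R), I01 t -> I01 t' ->
    `|t - t'| < d -> sup_close eps (arc e t) (arc e t').
  apply: common_eps => [e a b /andP[_ ba] h t t' t01 t'01 tt'|e].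
    by apply: h => //; apply: lt_le_trans ba.
  exact: cts01_uniform (@arc_cts e) eps0.
(* Subdivision into n parts makes the parameter steps shorter than d. *)
pose n := Num.bound d^-1.
have dn : d^-1 < n%:R by apply: archi_boundP; rewrite invr_ge0 ltW.
have n0 : (0 < n)%N by rewrite -(ltr0n R); apply: lt_trans dn; rewrite invr_gt0.
have steps e s : s \in polyline (arc e) n -> sup_close eps s.1 s.2 /\
    exists t t', [/\ I01 t, I01 t', s.1 = arc e t & s.2 = arc e t'].
  by move=> se; apply: (polyline_steps d0 dn (dP e) se).
exists (fun u v => if insub [set u; v]%SET is Some e then polyline (arc e) n else [::]).
split; first exact: (drawing_pos_inj drawn).
- move=> u v uv; have [e Ee ->] := edge_of_adj uv.
  have [u' [v' [E e0 e1]]] := drawing_ends drawn e.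
  have := polyline_bound (arc e) n0; rewrite e0 e1.
  have nuv : u != v by apply: contraTneq uv => ->; rewrite adj_irr.
  have : u \in [set u'; v']%SET by rewrite -E Ee !inE eqxx.
  have : v \in [set u'; v']%SET by rewrite -E Ee !inE eqxx orbT.
  rewrite !inE => /orP[]/eqP vE /orP[]/eqP uE; rewrite -?vE -?uE //.
  + by rewrite uE vE eqxx in nuv.
  + exact: chain_bound_sym.
  + by rewrite uE vE eqxx in nuv.
- move=> u v w z uv wz uw uz vw vz.
  have [e Ee ->] := edge_of_adj uv; have [f Ef ->] := edge_of_adj wz.
  have dis : [disjoint val e & val f].
    rewrite Ee Ef; apply/pred0P => x /=; rewrite !inE.
    by apply/negP => /andP[/orP[]/eqP -> /orP[]/eqP E]; rewrite E eqxx in uw uz vw vz.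
  rewrite /chain_cross /chain_sum big_seq big1 // => s /steps[ss [s1 [s2 [? ? E1 E2]]]].
  rewrite big_seq big1 // => t /steps[tt [t1 [t2 [? ? F1 F2]]]].
  apply/negbTE/negP => /(step_cross_close ss tt).
  by rewrite E1 E2 F1 F2 (negPf (sepE _ _ dis _ _ _ _)) ?(negPf (sepE _ _ dis _ _ _ _)).
- move=> u v w uv wu wv; have [e Ee ->] := edge_of_adj uv.
  have we : w \notin val e by rewrite Ee !inE negb_or wu.
  split; rewrite /chain_diag /chain_band /chain_sum big_seq big1 // =>
    s /steps[ss [s1 [s2 [? ? E1 E2]]]]; apply/negbTE/negP.
    move=> /(step_diag_close ss).
    by rewrite E1 E2 (negPf (sepV _ _ we _ _)) ?(negPf (sepV _ _ we _ _)).
  move=> /(step_band_close ss).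
  by rewrite E1 E2 (negPf (sepV _ _ we _ _)) ?(negPf (sepV _ _ we _ _)).
Qed.

End Drawing.

Theorem planar_no_minors (G : sgraph) : planar R G ->
  ~ has_minor [set: G]%SET (@adj G) K5 /\ ~ has_minor [set: G]%SET (@adj G) K33.
Proof.
case=> pos [arc drawn]; have [c flat] := drawing_flat drawn.
by split; [exact: flat_no_K5 flat | exact: flat_no_K33 flat].
Qed.

End Curves.

(** * Labelling numbers of planar graphs *)

Theorem minor_free_labellable (T : finType) (M : nat) (e : rel T) :
  12 <= M -> symmetric e -> irreflexive e -> (forall x, deg e x <= M) ->
  ~ has_minor [set: T]%SET e K5 -> ~ has_minor [set: T]%SET e K33 -> labellable (M + 3) e.
Proof.
move=> M12 se ie dM n5 n33.
move: {2}#|arcs [set: T] e| (leqnn #|arcs [set: T] e|) => n.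
elim: n e se ie dM n5 n33 => [|n IH] e se ie dM n5 n33 le; apply: contrapT => nlab;
  apply: (no_critical M12 _ dM n5 n33); split=> // e' se' sub [x [y /andP[xy nxy]]];
  have lt : #|arcs [set: T] e'| < #|arcs [set: T] e|.
- apply/proper_card/properP; split; first by apply: arcsS => // a b _ _; apply: sub.
  by exists (x, y); rewrite mem_arcs !inE.
- by move: lt le; clear; lia.
- apply/proper_card/properP; split; first by apply: arcsS => // a b _ _; apply: sub.
  by exists (x, y); rewrite mem_arcs !inE.
apply: IH => //.
- by move=> a; apply/negbTE/negP => /sub; rewrite ie.
- move=> a; apply: leq_trans (dM a); apply/subset_leq_card/subsetP => b; rewrite !inE; exact: sub.
- by move=> h; apply: n5; apply: has_minorS h => // a b _ _; apply: sub.
- by move=> h; apply: n33; apply: has_minorS h => // a b _ _; apply: sub.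
- by move: lt le; clear; lia.
Qed.

Section Transfer.
Variable G : sgraph.

Lemma edge_ends (e : edge G) : exists u v : G, val e = [set u; v]%SET /\ adj u v.
Proof.
case: e => S /= /imset2P[u v _]; rewrite inE => /andP[_ uv] ->.
by exists u, v.
Qed.

Lemma edge_eq (u v u' v' : G) : [set u; v]%SET = [set u'; v']%SET ->
  (u = u' /\ v = v') \/ (u = v' /\ v = u').
Proof.
move=> E.
have : u \in [set u'; v'] by rewrite -E !inE eqxx.
have : v \in [set u'; v'] by rewrite -E !inE eqxx orbT.
have : u' \in [set u; v] by rewrite E !inE eqxx.
have : v' \in [set u; v] by rewrite E !inE eqxx orbT.
rewrite !inE.
by do 4![case/orP => /eqP ?]; subst; auto.
Qed.

Lemma labellable_total k : labellable k.+1 (@adj G) -> 0 < k -> has_total_labelling21 G k.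
Proof.
case=> phi [psi [pv pe ps pvv pee pve]] k0; rewrite /has_total_labelling21 k0 /=.
have /fin_all_exists[lab labP] : forall e : edge G, exists i : 'I_k.+1,
    forall u v, val e = [set u; v]%SET -> i = psi u v :> nat.
  move=> e; have [u [v [E uv]]] := edge_ends e.
  exists (Ordinal (pe u v uv)) => u' v'; rewrite E /= => /edge_eq[[-> ->]//|[-> ->]].
  exact: ps.
apply/existsP; exists [ffun x => match x with inl u => Ordinal (pv u) | inr e => lab e end].
apply/and3P; split; apply/forallP => x; apply/forallP => y; apply/implyP => xy; rewrite !ffunE.
- by have := pvv _ _ xy; apply: contra_neq => /(congr1 val).
- case/andP: xy => xy /existsP[w /andP[wx wy]].
  have [u [v [E uv]]] := edge_ends x; have [u' [v' [E' uv']]] := edge_ends y.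
  have [a [Ea wa]] : exists a, val x = [set w; a]%SET /\ adj w a.
    move: wx; rewrite /incident E !inE => /orP[]/eqP->; first by exists v.
    by exists u; rewrite setUC adj_sym.
  have [b [Eb wb]] : exists b, val y = [set w; b]%SET /\ adj w b.
    move: wy; rewrite /incident E' !inE => /orP[]/eqP->; first by exists v'.
    by exists u'; rewrite setUC adj_sym.
  have ab : a != b by apply: contra_neq xy => ab; apply: val_inj; rewrite /= Ea Eb ab.
  have := pee _ _ _ wa wb ab; apply: contra_neq => /(congr1 val) /=.
  by rewrite (labP _ _ _ Ea) (labP _ _ _ Eb).
- have [u [v [E uv]]] := edge_ends y.
  have [a [Ea wa]] : exists a, val y = [set x; a]%SET /\ adj x a.
    move: xy; rewrite /incident E !inE => /orP[]/eqP->; first by exists v.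
    by exists u; rewrite setUC adj_sym.
  by have := pve _ _ wa; rewrite (labP _ _ _ Ea) /far /=; lia.
Qed.

(** Besides the label of [v], one of its two neighbouring integers is a label, and
    neither can be used at [v]. *)
Lemma total_labelling_lower k (v : G) : has_total_labelling21 G k -> 0 < degree v -> degree v < k.
Proof.
case/andP=> k0 /existsP[c /and3P[_ /forallP cee /forallP cve]] d0.
have /fin_all_exists[E EP] : forall w : G, exists e : option (edge G),
    adj v w -> if e is Some e then val e = [set v; w]%SET else False.
  move=> w; case vw: (adj v w); last by exists None.
  by have [e eE _] := edge_of_adj vw; exists (Some e).
have [e0 _] : exists e0 : edge G, True.
  have /card_gt0P[w] : 0 < #|[set w | adj v w]| by [].
  by rewrite !inE => /EP; case: (E w) => // e _; exists e.
pose g (w : G) : 'I_k.+1 := c (inr (odflt e0 (E w))).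
have gE w : adj v w -> exists e : edge G, [/\ val e = [set v; w]%SET, incident v e & g w = c (inr e)].
  move=> /EP; rewrite /g; case: (E w) => // e eE; exists e; split=> //.
  by apply/(subsetP (_ : [set v; w]%SET \subset val e)); rewrite ?eE ?subxx // !inE eqxx.
have ginj : {in [set w | adj v w] &, injective g}.
  move=> w w'; rewrite !inE => /gE[e [eE ve ->]] /gE[e' [eE' ve' ->]] ce.
  have ee : e = e'.
    apply/eqP; apply/negPn/negP => ne; have := forallP (cee e) e'.
    by rewrite /adjacent_edges ne ce eqxx implybF /= => /existsPn/(_ v); rewrite ve ve'.
  have : [set v; w]%SET = [set v; w']%SET by rewrite -eE -eE' ee.
  by case/edge_eq => [[_ //]|[<- <-]].
pose near := [set i : 'I_k.+1 | ~~ (2 <= `|c (inl v) - i|)%N].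
have near2 : 1 < #|near|.
  (* The label above x, or below x when x is the greatest label. *)
  move: (c (inl v)) @near => x near; pose y : 'I_k.+1 := if (x : nat) == k then inord k.-1 else inord x.+1.
  have yE : y = (if (x : nat) == k then k.-1 else x.+1) :> nat.
    by rewrite /y; case: eqP => h; rewrite inordK //; have := ltn_ord x; move: h; clear; lia.
  have xy : x != y.
    by apply/eqP => /(congr1 val) /=; rewrite yE; case: eqP; move: k0; clear; lia.
  suff sub : [set x; y] \subset near by apply: leq_trans (subset_leq_card sub); rewrite cards2 xy.
  apply/subsetP => i; rewrite !inE => /orP[]/eqP->; first by clear; lia.
  by rewrite yE; case: eqP; clear; lia.
have sub : g @: [set w | adj v w] \subset ~: near.
  apply/subsetP => i /imsetP[w]; rewrite inE => /gE[e [eE ve gw]] ->.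
  by rewrite !inE negbK gw; have := forallP (cve v) e; rewrite ve.
have := subset_leq_card sub; rewrite (card_in_imset ginj) -/(degree v).
have := cardsC near; rewrite card_ord; move: near2; clear; lia.
Qed.

End Transfer.

Unset Implicit Arguments.
Set Strict Implicit.
Set Printing Implicit Defensive.

Theorem theorem1p5 (R : realType) (G : sgraph) (hplanar : planar R G)
    (hDelta : (12 <= max_degree G)%N) :
  (max_degree G + 1 <= lambda21T G)%N /\ (lambda21T G <= max_degree G + 2)%N.
Proof.
have [n5 n33] := planar_no_minors hplanar.
have dM (x : G) : deg (@adj G) x <= max_degree G.
  by rewrite -[deg _ _]/(degree x); apply: leq_bigmax.
have lab := minor_free_labellable hDelta (@adj_sym G) (@adj_irr G) dM n5 n33.
rewrite /lambda21T; case: ex_minnP => k hk kmin; split.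
  have G0 : 0 < #|G|.
    rewrite lt0n; apply/eqP => G0; have := hDelta; rewrite /max_degree big_pred0 // => x.
    by have := card0_eq G0 x; rewrite !inE.
  have [v vE] := eq_bigmax (@degree G) G0; rewrite -/(max_degree G) in vE.
  have := total_labelling_lower (v := v) hk; rewrite -vE addn1; apply.
  exact: leq_trans hDelta.
apply: kmin; apply: labellable_total; last by rewrite addn2.
by move: lab; rewrite addn3 addn2.
Qed.
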